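(* Let $1>\varepsilon'>\delta>\delta'$ be a decreasing sequence of positive real numbers with each term being sufficiently small in terms of the previous one. Then there is a constant $c_\delta>0$, depending only on $\delta$, such that the following holds. Let $A\subset\mathbb{Z}$ be a finite, non-empty set, and suppose there exists some $\Gamma\subseteq A\times A$ such that $|\Gamma|\ge(1-\delta')|A|^2$ and $|A+_\Gamma A|\le(4+\delta)|A|$. Then one of the following must hold. (1) There exists a $1$-dimensional progression $P\subseteq\mathbb{Z}$ with $|P|\ge c_\delta|A|$ such that $\frac{|A\cap P|}{|P|}\ge\frac12-\varepsilon'$. (2) There exists a proper $2$-dimensional progression $Q\subseteq\mathbb{Z}$ with $|Q|\ge c_\delta|A|$ such that $\frac{|A\cap Q|}{|Q|}\ge1-\varepsilon'$.
   Context: For $\Gamma\subseteq A\times A$, the restricted sumset is $A+_\Gamma A=\{a_1+a_2:(a_1,a_2)\in\Gamma\}$. For $d\in\mathbb{N}$, a $d$-dimensional progression is a set of the form $P=\{a_0+l_1a_1+\dots+l_da_d: 1\le l_i\le L_i,\ l_i \in \mathbb{Z}\ (1\le i\le d)\}$ with $a_0,\dots,a_d\in\mathbb{Z}$ and $L_1,\dots,L_d\in\mathbb{N}$ (positive integers); it is proper if $|P|=L_1L_2\cdots L_d$. ''Each term sufficiently small in terms of the previous one'' means that each term is at most some positive threshold depending only on the previous term. *)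

(* Defs.v *)
From HB Require Import structures.
From mathcomp Require Import all_boot all_order all_algebra.
From mathcomp Require Import finmap.
From mathcomp Require Import reals.

Set Implicit Arguments.
Unset Strict Implicit.
Unset Printing Implicit Defensive.

Import Order.TTheory GRing.Theory Num.Theory.

Local Open Scope ring_scope.

(* The ambient set A with G included in A x A does not affect the value. *)
Definition restricted_sumset (G : {fset int * int}) : {fset int} :=
  [fset (p.1 + p.2)%R | p : int * int in G]%fset.

Definition progression_data (d : nat) (a0 : int) (a : 'I_d -> int)
    (L : 'I_d -> nat) (P : {fset int}) : Prop :=
  (forall i, (0 < L i)%N) /\
  (forall x : int, x \in P <->
    exists l : 'I_d -> int,
      (forall i, 1 <= l i <= (L i)%:Z) /\ x = a0 + \sum_(i < d) l i * a i).

Definition is_progression (d : nat) (P : {fset int}) : Prop :=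
  exists (a0 : int) (a : 'I_d -> int) (L : 'I_d -> nat),
    progression_data a0 a L P.

(* Properness refers to a presentation (a0, a, L) of the set; a set is called
   proper when it has some presentation that is proper. *)
Definition is_proper_progression (d : nat) (P : {fset int}) : Prop :=
  exists (a0 : int) (a : 'I_d -> int) (L : 'I_d -> nat),
    progression_data a0 a L P /\ #|` P| = (\prod_(i < d) L i)%N.

(* Main.v *)
(**
Croot-Sisask almost periodicity gives a level set [V] of [1_A * 1_A] that is almost
invariant under translation by some [q] such that an interval of length [q] contains
a positive proportion of [A]. Cutting the integers into cells of length [q] and
reducing modulo [q], some heavy cell yields a subset [S] of [ZZ / q] most of whose
sums lie in a set [U] with [|U| <= (2 + o(1))|S|].

Start with [(T, X) = (S, S)] and iterate [(T, X) |-> (T :|: (X + e), X :&: (T - e))].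
If no choice of [e] makes progress, then an almost invariant set forces a subgroup, and
[S] has density about [1/2] on one of its cosets, which gives a progression in [A].
Otherwise [X] shrinks to a small set whose differences are almost periods of
[U]; sumsets of these differences have doubling less than [21/10] over many scales. A
large Fourier coefficient of such a sumset defines a homomorphism to [ZZ] on it, whence
a coset progression [P] of almost periods of [U]. Repeating the iteration for
[S] smoothed by [P] shows that [S] has density close to [1] on a translate of [P], unless
again a subgroup appears. Successive minima turn [P] into proper two-dimensional
progressions of integers, and averaging finds one on which [A] is dense.
*)

Require Import Defs.
From HB Require Import structures.
From mathcomp Require Import all_boot all_order all_algebra.
From mathcomp Require Import finmap.
From mathcomp Require Import boolp reals trigo.
From mathcomp Require Import ring lra zify.

Set Implicit Arguments.
Unset Strict Implicit.
Unset Printing Implicit Defensive.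

Import Order.TTheory GRing.Theory Num.Theory.

Local Open Scope ring_scope.

(** Almost invariance under [q] is what lowers the constant 4 to 2: sums of two elements of a cell
    of length [q] lie in a cell of length [2q], and the two halves of that cell have nearly the same
    residues of [V]. The constant 2 is exactly what e-transforms need. They preserve
    [|T| + |X| = 2|S|], so a translate of [T] by a typical element of [X] fills [U] up to about
    [|X|] elements. The smaller [X], the better the almost periods in [X - X]. A set has at most
    [2|U|] translations moving it by less than half, so the multiples of [X - X] grow on average by
    little more than 2 per doubling of the scale, like a one-dimensional set. The rate 21/10 is
    chosen above 2, with square below the 5 of the Fourier argument and cube below [8 * 3/2], the
    growth forced when the circle of [psi] does not close up. The modulus [q] comes from the set and
    is unbounded, so all constants are fixed before the group. The second dimension of the final
    progression comes from lifting residues to integers: subgroup and step together span a planar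
    lattice. *)

Ltac clia :=
  repeat match goal with H : is_true _ |- _ => revert H | H : @eq nat _ _ |- _ => revert H end;
  repeat (let n := fresh "n" in set n := #|_|; clearbody n);
  intros; lia.

(** * Translates, sumsets, subgroups and bad pairs in a finite abelian group *)

Section Basics.
Variable G : finZmodType.
Implicit Types (A B D E H S T X Z : {set G}) (s t u x y : G).

Lemma sum_memE A B : (\sum_(x in A) (x \in B : nat) = #|A :&: B|)%N.
Proof.
rewrite -sum1_card [RHS](eq_bigl (fun x => (x \in A) && (x \in B))); last first.
  by move=> x; rewrite inE.
by rewrite big_mkcondr /=; apply: eq_bigr => x _; case: (x \in B).
Qed.

Lemma sum_predE A (p : pred G) : (\sum_(x in A) (p x : nat) = #|[set x in A | p x]|)%N.
Proof.
rewrite (eq_bigr (fun x => (x \in [set y | p y] : nat))).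
  by rewrite sum_memE; apply: eq_card => x; rewrite !inE.
by move=> x _; rewrite inE.
Qed.

Definition shift A t := [set x | x - t \in A].

Lemma in_shift A t x : (x \in shift A t) = (x - t \in A).
Proof. by rewrite inE. Qed.

Lemma card_shift A t : #|shift A t| = #|A|.
Proof.
have -> : shift A t = (fun x => x + t) @: A.
  apply/setP => x; rewrite in_shift; apply/idP/imsetP.
    by move=> xA; exists (x - t) => //; rewrite subrK.
  by case=> y yA ->; rewrite addrK.
by rewrite card_imset //; apply: addIr.
Qed.

Lemma shift_shift A s t : shift (shift A s) t = shift A (s + t).
Proof. by apply/setP => x; rewrite !in_shift opprD addrA addrAC. Qed.

Lemma shift0 A : shift A 0 = A.
Proof. by apply/setP => x; rewrite in_shift subr0. Qed.

Lemma shiftD A B t : shift (A :\: B) t = shift A t :\: shift B t.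
Proof. by apply/setP => x; rewrite !inE. Qed.

Lemma shiftI A B t : shift (A :&: B) t = shift A t :&: shift B t.
Proof. by apply/setP => x; rewrite !inE. Qed.

Lemma shiftS A B t : A \subset B -> shift A t \subset shift B t.
Proof. by move/subsetP=> sAB; apply/subsetP=> x; rewrite !in_shift; apply: sAB. Qed.

(** Half the size of the symmetric difference of [A] and its translate, hence even and subadditive
    in [t]; its small values define the almost periods of [A]. *)
Definition nu A t := #|A :\: shift A t|.

Lemma nu0 A : nu A 0 = 0%N.
Proof. by rewrite /nu shift0 setDv cards0. Qed.

Lemma card_setD_triangle A B Z : (#|A :\: Z| <= #|A :\: B| + #|B :\: Z|)%N.
Proof.
apply: leq_trans (_ : #|(A :\: B) :|: (B :\: Z)| <= _)%N; last by rewrite cardsU leq_subr.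
apply: subset_leq_card; apply/subsetP => x; rewrite !inE.
by case: (x \in A); case: (x \in B); case: (x \in Z).
Qed.

Lemma nuN A t : nu A (- t) = nu A t.
Proof.
have e : (#|A :\: shift A t| = #|shift A t :\: A|)%N.
  have h1 := cardsID (shift A t) A; have h2 := cardsID A (shift A t).
  by rewrite [shift A t :&: A]setIC card_shift in h2; clia.
by rewrite /nu e -(card_shift (A :\: _) t) shiftD shift_shift addNr shift0.
Qed.

Lemma nuD A s t : (nu A (s + t)%R <= nu A s + nu A t)%N.
Proof.
apply: leq_trans (card_setD_triangle _ (shift A t) _) _.
by rewrite addnC leq_add2r -shift_shift -shiftD card_shift.
Qed.

Definition sumset A B := [set a + b | a in A, b in B].

Lemma sumsetP A B x : reflect (exists a b, [/\ a \in A, b \in B & x = a + b]) (x \in sumset A B).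
Proof.
apply: (iffP imset2P) => [[a b aA bB ->]|[a [b [aA bB ->]]]]; first by exists a, b.
by exists a b.
Qed.

Lemma mem_sumset A B a b : a \in A -> b \in B -> a + b \in sumset A B.
Proof. by move=> aA bB; apply/sumsetP; exists a, b. Qed.

Lemma sumsetC A B : sumset A B = sumset B A.
Proof.
by apply/setP => x; apply/sumsetP/sumsetP => -[a [b [? ? ->]]]; exists b, a; rewrite addrC.
Qed.

Lemma sumsetA A B Z : sumset A (sumset B Z) = sumset (sumset A B) Z.
Proof.
apply/setP => x; apply/sumsetP/sumsetP.
  move=> [a [_ [aA /sumsetP[b [c [bB cZ ->]]] ->]]].
  by exists (a + b), c; rewrite addrA; split=> //; apply: mem_sumset.
move=> [_ [c [/sumsetP[a [b [aA bB ->]]] cZ ->]]].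
by exists a, (b + c); rewrite addrA; split=> //; apply: mem_sumset.
Qed.

Definition diffset A B := [set a - b | a in A, b in B].

Lemma diffsetP A B x : reflect (exists a b, [/\ a \in A, b \in B & x = a - b]) (x \in diffset A B).
Proof.
apply: (iffP imset2P) => [[a b aA bB ->]|[a [b [aA bB ->]]]]; first by exists a, b.
by exists a b.
Qed.

Lemma mem_diffset A B a b : a \in A -> b \in B -> a - b \in diffset A B.
Proof. by move=> aA bB; apply/diffsetP; exists a, b. Qed.

Lemma sub_card_diffset A B : B != set0 -> (#|A| <= #|diffset A B|)%N.
Proof.
case/set0Pn=> b bB; rewrite -(card_shift A (- b)); apply/subset_leq_card/subsetP => x.
by rewrite in_shift opprK => xA; apply/diffsetP; exists (x + b), b; rewrite addrK.
Qed.

Definition symmetric A := [forall x in A, - x \in A].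

Lemma symmetricP A : reflect {in A, forall x, - x \in A} (symmetric A).
Proof. exact: forall_inP. Qed.

Definition subgroup H := (0 \in H) && [forall x in H, forall y in H, x - y \in H].

Lemma subgroupP H : reflect (0 \in H /\ {in H &, forall x y, x - y \in H}) (subgroup H).
Proof.
apply: (iffP andP) => [[h0 /forall_inP h]|[h0 h]]; split=> //.
  by move=> x y xH yH; move/forall_inP: (h x xH); apply.
by apply/forall_inP => x xH; apply/forall_inP => y yH; apply: h.
Qed.

Lemma subgroupD H x y : subgroup H -> x \in H -> y \in H -> x + y \in H.
Proof.
case/subgroupP => h0 hB xH yH; rewrite -[y]opprK; apply: (hB) => //.
by rewrite -sub0r; apply: hB.
Qed.

Lemma subgroupN H x : subgroup H -> x \in H -> - x \in H.
Proof. by case/subgroupP => h0 hB xH; rewrite -sub0r; apply: hB. Qed.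

Lemma subgroup_gt0 H : subgroup H -> (0 < #|H|)%N.
Proof. by case/subgroupP => h0 _; rewrite card_gt0; apply/set0Pn; exists 0. Qed.

(* If [|D + D| < 3|D|/2], any two elements of [D - D] have more than half of
   the elements of [D] in common as middle points of their representations. *)
Lemma subgroup_of_small_doubling D : symmetric D -> D != set0 ->
  (2 * #|sumset D D| < 3 * #|D|)%N -> subgroup (sumset D D).
Proof.
move=> /symmetricP symD /set0Pn[d0 d0D] small.
have rep x : x \in sumset D D -> (#|D| < 2 * #|D :&: shift D x|)%N.
  case/sumsetP=> a [b [aD bD ->]].
  have -> : #|D :&: shift D (a + b)| = #|shift D (- a) :&: shift D b|.
    by rewrite -(card_shift _ (- a)) shiftI shift_shift addrC addrA addNr add0r.
  have := cardsUI (shift D (- a)) (shift D b); rewrite !card_shift.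
  have : (#|shift D (- a) :|: shift D b| <= #|sumset D D|)%N.
    apply/subset_leq_card/subsetP => w; rewrite inE !in_shift => /orP[] h.
      by apply/sumsetP; exists (w + a), (- a); rewrite addrK -{1}[a]opprK; split=> //; apply: symD.
    by apply/sumsetP; exists (w - b), b; rewrite subrK.
  by clia.
apply/subgroupP; split.
  by apply/sumsetP; exists d0, (- d0); rewrite subrr; split=> //; apply: symD.
move=> x y /rep hx hy.
have {}hy : (#|D| < 2 * #|D :&: shift D y|)%N by apply: rep.
have /card_gt0P[z] : (0 < #|(D :&: shift D x) :&: (D :&: shift D y)|)%N.
  have := cardsUI (D :&: shift D x) (D :&: shift D y).
  have : (#|(D :&: shift D x) :|: (D :&: shift D y)| <= #|D|)%N.
    by apply: subset_leq_card; rewrite subUset !subsetIl.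
  by clia.
rewrite !inE => /andP[/andP[zD zx] /andP[_ zy]].
apply/sumsetP; exists (x - z), (z - y); rewrite addrA subrK; split=> //.
by rewrite -opprB; apply: symD.
Qed.

Lemma sum_shiftI A B : (\sum_t #|A :&: shift B t| = #|A| * #|B|)%N.
Proof.
transitivity (\sum_t \sum_(x in A) (x \in shift B t : nat))%N.
  by apply: eq_bigr => t _; rewrite sum_memE.
rewrite exchange_big /= -sum_nat_const; apply: eq_bigr => x xA.
rewrite -(sum1_card (mem B)) [RHS]big_mkcond /= (reindex_inj (inv_inj (subKr x))) /=.
by apply: eq_bigr => t _; rewrite in_shift opprB addrCA subrr addr0; case: (t \in B).
Qed.

Definition bad T X S := (\sum_(t in T) \sum_(x in X) ((t + x)%R \notin S : nat))%N.

Lemma badC T X S : bad T X S = bad X T S.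
Proof.
rewrite /bad exchange_big; apply: eq_bigr => t _; apply: eq_bigr => x _.
by rewrite addrC.
Qed.

Lemma bad_row T X S : bad T X S = (\sum_(x in X) #|shift T x :\: S|)%N.
Proof.
rewrite /bad exchange_big; apply: eq_bigr => x _.
rewrite sum_predE -(card_shift [set _ in T | _] x); apply: eq_card => y.
by rewrite !inE subrK andbC.
Qed.

Lemma leq_sum_sub (I : finType) (A B : {set I}) (F : I -> nat) :
  A \subset B -> (\sum_(i in A) F i <= \sum_(i in B) F i)%N.
Proof.
move=> sAB; rewrite [leqRHS](big_setID A) /= (setIidPr sAB).
exact: leq_addr.
Qed.

Lemma bad_sub T X T' X' S : T \subset T' -> X \subset X' -> (bad T X S <= bad T' X' S)%N.
Proof.
move=> sT sX; apply: leq_trans (leq_sum_sub _ sT); apply: leq_sum => t _.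
exact: leq_sum_sub.
Qed.

Lemma leq_sum_setU (I : finType) (A B : {set I}) (F : I -> nat) :
  (\sum_(i in A :|: B) F i <= \sum_(i in A) F i + \sum_(i in B) F i)%N.
Proof.
rewrite (big_setID A) /= [in X in (X + _ <= _)%N](setIidPr (subsetUl _ _)) leq_add2l.
by apply: leq_sum_sub; rewrite setDUl setDv set0U subsetDl.
Qed.

Lemma sum_shift B e (F : G -> nat) :
  (\sum_(t in shift B e) F t = \sum_(t in B) F (t + e)%R)%N.
Proof.
rewrite big_mkcond [RHS]big_mkcond /= (reindex_inj (addIr e)) /=.
by apply: eq_bigr => t _; rewrite in_shift addrK.
Qed.

(** A pair with first entry in [T] is an old pair. A pair [(x + e, z)] with [x] in [X] and [z + e]
    in [T] has the same sum as the old pair [(z + e, x)]. *)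
Lemma bad_etransform T X S e :
  (bad (T :|: shift X e) (X :&: shift T (- e)) S <= 2 * bad T X S)%N.
Proof.
rewrite mul2n -addnn; apply: leq_trans (leq_sum_setU _ _ _) _; apply: leq_add.
  by apply: bad_sub; rewrite ?subsetIl.
rewrite sum_shift (badC T) /bad; apply: leq_sum => y _.
rewrite [leqLHS](eq_bigr (fun z => (y + (z + e)%R)%R \notin S : nat)); last first.
  by move=> z _; rewrite addrA addrAC.
rewrite -(sum_shift _ e (fun t => (y + t)%R \notin S : nat)).
by apply: leq_sum_sub; rewrite shiftI shift_shift addNr shift0 subsetIr.
Qed.

Lemma card_etransform T X e :
  (#|T :|: shift X e| + #|X :&: shift T (- e)| = #|T| + #|X|)%N.
Proof.
have -> : #|X :&: shift T (- e)| = #|T :&: shift X e|.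
  by rewrite -(card_shift _ e) shiftI shift_shift addNr shift0 setIC.
by rewrite cardsUI card_shift.
Qed.

(** [Z] is a union of cosets, so each point of [S :&: Z] lies in [shift H z] for exactly [|H|]
    elements [z] of [Z]; the best [z] is at least the average. *)
Lemma invariant_density H Z S : subgroup H -> sumset Z H \subset Z -> Z != set0 ->
  exists z, (#|H| * #|S :&: Z| <= #|S :&: shift H z| * #|Z|)%N.
Proof.
move=> sgH invZ /set0Pn[z0 z0Z].
pose z := [arg max_(z > z0 in Z) #|S :&: shift H z|].
exists z; rewrite /z; case: arg_maxnP => // {}z zZ zmax.
suff -> : (#|H| * #|S :&: Z| = \sum_(w in Z) #|S :&: shift H w|)%N.
  by rewrite mulnC -sum_nat_const; apply: leq_sum => w; apply: zmax.
transitivity (\sum_(w in Z) \sum_(x in S) (x \in shift H w : nat))%N; last first.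
  by apply: eq_bigr => w _; rewrite sum_memE.
rewrite exchange_big /= mulnC -sum_nat_const.
rewrite [RHS](big_setID Z) /= [X in (_ = _ + X)%N]big1 ?addn0.
  apply: eq_bigr => x xSZ; rewrite sum_predE.
  rewrite -(card_shift H x); apply: eq_card => w; rewrite !inE.
  have xZ : x \in Z by move: xSZ; rewrite inE => /andP[].
  have -> : (x - w \in H) = (w - x \in H).
    by apply/idP/idP => h; rewrite -opprB; apply: subgroupN.
  case h : (w - x \in H); rewrite ?andbF //.
  have -> // : w \in Z.
  by apply: (subsetP invZ); apply/sumsetP; exists x, (w - x); split=> //; rewrite addrC subrK.
move=> x; rewrite inE => /andP[xZ xS]; rewrite big1 // => w wZ.
rewrite in_shift; case h : (x - w \in H) => //; case/negP: xZ.
by apply: (subsetP invZ); apply/sumsetP; exists w, (x - w); split=> //; rewrite addrC subrK.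
Qed.

End Basics.

(** * Almost invariance and e-transforms *)

Section AlmostInvariance.
Variable G : finZmodType.
Implicit Types (A B D E H S T X Z : {set G}) (s t u x y : G).

(** Each such [t] has at least [|A| / 2] representations as a difference in [A], out of [|A| ^ 2] in
    total. *)
Lemma card_ball A r : (2 * r <= #|A|)%N -> (0 < #|A|)%N ->
  (#|[set t | nu A t <= r]%N| <= 2 * #|A|)%N.
Proof.
move=> rA A0; rewrite -(leq_pmul2r A0).
rewrite -mulnA -(sum_shiftI A A) -sum_nat_const big_distrr /=.
rewrite big_mkcond /=; apply: leq_sum => t _; rewrite inE; case: ifP => // h.
by have := cardsID (shift A t) A; rewrite -/(nu A t); clia.
Qed.

(* The sets of [2 ^ i * m]-almost periods of [E], [i <= J], have at most [2|E|]
   elements, so one of them has doubling less than [3/2]. *)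
Lemma almost_invariant_subgroup E D (m J : nat) :
  symmetric D -> D != set0 -> (forall t, t \in D -> nu E t <= m)%N ->
  (2 * (2 ^ J * m) <= #|E|)%N -> (0 < #|E|)%N ->
  (2 ^ J * (2 * #|E|) < 3 ^ J * #|D|)%N ->
  exists H, [/\ subgroup H, D \subset H & forall h, h \in H -> (nu E h <= 2 ^ J * m)%N].
Proof.
move=> symD Dn0 Dm mE E0 big.
pose B i := [set t | nu E t <= 2 ^ i * m]%N.
have symB i : symmetric (B i) by apply/symmetricP => x; rewrite !inE nuN.
have B0 i : 0 \in B i by rewrite inE nu0.
have BB i : sumset (B i) (B i) \subset B i.+1.
  apply/subsetP => _ /sumsetP[a [b [+ + ->]]]; rewrite !inE => ha hb.
  by apply: leq_trans (nuD _ _ _) _; rewrite expnS; lia.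
have Bmono i j : (i <= j)%N -> B i \subset B j.
  move=> ij; apply/subsetP => t; rewrite !inE => /leq_trans; apply.
  by rewrite leq_mul2r leq_exp2l // ij orbT.
have DB : D \subset B 0%N by apply/subsetP => t /Dm; rewrite inE mul1n.
have [/existsP[i hi]|/existsPn none] :=
  boolP [exists i : 'I_J, (2 * #|sumset (B i) (B i)| < 3 * #|B i|)%N].
  exists (sumset (B i) (B i)); split.
  - by apply: subgroup_of_small_doubling hi; rewrite ?symB //; apply/set0Pn; exists 0.
  - apply: subset_trans DB _; apply: subset_trans (Bmono 0%N i (leq0n _)) _.
    by apply/subsetP => x xB; apply/sumsetP; exists x, 0; rewrite addr0.
  - by move=> h /(subsetP (BB i)) /(subsetP (Bmono _ _ (ltn_ord i))); rewrite inE.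
have grow i : (i <= J)%N -> (3 ^ i * #|D| <= 2 ^ i * #|B i|)%N.
  elim: i => [_|i IH iJ]; first by rewrite !mul1n subset_leq_card.
  have := none (Ordinal iJ); rewrite -leqNgt /= => h.
  have {}h : (3 * #|B i| <= 2 * #|B i.+1|)%N.
    by apply: leq_trans h _; rewrite leq_mul2l subset_leq_card ?orbT.
  rewrite !expnS -!mulnA; apply: leq_trans (_ : 3 * (2 ^ i * #|B i|) <= _)%N.
    by rewrite leq_mul2l IH ?orbT // ltnW.
  by rewrite mulnCA [leqRHS]mulnCA leq_mul2l h orbT.
have := card_ball mE E0; have := grow J (leqnn _); rewrite -/(B J) => h1 h2.
by move: big; rewrite ltnNge => /negP[]; apply: leq_trans h1 _; rewrite leq_mul2l h2 orbT.
Qed.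

Lemma sum_subgroupN H (F : G -> nat) : subgroup H ->
  (\sum_(h in H) F h = \sum_(h in H) F (- h)%R)%N.
Proof.
move=> sgH; rewrite (reindex_inj oppr_inj) /=; apply: eq_bigl => h.
by apply/idP/idP => k; [rewrite -[h]opprK|]; apply: subgroupN.
Qed.

(** [Z] is the union of the cosets at least half filled by [E]. A point of [E] outside [Z], or of
    [Z] outside [E], is therefore moved across the boundary of [E] by at least half of [H], while
    each [h] accounts for at most [m] crossings. *)
Lemma invariant_hull E H m : subgroup H -> (forall h, h \in H -> nu E h <= m)%N ->
  exists Z, [/\ sumset Z H \subset Z, (#|E :\: Z| <= 2 * m)%N & (#|Z :\: E| <= 2 * m)%N].
Proof.
move=> sgH nuH; exists [set z | #|H| <= 2 * #|E :&: shift H z|]%N.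
have H0 := subgroup_gt0 sgH.
have tot : (\sum_(h in H) nu E h <= #|H| * m)%N by rewrite -sum_nat_const leq_sum.
split.
- apply/subsetP => _ /sumsetP[z [h [+ hH ->]]]; rewrite !inE.
  have -> // : shift H (z + h) = shift H z.
  apply/setP => w; rewrite !in_shift opprD addrA.
  apply/idP/idP => k; last by apply: subgroupD k _ => //; apply: subgroupN.
  by rewrite -[w - z](subrK h); apply: subgroupD.
- have e : (\sum_(h in H) nu E h = \sum_(z in E) #|shift H z :\: E|)%N.
    transitivity (\sum_(h in H) \sum_(z in E) ((z - h)%R \notin E : nat))%N.
      apply: eq_bigr => h _; rewrite sum_predE; apply: eq_card => z.
      by rewrite !inE andbC.
    rewrite exchange_big; apply: eq_bigr => z _.
    rewrite sum_subgroupN // [LHS](eq_bigr (fun h => ((h + z)%R \notin E : nat))).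
      rewrite -(sum_shift H z (fun w => (w \notin E : nat))) sum_predE.
      by apply: eq_card => w; rewrite !inE andbC.
    by move=> h _; rewrite opprK addrC.
  rewrite -(leq_pmul2r H0); apply: leq_trans (_ : (2 * \sum_(z in E) #|shift H z :\: E| <= _))%N.
    rewrite -sum_nat_const big_distrr /=; apply: leq_trans (leq_sum_sub _ (subsetDl _ _)).
    apply: leq_sum => z; rewrite !inE => /andP[+ _].
    have := cardsID E (shift H z); rewrite card_shift setIC; clia.
  by rewrite -e -mulnA leq_mul2l [leqRHS]mulnC tot orbT.
- have e : (\sum_(h in H) nu E h = \sum_(w in ~: E) #|E :&: shift H w|)%N.
    transitivity (\sum_(h in H) \sum_(w in ~: E) ((w - h)%R \in E : nat))%N.
      apply: eq_bigr => h _; rewrite -nuN /nu -(card_shift _ h) shiftD shift_shift addNr shift0.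
      by rewrite sum_predE; apply: eq_card => z; rewrite !inE.
    rewrite exchange_big; apply: eq_bigr => z _.
    rewrite sum_subgroupN // [LHS](eq_bigr (fun h => ((h + z)%R \in E : nat))).
      rewrite -(sum_shift H z (fun w => (w \in E : nat))) sum_predE.
      by apply: eq_card => w; rewrite !inE andbC.
    by move=> h _; rewrite opprK addrC.
  rewrite -(leq_pmul2r H0); apply: leq_trans (_ : (2 * \sum_(w in ~: E) #|E :&: shift H w| <= _))%N.
    rewrite -sum_nat_const big_distrr /=.
    apply: leq_trans (leq_sum_sub (B := ~: E) _ _).
      by apply: leq_sum => z; rewrite !inE => /andP[_ ].
    by apply/subsetP => z; rewrite !inE => /andP[].
  by rewrite -e -mulnA leq_mul2l [leqRHS]mulnC tot orbT.
Qed.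

End AlmostInvariance.

Section Stuck.
Variables (R : realFieldType) (G : finZmodType).
Implicit Types (A B D E H S T U X Z : {set G}) (e t u x y : G).

Local Notation "A '%:c'" := (#|A|%:R : R) (at level 2, format "A %:c").

(** For at least half of the [z] in [X] both [t + z] and [y + z] lie in [U], so [t - y] has at least
    [|X| / 2] representations as a difference in [U]. *)
Lemma card_diffset_good X U T' X' :
  (forall t, t \in T' -> 4 * #|[set z in X | (t + z)%R \notin U]| <= #|X|)%N ->
  (forall y, y \in X' -> 4 * #|[set z in X | (y + z)%R \notin U]| <= #|X|)%N ->
  (#|diffset T' X'| * #|X| <= 2 * (#|U| * #|U|))%N.
Proof.
move=> goodT goodX; rewrite -sum_nat_const -(sum_shiftI U U) big_distrr /=.
rewrite big_mkcond /=; apply: leq_sum => e _; case: ifP => // /diffsetP[t [y [tT yX ->]]].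
have sub : (#|[set z in X | (t + z)%R \in U & (y + z)%R \in U]| <= #|U :&: shift U (t - y)%R|)%N.
  rewrite -(card_shift _ t); apply/subset_leq_card/subsetP => w.
  by rewrite !inE opprB [t + (w - t)]addrC subrK [w + (y - t)]addrCA => /and3P[_ -> ->].
have := goodT t tT; have := goodX y yX.
have : (#|X| <= #|[set z in X | (t + z)%R \in U & (y + z)%R \in U]| +
   #|[set z in X | (t + z)%R \notin U]| + #|[set z in X | (y + z)%R \notin U]|)%N.
  have := cardsUI [set z in X | (t + z)%R \notin U] [set z in X | (y + z)%R \notin U].
  have : (#|X| <= #|[set z in X | (t + z)%R \in U & (y + z)%R \in U] :|:
    ([set z in X | (t + z)%R \notin U] :|: [set z in X | (y + z)%R \notin U])|)%N.
    apply/subset_leq_card/subsetP => z zX; rewrite !inE zX /=.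
    by case: (_ \in U); case: (_ \in U).
  have := cardsUI [set z in X | (t + z)%R \in U & (y + z)%R \in U]
    ([set z in X | (t + z)%R \notin U] :|: [set z in X | (y + z)%R \notin U]).
  clia.
by move: sub; clia.
Qed.

Lemma markov (I : finType) (P : {set I}) (F : I -> nat) (a : R) :
  [set i in P | (a < (F i)%:R)%R]%:c * a <= (\sum_(i in P) F i)%:R.
Proof.
rewrite mulrC mulr_natr -sumr_const natr_sum.
apply: le_trans (_ : \sum_(i in [set i in P | (a < (F i)%:R)%R]) (F i)%:R <= _).
  by apply: ler_sum => i; rewrite inE => /andP[_ /ltW].
rewrite -!natr_sum ler_nat; apply: leq_sum_sub.
by apply/subsetP => i; rewrite inE => /andP[].
Qed.

Lemma markov_good (I : finType) (P : {set I}) (F : I -> nat) (a r : R) : 0 < a ->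
  (\sum_(i in P) F i)%:R <= r * a -> P%:c <= r + [set i in P | ~~ (a < (F i)%:R)]%:c.
Proof.
move=> a0 h; have := le_trans (markov P F a) h; rewrite ler_pM2r // => {}h.
have <- : ([set i in P | a < (F i)%:R]%:c + [set i in P | ~~ (a < (F i)%:R)]%:c = P%:c).
  rewrite -natrD -(cardsID [set i in P | a < (F i)%:R] P); congr (_ + _)%:R; apply: eq_card => i.
    by rewrite !inE andbA andbb.
  by rewrite !inE; case: (i \in P); rewrite ?andbT ?andbF.
by rewrite lerD2r.
Qed.

(** The size of the second set after the e-transform by [e], which is also the number of
    representations of [e] as an element of [T] minus one of [X]. *)
Definition overlap T X e := #|X :&: shift T (- e)|.

Lemma overlapE T X e : overlap T X e = (\sum_(y in X) ((y + e)%R \in T : nat))%N.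
Proof. by rewrite /overlap -sum_memE; apply: eq_bigr => y _; rewrite in_shift opprK. Qed.

Lemma sum_overlap T X : (\sum_e overlap T X e = #|X| * #|T|)%N.
Proof. by rewrite -sum_shiftI (reindex_inj oppr_inj) /=; apply: eq_bigr => e _; rewrite /overlap opprK. Qed.

Lemma sum_overlap_in T X E :
  (\sum_(e in E) overlap T X e = \sum_(y in X) #|shift E y :&: T|)%N.
Proof.
rewrite (eq_bigr _ (fun e _ => overlapE T X e)) exchange_big /=; apply: eq_bigr => y _.
by rewrite -sum_memE sum_shift; apply: eq_bigr => e _; rewrite addrC.
Qed.

Variables (eps e1 th b : R) (J : nat).
Hypotheses (eps0 : 0 < eps) (eps1 : eps <= 1) (e10 : 0 < e1) (th0 : 0 < th).
Hypothesis bE : 16 * b <= e1 * eps ^+ 2.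
Hypothesis thE : 36 * th <= e1 * eps.
Hypothesis JE : 16 * 2 ^+ J < eps * 3 ^+ J.
Hypothesis e1J : 50 * 2 ^+ J * e1 <= 1.

(* As no [e] gives an intermediate overlap, almost all the mass of the overlaps
   sits on a set [E] of about [|T|] values of [e] with almost full overlap. For
   most [y] in [X] the translate [E + y] is then close to [T], so the differences
   of such [y] are almost periods of [E]. *)
Lemma stuck_subgroup (S U T X : {set G}) :
  S != set0 -> U%:c <= 3 * S%:c -> X \subset S -> S \subset T ->
  (#|T| + #|X| = 2 * #|S|)%N -> eps * S%:c <= X%:c ->
  (bad T X U)%:R <= b * S%:c ^+ 2 ->
  (forall e, ~ (th * X%:c <= (overlap T X e)%:R <= (1 - th) * X%:c)) ->
  exists H Z, [/\ subgroup H, sumset Z H \subset Z, eps / 2 * S%:c <= H%:c,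
    (S :\: Z)%:c <= 40 * 2 ^+ J * e1 * S%:c & Z%:c <= U%:c + 40 * 2 ^+ J * e1 * S%:c].
Proof.
move=> Sn0 US XS ST TX Xbig badb noint.
have J1 : 1 <= 2 ^+ J :> R by apply: exprn_ege1; lra.
have e1s : 50 * e1 <= 1.
  by apply: le_trans e1J; rewrite ler_pM2r // ler_peMr.
set s := S%:c in US Xbig badb *; set x := X%:c in Xbig noint *.
set t := T%:c.
have s0 : 0 < s by rewrite /s ltr0n card_gt0.
have x0 : 0 < x by apply: lt_le_trans Xbig; apply: mulr_gt0.
have txs : t + x = 2 * s by rewrite /t /x /s -natrD TX natrM.
have st : s <= t by rewrite /s /t ler_nat subset_leq_card.
have xs : x <= s by rewrite /s /x ler_nat subset_leq_card.
have XT := subset_trans XS ST.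
have bs : b * s ^+ 2 <= e1 * x ^+ 2 / 16.
  have : 16 * b * s ^+ 2 <= e1 * eps ^+ 2 * s ^+ 2 by rewrite ler_pM2r ?exprn_gt0.
  have : (eps * s) ^+ 2 <= x ^+ 2 by apply: lerXn2r; rewrite ?nnegrE ?mulr_ge0 // ltW.
  by rewrite -(ler_pM2l e10) exprMn; lra.
have badT : (bad T X U = \sum_(u in T) #|[set z in X | (u + z)%R \notin U]|)%N.
  by apply: eq_bigr => u _; rewrite sum_predE.
have badX : (bad T X U = \sum_(u in X) #|[set z in T | (u + z)%R \notin U]|)%N.
  by rewrite badC; apply: eq_bigr => u _; rewrite sum_predE.
(* Both sets drop few elements. [X'] is tested against all of [T], but with threshold [|X| / 4]; as
   [X] lies in [T], its elements are also good for [X], as [card_diffset_good] requires. *)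
pose T' := [set u in T | 4 * #|[set z in X | (u + z)%R \notin U]| <= #|X|]%N.
pose X' := [set u in X | 4 * #|[set z in T | (u + z)%R \notin U]| <= #|X|]%N.
have T'c : (T :\: T')%:c <= e1 / 4 * x.
  have : (T :\: T')%:c * (x / 4) <= (bad T X U)%:R.
    rewrite badT; apply: le_trans (markov _ _ (x / 4)); apply: ler_wpM2r; first by lra.
    rewrite ler_nat; apply/subset_leq_card/subsetP => u; rewrite !inE.
    by move=> /andP[+ uT]; rewrite uT /= -ltnNge -(ltr_nat R) natrM -/x; lra.
  by move: bs badb; rewrite !expr2; nra.
have X'c : (X :\: X')%:c <= e1 / 4 * x.
  have : (X :\: X')%:c * (x / 4) <= (bad T X U)%:R.
    rewrite badX; apply: le_trans (markov _ _ (x / 4)); apply: ler_wpM2r; first by lra.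
    rewrite ler_nat; apply/subset_leq_card/subsetP => u; rewrite !inE.
    by move=> /andP[+ uT]; rewrite uT /= -ltnNge -(ltr_nat R) natrM -/x; lra.
  by move: bs badb; rewrite !expr2; nra.
have dc : (diffset T' X')%:c * x <= 18 * s ^+ 2.
  have := @card_diffset_good X U T' X'.
  rewrite -(ler_nat R) !natrM => h; apply: le_trans (h _ _) _.
  - by move=> u; rewrite inE => /andP[].
  - move=> u; rewrite inE => /andP[_]; apply: leq_trans; rewrite leq_mul2l /=.
    apply/subset_leq_card/subsetP => z; rewrite !inE => /andP[/(subsetP XT) -> ->] //.
  - by rewrite expr2; have : 0 <= U%:c := ler0n _ _; nra.
pose E := [set e | th * x <= (overlap T X e)%:R].
have Emass : (1 - e1) * (x * t) <= (\sum_(e in E) overlap T X e)%:R.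
  have le_ov e : (overlap T' X' e <= overlap T X e)%N.
    apply: subset_leq_card; apply: setISS; first by apply/subsetP => u; rewrite inE => /andP[].
    by apply: shiftS; apply/subsetP => u; rewrite inE => /andP[].
  have hE : (\sum_(e in E) overlap T' X' e <= \sum_(e in E) overlap T X e)%N.
    by apply: leq_sum.
  (* Off [E] an overlap is below [th * x], and only the at most [18 * s ^+ 2 / x] differences of
     [T'] and [X'] contribute. *)
  have hC : (\sum_(e in ~: E) overlap T' X' e)%:R <= (diffset T' X')%:c * (th * x).
    rewrite mulrC mulr_natr -sumr_const natr_sum.
    rewrite (big_setID (diffset T' X')) /= [X in _ + X]big1 ?addr0; last first.
      move=> e; rewrite inE => /andP[eN _]; apply/eqP; rewrite pnatr_eq0 cards_eq0.
      rewrite -subset0; apply/subsetP => y; rewrite inE in_shift opprK => /andP[yX yT].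
      by case/negP: eN; apply/diffsetP; exists (y + e), y; rewrite addrAC subrr add0r.
    apply: le_trans (_ : \sum_(i in ~: E :&: diffset T' X') th * x <= _).
      apply: ler_sum => e; rewrite !inE => /andP[+ _]; rewrite -ltNge => /ltW.
      by apply: le_trans; rewrite ler_nat.
    rewrite !sumr_const -[leLHS]mulr_natr -[leRHS]mulr_natr ler_wpM2l ?ler_nat ?mulr_ge0 ?ltW //.
    by apply/subset_leq_card/subsetIr.
  have tot : (\sum_(e in E) overlap T' X' e + \sum_(e in ~: E) overlap T' X' e = #|X'| * #|T'|)%N.
    rewrite -sum_overlap [RHS](bigID (mem E)) /=; congr (_ + _)%N.
    by apply: eq_bigl => e; rewrite inE.
  move: hE tot; rewrite -(ler_nat R) => hE /(congr1 (fun n => n%:R : R)); rewrite natrD natrM.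
  have cT : T'%:c = t - (T :\: T')%:c.
    rewrite /t -(cardsID T' T) natrD addrK; congr (_%:R); apply: eq_card => u.
    by rewrite !inE; case: (u \in T).
  have cX : X'%:c = x - (X :\: X')%:c.
    rewrite /x -(cardsID X' X) natrD addrK; congr (_%:R); apply: eq_card => u.
    by rewrite !inE; case: (u \in X).
  have hd : (diffset T' X')%:c * (th * x) <= e1 / 2 * (x * t).
    have a0 : th * ((diffset T' X')%:c * x) <= th * (18 * s ^+ 2) by rewrite ler_pM2l.
    have a1 : e1 * (eps * s * s) <= e1 * (x * t).
      by rewrite ler_pM2l //; apply: ler_pM => //; rewrite ?mulr_ge0 // ltW.
    have a2 : 36 * th * (s * s) <= e1 * eps * (s * s) by rewrite ler_pM2r ?mulr_gt0.
    by clear - a0 a1 a2; rewrite expr2 in a0; lra.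
  rewrite cT cX => tot; move: hE hC hd tot T'c X'c.
  have : 0 <= (T :\: T')%:c := ler0n _ _; have : 0 <= (X :\: X')%:c := ler0n _ _.
  move: (\sum_(e in E) _)%:R (\sum_(e in E) _)%:R (\sum_(e in ~: E) _)%:R => a1 a2 a3.
  move: ((T :\: T')%:c) ((X :\: X')%:c) (_ * (th * x)) => p q r.
  move=> q0 p0 h1 h2 h3 h4 h5 h6.
  have h7 : x * p <= x * (e1 / 4 * x) by rewrite ler_pM2l.
  have h8 : q * t <= e1 / 4 * x * t by rewrite ler_wpM2r // (le_trans _ st) ?ltW.
  have h9 : e1 * x * x <= e1 * x * t by rewrite ler_pM2l ?mulr_gt0 // (le_trans xs).
  have h10 : 0 <= q * p by apply: mulr_ge0.
  by clear - h1 h2 h3 h4 h7 h8 h9 h10; lra.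
(* Without intermediate overlaps, those on [E] exceed [(1 - th) * x]. *)
have Eup : E%:c * ((1 - th) * x) <= x * t.
  have : (\sum_(e in E) overlap T X e)%:R <= x * t.
    rewrite /x /t -natrM ler_nat -sum_overlap [leqRHS](bigID (mem E)) /=.
    exact: leq_addr.
  apply: le_trans; rewrite mulrC mulr_natr -sumr_const natr_sum.
  apply: ler_sum => e; rewrite inE => eE; rewrite leNgt; apply/negP => eE'.
  by apply: (noint e); rewrite eE (ltW eE').
have Elow : (1 - e1) * t <= E%:c.
  rewrite -(ler_pM2r x0); apply: le_trans (_ : (\sum_(e in E) overlap T X e)%:R <= _).
    by move: Emass; nra.
  rewrite /x -natrM ler_nat -sum_nat_const; apply: leq_sum => e _.
  by apply/subset_leq_card/subsetIl.
have t0 : 0 < t by lra.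
have cE y : (shift E y :&: T)%:c = t - (T :\: shift E y)%:c.
  by rewrite /t -(cardsID (shift E y) T) natrD addrK setIC.
pose X2 := [set y in X | ((T :\: shift E y)%:c <= 2 * e1 * t)%R].
have X2c : x / 2 <= X2%:c.
  have : (\sum_(y in X) #|T :\: shift E y|)%:R <= e1 * (x * t).
    have Em := Emass; rewrite sum_overlap_in natr_sum in Em.
    rewrite (eq_bigr (fun y => t - (T :\: shift E y)%:c)) // in Em.
    rewrite sumrB sumr_const -mulr_natl -/x -natr_sum in Em.
    by move: Em; lra.
  move=> h; have := le_trans (markov X (fun y => #|T :\: shift E y|) (2 * e1 * t)) h.
  have -> : x = X2%:c + [set y in X | (2 * e1 * t < (T :\: shift E y)%:c)%R]%:c.
    rewrite /x -(cardsID X2 X) natrD; congr (_%:R + _%:R); apply: eq_card => y.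
      by rewrite !inE andbA andbb.
    by rewrite !inE; case: (y \in X) => //=; rewrite -ltNge andbT.
  have : 0 < e1 * t by apply: mulr_gt0.
  move: (_%:c) (_%:c) => p q k0 h'.
  have : q * (e1 * t) <= p * (e1 * t) by nra.
  rewrite ler_pM2r //; lra.
have X2a y : y \in X2 -> (T :\: shift E y)%:c <= 2 * e1 * t by rewrite inE => /andP[].
have the1 : th <= e1.
  have : e1 * eps <= e1 by rewrite ler_piMr // ltW.
  by move: thE e10; lra.
have Et : E%:c <= t + 2 * th * t.
  have : E%:c * (1 - th) <= t by rewrite -(ler_pM2r x0); lra.
  have : 0 <= E%:c := ler0n _ _.
  have : th * 50 <= 1 by lra.
  move=> h50 h0 h; have h2 : E%:c <= 2 * t by nra.
  have : th * E%:c <= th * (2 * t) by rewrite ler_pM2l.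
  lra.
have X2b y : y \in X2 -> (shift E y :\: T)%:c <= 4 * e1 * t.
  move=> /X2a; have := cE y; have := congr1 (fun n => n%:R : R) (cardsID T (shift E y)).
  rewrite natrD card_shift => h1 h2 h3.
  have : th * t <= e1 * t by rewrite ler_pM2r.
  by move: h1 h2 h3 Et; lra.
have ts : t <= 2 * s by lra.
pose D := diffset X2 X2.
have nuE u : u \in D -> (nu E u)%:R <= 12 * e1 * s.
  case/diffsetP=> y [y' [yX yX' ->]].
  have -> : nu E (y - y') = #|shift E y' :\: shift E y|.
    by rewrite /nu -(card_shift _ y') shiftD shift_shift subrK.
  have := card_setD_triangle (shift E y') T (shift E y).
  rewrite -(ler_nat R) natrD => h; have := X2a _ yX; have := X2b _ yX'.
  have : e1 * t <= e1 * (2 * s) by rewrite ler_pM2l.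
  by move: h; lra.
have X2n0 : X2 != set0.
  by rewrite -card_gt0 -(ltr_nat R); lra.
have [v vX2] := set0Pn _ X2n0.
have Dn0 : 0 \in D by apply/diffsetP; exists v, v; rewrite subrr.
have [u0 u0D mE] : {u0 | u0 \in D & \max_(u in D) nu E u = nu E u0}.
  by apply: eq_bigmax_cond; apply/card_gt0P; exists 0.
(* The maximum replaces [12 * e1 * s] because the subgroup lemma needs a natural number. *)
set m := \max_(u in D) nu E u in mE.
have mb : 12 * 2 ^+ J * e1 * s >= 2 ^+ J * m%:R.
  by rewrite mE; have := nuE _ u0D; move: (nu E u0)%:R => n; nra.
have E0 : 0 < E%:c by nra.
have [H [sgH DH Hm]] : exists H, [/\ subgroup H, D \subset H &
    forall h, h \in H -> (nu E h <= 2 ^ J * m)%N].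
  apply: almost_invariant_subgroup.
  - by apply/symmetricP => _ /diffsetP[a [c [aX cX ->]]]; rewrite opprB mem_diffset.
  - by apply/set0Pn; exists 0.
  - by move=> u uD; rewrite /m leq_bigmax_cond.
  - rewrite -(ler_nat R) !natrM natrX; move: mb Elow e1J e1s.
    move: (2 ^+ J) J1 => p p1 h1 h2 h3 h4.
    have : 50 * p * e1 * s <= s by rewrite ler_piMl // ltW.
    by have : e1 * t <= 1 / 50 * t; [rewrite ler_pM2r //; lra|nra].
  - by rewrite -(ltr_nat R).
  - have := @sub_card_diffset _ X2 X2 X2n0; rewrite -(ler_nat R) -/D => hD.
    rewrite -(ltr_nat R) !natrM !natrX.
    have h1 : E%:c <= 4 * s by have : th * t <= 1 / 50 * t; [rewrite ler_pM2r //; lra|lra].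
    have h2 : eps * s / 2 <= D%:c by lra.
    apply: lt_le_trans (_ : 3 ^+ J * (eps * s / 2) <= _); last by rewrite ler_pM2l ?exprn_gt0.
    apply: le_lt_trans (_ : 2 ^+ J * (2 * (4 * s)) < _); first by rewrite ler_pM2l ?exprn_gt0 ?ler_pM2l.
    have : 16 * 2 ^+ J * s < eps * 3 ^+ J * s by rewrite ltr_pM2r.
    by lra.
have [Z0 [Z0H EZ ZE]] := invariant_hull sgH Hm.
(* The hull approximates [E]; it is the translate of [E] by [v] that nearly covers [T], hence
   [S]. *)
exists H, (shift Z0 v); split=> //.
- apply/subsetP => _ /sumsetP[z [h [+ hH ->]]]; rewrite !in_shift => zZ.
  by rewrite addrAC; apply: (subsetP Z0H); apply: mem_sumset.
- have := subset_leq_card DH; have := @sub_card_diffset _ X2 X2 X2n0; rewrite -/D.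
  by rewrite -!(ler_nat R); lra.
- have : (#|S :\: shift Z0 v| <= #|T :\: shift E v| + #|E :\: Z0|)%N.
    apply: leq_trans (_ : #|T :\: shift Z0 v| <= _)%N.
      by apply/subset_leq_card/setSD.
    apply: leq_trans (card_setD_triangle _ (shift E v) _) _.
    by rewrite -shiftD card_shift.
  move: EZ; rewrite -!(ler_nat R) natrD !natrM natrX => h1 h2; have := X2a _ vX2.
  have : e1 * t <= e1 * (2 * s) by rewrite ler_pM2l.
  have : e1 * s <= 2 ^+ J * e1 * s by rewrite -mulrA ler_peMl // mulr_ge0 ?ltW.
  have : 0 < e1 * s by rewrite mulr_gt0.
  by lra.
- have : (#|shift Z0 v| <= #|E| + #|Z0 :\: E|)%N.
    rewrite card_shift -(cardsID E Z0) leq_add2r; exact/subset_leq_card/subsetIr.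
  move: ZE; rewrite -!(ler_nat R) natrD !natrM natrX => h1 h2.
  (* The row with the fewest bad pairs gives a translate of [T] almost inside [U], which bounds
     [|T|], then [|E|] and [|Z|], by [|U|] plus an error. *)
  have [y yX yb] : exists2 y, y \in X & (shift T y :\: U)%:c <= e1 * x / 16.
    have Xn0 : X != set0 by rewrite -card_gt0 -(ltr_nat R).
    have [y0 y0X] := set0Pn _ Xn0.
    case: (arg_minnP (fun y => #|shift T y :\: U|) y0X) => y yX ymin; exists y => //.
    rewrite -(ler_pM2l x0); apply: le_trans (_ : (bad T X U)%:R <= _); last first.
      by move: badb bs; rewrite expr2; lra.
    rewrite bad_row /x -natrM ler_nat -sum_nat_const; apply: leq_sum => z; exact: ymin.
  have : t <= U%:c + e1 * x / 16.
    have : (#|T| <= #|U| + #|shift T y :\: U|)%N.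
      rewrite -(card_shift T y) -(cardsID U (shift T y)) leq_add2r.
      exact/subset_leq_card/subsetIr.
    by rewrite -(ler_nat R) natrD -/t; lra.
  have : th * t <= e1 * (2 * s) by apply: ler_pM; rewrite ?(ltW th0) ?(ltW t0).
  have : e1 * x <= e1 * s by rewrite ler_pM2l.
  have : e1 * s <= 2 ^+ J * e1 * s by rewrite -mulrA ler_peMl // mulr_ge0 ?ltW.
  have : 0 < e1 * s by rewrite mulr_gt0.
  by move: h1 h2 Et; lra.
Qed.

End Stuck.

Section Archimedean.
Variable R : realType.
Implicit Types a x C : R.

Lemma bernoulli x n : 0 <= x -> 1 + n%:R * x <= (1 + x) ^+ n.
Proof.
move=> x0; elim: n => [|n IH]; first by rewrite mul0r addr0 expr0.
rewrite exprS; apply: le_trans (_ : (1 + x) * (1 + n%:R * x) <= _); last first.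
  by rewrite ler_pM2l //; lra.
have : 0 <= n%:R * x * x by rewrite !mulr_ge0.
by rewrite -[n.+1]addn1 natrD; lra.
Qed.

Lemma expr_unbounded a C : 1 < a -> exists n, forall m, (n <= m)%N -> C < a ^+ m.
Proof.
move=> a1; exists (Num.bound (C / (a - 1))) => m nm.
have a0 : 0 < a - 1 by lra.
have h : C / (a - 1) < m%:R.
  apply: le_lt_trans (ler_norm _) _; apply: lt_le_trans (archi_boundP (normr_ge0 _)) _.
  rewrite ler_nat; apply: leq_trans nm; rewrite /Num.bound /=.
  by rewrite normr_id.
have := @bernoulli (a - 1) m (ltW a0); rewrite [1 + (a - 1)]addrC subrK.
by apply: lt_le_trans; rewrite ltr_pdivrMr // in h; lra.
Qed.

Lemma expr_vanish a C : 0 < a -> a < 1 -> 0 < C -> exists n, a ^+ n < C.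
Proof.
move=> a0 a1 C0; have [|n /(_ n (leqnn n)) h] := @expr_unbounded a^-1 C^-1.
  by rewrite invf_gt1.
by exists n; rewrite -(ltf_pV2 (_ : _ \is Num.pos)) ?posrE ?exprn_gt0 // -exprVn.
Qed.

End Archimedean.

Section ETransform.
Variable R : realType.
Local Notation "A '%:c'" := (#|A|%:R : R) (at level 2, format "A %:c").

(* An e-transform with intermediate overlap shrinks [X] by a definite factor,
   preserves [|T| + |X|] and at most doubles the number of bad pairs; boundedly
   many of them reach [|X| <= eps |S|], unless one gets stuck. *)
Lemma etransform_dichotomy (eps eta : R) : 0 < eps -> eps < 1 -> 0 < eta ->
  exists2 c : R, 0 < c & forall b : R, 0 < b -> exists2 g : R, 0 < g &
  forall (G : finZmodType) (S U : {set G}), S != set0 -> U%:c <= 3 * S%:c ->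
  (bad S S U)%:R <= g * S%:c ^+ 2 ->
  (exists (T X : {set G}), [/\ X \subset S, S \subset T, (#|T| + #|X| = 2 * #|S|)%N,
     c * S%:c <= X%:c <= eps * S%:c & (bad T X U)%:R <= b * S%:c ^+ 2]) \/
  (exists (H Z : {set G}), [/\ subgroup H, sumset Z H \subset Z, c * S%:c <= H%:c,
     (S :\: Z)%:c <= eta * S%:c & Z%:c <= U%:c + eta * S%:c]).
Proof.
move=> eps0 eps1 eta0.
(* The number of scales at which growth by 3/2, starting from [eps * s / 2] differences, would
   outgrow the bound [2|E| <= 8 * s] for balls. *)
have [J hJ] : exists J, 16 * 2 ^+ J < eps * 3 ^+ J :> R.
  have [|J /(_ J (leqnn J)) h] := @expr_unbounded R (3 / 2) (16 / eps); first by lra.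
  exists J; move: h; rewrite ltr_pdivrMr // expr_div_n mulrC mulrA ltr_pdivlMr ?exprn_gt0 //.
have J1 : 1 <= 2 ^+ J :> R by apply: exprn_ege1; lra.
have J0 : 0 < 2 ^+ J :> R by lra.
pose e1 := Num.min (50 * 2 ^+ J)^-1 (eta / (40 * 2 ^+ J)).
have e10 : 0 < e1 by rewrite lt_min invr_gt0 divr_gt0 ?mulr_gt0.
have e1J : 50 * 2 ^+ J * e1 <= 1.
  rewrite mulrC -ler_pdivlMr ?mulr_gt0 // div1r; by rewrite ge_min lexx.
have e1eta : 40 * 2 ^+ J * e1 <= eta.
  rewrite mulrC -ler_pdivlMr ?mulr_gt0 //; by rewrite ge_min lexx orbT.
pose th := e1 * eps / 36; have th0 : 0 < th by rewrite !mulr_gt0 // invr_gt0.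
have the : 36 * th <= e1 * eps by rewrite /th; lra.
have th1 : th < 1 / 2.
  have : e1 * 1 <= 50 * 2 ^+ J * e1 by nra.
  by have : e1 * eps <= e1 * 1; [rewrite ler_pM2l // ltW|lra].
pose b0 := e1 * eps ^+ 2 / 16; have b00 : 0 < b0 by rewrite !mulr_gt0 ?exprn_gt0 ?invr_gt0.
have b0E : 16 * b0 <= e1 * eps ^+ 2 by rewrite /b0; lra.
(* [N] transforms, each keeping at most the share [1 - th] of [X], suffice; the factor [2 ^+ N] in
   [g] pays for their doublings of the bad pairs. The last one keeps at least the share [th] of a
   set larger than [eps * |S|], whence the constant [th * eps]. *)
have [N hN] : exists N, (1 - th) ^+ N < eps by apply: expr_vanish; lra.
exists (th * eps); first exact: mulr_gt0.
move=> b bpos; pose g := Num.min b b0 / 2 ^+ N.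
have g0 : 0 < g by rewrite divr_gt0 ?exprn_gt0 ?lt_min ?bpos.
exists g => // G S U Sn0 US badS.
have s0 : 0 < S%:c by rewrite ltr0n card_gt0.
have gN n : (n <= N)%N -> 2 ^+ n * g <= Num.min b b0.
  move=> nN; rewrite /g mulrCA ger_pMr ?lt_min ?bpos // ler_pdivrMr ?exprn_gt0 // mul1r.
  by rewrite ler_weXn2l //; lra.
set frag := (X in X \/ _); set sub := (X in _ \/ X).
suff main n : (n <= N)%N -> frag \/ sub \/ exists (T X : {set G}), [/\ X \subset S, S \subset T,
    (#|T| + #|X| = 2 * #|S|)%N, eps * S%:c < X%:c <= (1 - th) ^+ n * S%:c &
    (bad T X U)%:R <= 2 ^+ n * g * S%:c ^+ 2].
  have [|[|[T [X [_ _ _ /andP[h1 h2] _]]]]] := main N (leqnn _); [by left|by right|].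
  by have : (1 - th) ^+ N * S%:c < eps * S%:c; [rewrite ltr_pM2r|lra].
elim: n => [_|n IH nN].
  right; right; exists S, S; split; [by []|by []|by rewrite mul2n addnn| |].
    by rewrite expr0 mul1r lexx andbT gtr_pMl.
  by rewrite expr0 mul1r.
have {IH} [|[|[T [X [XS ST TX /andP[X1 X2] badX]]]]] := IH (ltnW nN); [by left|by right; left|].
have s20 : 0 < S%:c ^+ 2 by rewrite exprn_gt0.
have [/existsP[e /andP[o1 o2]]|/existsPn none] :=
  boolP [exists e, th * X%:c <= (overlap T X e)%:R <= (1 - th) * X%:c].
  pose T' := T :|: shift X e; pose X' := X :&: shift T (- e).
  have badX' : (bad T' X' U)%:R <= 2 ^+ n.+1 * g * S%:c ^+ 2.
    have := bad_etransform T X U e; rewrite -/T' -/X' -(ler_nat R) natrM exprS.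
    by move: badX; move: (2 ^+ n) => p; lra.
  have X'S : X' \subset S by apply: subset_trans (subsetIl _ _) XS.
  have ST' : S \subset T' by apply: subset_trans ST (subsetUl _ _).
  have TX' : (#|T'| + #|X'| = 2 * #|S|)%N by rewrite card_etransform.
  have [small|big] := leP X'%:c (eps * S%:c); [left|right; right]; exists T', X'; split=> //.
  - rewrite small andbT; apply: le_trans o1; rewrite -mulrA ler_pM2l //.
    exact: ltW.
  - apply: le_trans badX' _; rewrite ler_pM2r //; apply: le_trans (gN _ nN) _.
    by rewrite ge_min lexx.
  - rewrite big /= exprS -mulrA; apply: le_trans o2 _; rewrite ler_pM2l //; lra.
right; left.
have [] := @stuck_subgroup R G eps e1 th b0 J eps0 (ltW eps1) e10 th0 b0E the hJ e1J
  S U T X Sn0 US XS ST TX (ltW X1).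
- apply: le_trans badX _; rewrite ler_pM2r //; apply: le_trans (gN _ (ltnW nN)) _.
  by rewrite ge_min lexx orbT.
- by move=> e; apply/negP; apply: none.
move=> H [Z [sgH ZH Hc SZ Zc]]; exists H, Z; split=> //.
- apply: le_trans Hc; rewrite ler_pM2r //; nra.
- by apply: le_trans SZ _; rewrite ler_pM2r.
- by apply: le_trans Zc _; rewrite lerD2l ler_pM2r.
Qed.

End ETransform.

(** * Coset progressions from local homomorphisms *)

Ltac pure_lia := repeat match goal with H : _ |- _ => clear H end; lia.

Section NFold.
Variable G : finZmodType.
Implicit Types (A B D E H S T X Z : {set G}) (s t u x y : G).

Definition nfold k B := iter k (sumset B) [set 0].

Lemma nfoldS k B : nfold k.+1 B = sumset B (nfold k B).
Proof. by []. Qed.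

Lemma sumset0 A : sumset [set 0] A = A.
Proof.
apply/setP => x; apply/sumsetP/idP => [[a [b [/set1P -> bA ->]]]|xA]; first by rewrite add0r.
by exists 0, x; rewrite add0r inE.
Qed.

Lemma nfold1 B : nfold 1 B = B.
Proof. by rewrite nfoldS sumsetC sumset0. Qed.

Lemma nfoldD j k B : nfold (j + k) B = sumset (nfold j B) (nfold k B).
Proof. by elim: j => [|j IH]; rewrite ?sumset0 // addSn !nfoldS IH sumsetA. Qed.

Lemma nfoldM j k B : nfold (j * k) B = nfold j (nfold k B).
Proof. by elim: j => [|j IH] //; rewrite mulSn nfoldD nfoldS IH. Qed.

Lemma mem_nfoldD j k B x y : x \in nfold j B -> y \in nfold k B -> x + y \in nfold (j + k) B.
Proof. by move=> xj yk; rewrite nfoldD mem_sumset. Qed.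

Lemma nfold_0 k B : 0 \in B -> 0 \in nfold k B.
Proof.
move=> B0; elim: k => [|k IH]; first by rewrite inE.
by rewrite nfoldS -[0]addr0 mem_sumset.
Qed.

Lemma nfold_mono j k B : 0 \in B -> (j <= k)%N -> nfold j B \subset nfold k B.
Proof.
move=> B0 /subnK <-; apply/subsetP => x xj; rewrite -[x]add0r.
by apply: mem_nfoldD => //; apply: nfold_0.
Qed.

Lemma nfoldN k B x : symmetric B -> x \in nfold k B -> - x \in nfold k B.
Proof.
move=> /symmetricP symB; elim: k x => [|k IH] x; first by rewrite !inE oppr_eq0.
rewrite nfoldS => /sumsetP[a [b [aB bk ->]]]; rewrite opprD mem_sumset //.
  exact: symB.
exact: IH.
Qed.

Lemma nfold_symmetric k B : symmetric B -> symmetric (nfold k B).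
Proof. by move=> symB; apply/symmetricP => x; apply: nfoldN. Qed.

Lemma nu_nfold A B m k t : (forall t, t \in B -> nu A t <= m)%N ->
  t \in nfold k B -> (nu A t <= k * m)%N.
Proof.
move=> Bm; elim: k t => [|k IH] t; first by rewrite inE => /eqP ->; rewrite nu0.
rewrite nfoldS => /sumsetP[a [b [aB bk ->]]]; apply: leq_trans (nuD _ _ _) _.
by rewrite mulSn leq_add ?Bm ?IH.
Qed.

(** The coset progression [H + {0, d, ..., (l - 1)d}]. Properness is stated separately, as
    cardinality [|H| * l]. *)
Definition cprog H d l := [set p.1 + d *+ (p.2 : 'I_l) | p in setX H [set: 'I_l]].

Lemma cprogP H d l x :
  reflect (exists h i, [/\ h \in H, (i < l)%N & x = h + d *+ i]) (x \in cprog H d l).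
Proof.
apply: (iffP imsetP) => [[[h i]]|[h [i [hH il ->]]]].
  by rewrite !inE andbT => /= hH ->; exists h, i.
by exists (h, Ordinal il); rewrite ?inE ?hH.
Qed.

Lemma card_cprog H d l :
  (forall h h' i i', h \in H -> h' \in H -> (i < l)%N -> (i' < l)%N ->
     h + d *+ i = h' + d *+ i' -> h = h' /\ i = i') -> #|cprog H d l| = (#|H| * l)%N.
Proof.
move=> inj; rewrite card_in_imset ?cardsX ?cardsT ?card_ord //.
move=> [h i] [h' i']; rewrite !inE !andbT /= => hH hH' e.
by have [-> /val_inj ->] := inj _ _ _ _ hH hH' (ltn_ord i) (ltn_ord i') e.
Qed.

End NFold.

Section LocalHom.
Variables (G : finZmodType) (B : {set G}) (K : nat) (psi : G -> int).
Implicit Types (C H : {set G}) (x y z d h t : G).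
Hypotheses (B0 : 0 \in B) (symB : symmetric B) (K0 : (0 < K)%N).
Hypothesis psiD : forall x y, x \in nfold K B -> y \in nfold K B -> x + y \in nfold K B ->
  psi (x + y) = psi x + psi y.

Let inK j x : (j <= K)%N -> x \in nfold j B -> x \in nfold K B.
Proof. by move=> jK; apply/subsetP/nfold_mono. Qed.

Lemma psi0 : psi 0 = 0.
Proof.
have h : 0 \in nfold K B by apply: nfold_0.
by have := psiD h h; rewrite addr0 => /(_ h); lia.
Qed.

Lemma psiN j x : (j <= K)%N -> x \in nfold j B -> psi (- x) = - psi x.
Proof.
move=> jK xj; have xK := inK jK xj; have NxK := nfoldN symB xK.
have := psiD xK NxK; rewrite subrr psi0 => /(_ (nfold_0 _ B0)); lia.
Qed.

Lemma psiDj i j x y : (i + j <= K)%N -> x \in nfold i B -> y \in nfold j B ->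
  psi (x + y) = psi x + psi y.
Proof.
move=> ijK xi yj; apply: psiD.
- by apply: inK xi; apply: leq_trans ijK; apply: leq_addr.
- by apply: inK yj; apply: leq_trans ijK; apply: leq_addl.
- by apply: inK ijK _; apply: mem_nfoldD.
Qed.

Variable t2 : G.
Hypothesis t2B : t2 \in B.
Hypothesis t2max : forall x, x \in B -> psi x <= psi t2.
Hypothesis u0 : 0 < psi t2.

Let t2j : t2 \in nfold 1 B. Proof. by rewrite nfold1. Qed.
Let Nt2j : - t2 \in nfold 1 B. Proof. exact: nfoldN. Qed.

(** A fundamental domain for translation by [t2], playing the role of the [j]-fold sumset modulo
    [t2]. *)
Definition Cset j := [set x in nfold j B | 0 <= psi x < psi t2].

Lemma CsetP j x : reflect (x \in nfold j B /\ 0 <= psi x < psi t2) (x \in Cset j).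
Proof. by rewrite inE; apply: andP. Qed.

Lemma Cset_mono i j : (i <= j)%N -> Cset i \subset Cset j.
Proof.
move=> ij; apply/subsetP => x /CsetP[xi h]; apply/CsetP; split=> //.
exact: (subsetP (nfold_mono B0 ij)).
Qed.

Lemma Cset_0 j : 0 \in Cset j.
Proof. by apply/CsetP; rewrite psi0 lexx u0; split=> //; apply: nfold_0. Qed.

Lemma psi_mul j i x : (j + i <= K)%N -> x \in nfold j B ->
  x + t2 *+ i \in nfold (j + i) B /\ psi (x + t2 *+ i) = psi x + psi t2 * i%:Z.
Proof.
elim: i => [|i IH] jiK xj; first by rewrite mulr0n mulr0 !addr0 addn0.
have [|h1 h2] := IH _ xj; first by lia.
rewrite mulrSr addrA -[i.+1]addn1 PoszD mulrDr mulr1 addrA -h2 addnA.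
by split; [apply: mem_nfoldD|apply: psiDj h1 t2j; lia].
Qed.

(** The translates by [t2 *+ i] with [i <= j] are disjoint because [psi] sends them to disjoint
    intervals of length [psi t2]. *)
Lemma card_Cset j : (2 * j <= K)%N -> (j.+1 * #|Cset j| <= #|nfold (2 * j) B|)%N.
Proof.
move=> jK; pose F (p : G * 'I_j.+1) := p.1 + t2 *+ p.2.
have inj : {in setX (Cset j) [set: 'I_j.+1] &, injective F}.
  move=> [x i] [y k]; rewrite !in_setX !in_setT !andbT => /= /CsetP[xj xu] /CsetP[yj yu] e.
  have ij := ltn_ord i; have kj := ltn_ord k.
  have [|_ e1] := @psi_mul j i x _ xj; first by lia.
  have [|_ e2] := @psi_mul j k y _ yj; first by lia.
  have ik : i = k.
    have {e1 e2} e3 : psi x + psi t2 * i%:Z = psi y + psi t2 * k%:Z by rewrite -e1 -e2; congr psi; exact: e.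
    apply: val_inj => /=; move: u0 xu yu e3; move: (psi x) (psi y) (psi t2) => a b c.
    move=> c0 /andP[a0 ac] /andP[b0 bc] e3; case: (ltngtP i k) => // lik.
      have : c * (i.+1)%:Z <= c * k%:Z by rewrite ler_pM2l.
      by rewrite -[i.+1]addn1 PoszD mulrDr mulr1; lia.
    have : c * (k.+1)%:Z <= c * i%:Z by rewrite ler_pM2l.
    by rewrite -[k.+1]addn1 PoszD mulrDr mulr1; lia.
  by move: e; rewrite /F ik /= => /addIr ->.
rewrite mulnC -[j.+1]card_ord -cardsT -cardsX -(card_in_imset inj).
apply/subset_leq_card/subsetP => _ /imsetP[[x i] + ->].
rewrite in_setX => /andP[/CsetP[xj _] _]; have ij := ltn_ord i.
have [|h _] := @psi_mul j i x _ xj; first by move=> /=; lia.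
by apply: (subsetP (nfold_mono B0 _)) h => /=; lia.
Qed.

(** By symmetry of [B] and maximality of [psi t2], [|psi x| <= psi t2] on [B], so one of [x],
    [x + t2], [x - t2] falls in the fundamental domain. *)
Lemma card_Cset2 : (2 <= K)%N -> (#|B| <= 3 * #|Cset 2|)%N.
Proof.
move=> K2.
have sub : B \subset Cset 2 :|: shift (Cset 2) (- t2) :|: shift (Cset 2) t2.
  apply/subsetP => x xB; rewrite !in_setU !in_shift opprK.
  have xj : x \in nfold 1 B by rewrite nfold1.
  have h1 := t2max xB.
  have h2 : psi (- x) <= psi t2 by apply: t2max; apply: (symmetricP _ symB).
  rewrite (psiN _ xj) // in h2.
  have p1 : psi (x + t2) = psi x + psi t2 by apply: psiDj xj t2j.
  have p2 : psi (x - t2) = psi x - psi t2 by rewrite (psiDj _ xj Nt2j) // (psiN _ t2j).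
  have m1 := mem_nfoldD xj t2j; have m2 := mem_nfoldD xj Nt2j.
  have m3 := subsetP (nfold_mono B0 (leqnSn 1)) _ xj.
  have [h|h] := ltP (psi x) 0.
    rewrite [x + t2 \in _](_ : _ = true) ?orbT //; apply/CsetP; rewrite p1; split=> //.
    by apply/andP; split; [rewrite -lerBlDr sub0r lerNl|rewrite gtrDr].
  have [h'|h'] := ltP (psi x) (psi t2).
    by rewrite [x \in Cset 2](_ : _ = true) //; apply/CsetP; rewrite h h'.
  rewrite [x - t2 \in _](_ : _ = true) ?orbT //; apply/CsetP; rewrite p2; split=> //.
  by rewrite subr_ge0 h' (le_lt_trans _ u0) // subr_le0.
have := subset_leq_card sub.
have := (cardsU (Cset 2 :|: shift (Cset 2) (- t2)) (shift (Cset 2) t2)).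
have := cardsU (Cset 2) (shift (Cset 2) (- t2)); rewrite !card_shift.
clia.
Qed.

(* Subtraction on the circle of length [psi t2]. *)
Let wrap z x := if psi x <= psi z then z - x else z - x + t2.

Let wrapC i k z x : (i + k < K)%N -> z \in Cset i -> x \in Cset k -> wrap z x \in Cset (i + k).+1.
Proof.
move=> ikK /CsetP[zi zu] /CsetP[xk xu].
have Nxk := nfoldN symB xk.
have m1 := mem_nfoldD zi Nxk.
have p1 : psi (z - x) = psi z - psi x.
  rewrite (psiDj (ltnW ikK) zi Nxk) (psiN _ xk) //.
  by apply: leq_trans (ltnW ikK); apply: leq_addl.
have m2 := mem_nfoldD m1 t2j.
have p2 : psi (z - x + t2) = psi z - psi x + psi t2.
  by rewrite (psiDj _ m1 t2j) ?p1 // addn1.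
rewrite /wrap; case: ifP => h; apply/CsetP.
  split; first exact: (subsetP (nfold_mono B0 (leqnSn _))).
  by rewrite p1; move: zu xu h; move: (psi z) (psi x) (psi t2); pure_lia.
rewrite -addn1; split=> //; rewrite p2.
by move: zu xu h; move: (psi z) (psi x) (psi t2); pure_lia.
Qed.

Let wrap_inj j z : (j < K)%N -> {in Cset j &, injective (wrap z)}.
Proof.
move=> jK x y /CsetP[xj xu] /CsetP[yj yu]; rewrite /wrap.
have tw a b : a \in nfold j B -> b \in nfold j B -> 0 <= psi a < psi t2 -> 0 <= psi b < psi t2 ->
    z - a = z - b + t2 -> False.
  move=> aj bj au bu e.
  have e1 : - a = - b + t2 by apply: (addrI z); rewrite e addrA.
  have e2 : b = a + t2 by rewrite -[t2](addKr (- b)) -e1 opprK addrCA subrr addr0.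
  move: bu; rewrite e2 (psiDj _ aj t2j); last by rewrite addn1.
  by move: au; move: (psi a) (psi t2); pure_lia.
case: ifP => _; case: ifP => _.
- by move/addrI/oppr_inj.
- by move=> e; case: (tw _ _ xj yj xu yu e).
- by move/esym => e; case: (tw _ _ yj xj yu xu e).
- by move/addIr/addrI/oppr_inj.
Qed.

Section Closed.
Variable j : nat.
Hypotheses (j2 : (2 <= j)%N) (jK : (8 * j <= K)%N).
Hypothesis small : (2 * #|Cset (8 * j)| < 3 * #|Cset j|)%N.
Let C := Cset (2 * j).+1.

(* For [z] in [Cset (4j+3)] the reflection [x |-> z - x] of the circle maps [Cset j]
   into [Cset (8j)], where, by [small], its image meets [Cset j]; hence
   [z] is a sum of two elements of [Cset j]. *)
Let CsetS : Cset (4 * j).+3 \subset C.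
Proof.
apply/subsetP => z zC.
have Wi : {in Cset j &, injective (wrap z)} by apply: wrap_inj; lia.
have WS : wrap z @: Cset j \subset Cset (8 * j).
  apply/subsetP => _ /imsetP[x xC ->].
  have ij : ((4 * j).+3 + j < K)%N by lia.
  by apply: (subsetP (Cset_mono _)) (wrapC ij zC xC); lia.
have CS : Cset j \subset Cset (8 * j) by apply: Cset_mono; lia.
have : (0 < #|(wrap z @: Cset j) :&: Cset j|)%N.
  have := cardsUI (wrap z @: Cset j) (Cset j); rewrite card_in_imset //.
  have : (#|(wrap z @: Cset j) :|: Cset j| <= #|Cset (8 * j)|)%N.
    by apply: subset_leq_card; rewrite subUset WS CS.
  by move: small; clia.
rewrite card_gt0 => /set0Pn[y]; rewrite inE => /andP[/imsetP[x xC ey] yC].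
have zE : z = y + x \/ z = y + x - t2.
  rewrite ey /wrap; case: ifP => _; first by left; rewrite subrK.
  by right; rewrite (addrAC _ t2) subrK addrK.
case/CsetP: (xC) => xj _; case/CsetP: (yC) => yj _; case/CsetP: zC => _ zu.
apply/CsetP; split=> //; rewrite -addn1 mul2n -addnn.
case: zE => ->; last by apply: mem_nfoldD Nt2j; apply: mem_nfoldD.
by apply: (subsetP (nfold_mono B0 (leq_addr _ _))); apply: mem_nfoldD.
Qed.

(** A sum of two elements of [C] uses [4j + 2] summands, within reach of [CsetS]; so [C] is closed
    under addition and subtraction as long as [psi] stays in its range. *)
Let CD x y : x \in C -> y \in C -> psi x + psi y < psi t2 ->
  x + y \in C /\ psi (x + y) = psi x + psi y.
Proof.
move=> /CsetP[xj xu] /CsetP[yj yu] xy.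
have e : psi (x + y) = psi x + psi y by apply: psiDj xj yj; move: j2 jK; pure_lia.
split=> //; apply: (subsetP CsetS); apply/CsetP; split.
  by apply: (subsetP (nfold_mono B0 _)) (mem_nfoldD xj yj); move: j2; pure_lia.
by rewrite e; move: xu yu xy; move: (psi x) (psi y) (psi t2); pure_lia.
Qed.

Let CB x y : x \in C -> y \in C -> psi y <= psi x ->
  x - y \in C /\ psi (x - y) = psi x - psi y.
Proof.
move=> /CsetP[xj xu] /CsetP[yj yu] xy; have Nyj := nfoldN symB yj.
have e : psi (x - y) = psi x - psi y.
  rewrite (psiDj _ xj Nyj) ?(psiN _ yj) //; first by move: j2 jK; pure_lia.
  by move: j2 jK; pure_lia.
split=> //; apply: (subsetP CsetS); apply/CsetP; split.
  by apply: (subsetP (nfold_mono B0 _)) (mem_nfoldD xj Nyj); move: j2; pure_lia.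
by rewrite e; move: xu yu xy; move: (psi x) (psi y) (psi t2); pure_lia.
Qed.

Let psiC x : x \in C -> 0 <= psi x < psi t2. Proof. by case/CsetP. Qed.

(** As for subgroups of the integers: [H] is the kernel of [psi] on [C], and [d] has the least
    positive value, so repeatedly subtracting [d] brings every element of [C] into [H]. If [psi]
    vanishes on [C], then [C = H]. *)
Lemma Cset_cprog : exists H d l, [/\ subgroup H, (0 < l)%N,
  #|cprog H d l| = (#|H| * l)%N & cprog H d l = C].
Proof.
pose H := [set x in C | psi x == 0].
have HP x : reflect (x \in C /\ psi x = 0) (x \in H).
  by apply: (iffP setIdP) => -[h /eqP].
have C0 : 0 \in C by apply: Cset_0.
have sgH : subgroup H.
  apply/subgroupP; split; first by apply/HP; rewrite psi0.
  move=> x y /HP[xC x0] /HP[yC y0]; apply/HP.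
  by have [|-> ->] := CB xC yC; rewrite x0 y0 ?subr0.
have [/existsP[d0 /andP[d0C d0p]]|/existsPn none] := boolP [exists d0, (d0 \in C) && (0 < psi d0)]; last first.
  exists H, 0, 1%N; split=> //.
    by apply: card_cprog => h h' [|//] [|//] _ _ _ _; rewrite !addr0 => ->.
  apply/setP => x; apply/cprogP/idP => [[h [i [/HP[hC _] _ ->]]]|xC].
    by rewrite mul0rn addr0.
  exists x, 0%N; rewrite mul0rn addr0; split=> //; apply/HP; split=> //.
  by have := none x; rewrite xC /=; move: (psiC xC); move: (psi x) (psi t2); pure_lia.
pose P d := (d \in C) && (0 < psi d).
have [d /andP[dC dp] dmin] := @arg_minnP _ d0 P (fun d => `|psi d|%N) (introT andP (conj d0C d0p)).
have {}dmin x : x \in C -> 0 < psi x -> psi d <= psi x.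
  move=> xC xp; have := dmin x; rewrite /P xC xp => /(_ isT).
  by move: dp xp; move: (psi d) (psi x); pure_lia.
pose v := psi d; pose u := psi t2.
(* The number of [i >= 0] with [v * i < u], that is, of multiples of [d] that stay in the
   fundamental domain. *)
pose l := (`|u - 1| %/ `|v|).+1%N.
have il i : (i < l)%N = (v * i%:Z < u).
  rewrite /l ltnS leq_divRL; last by rewrite absz_gt0 gt_eqF.
  rewrite -lez_nat PoszM !gez0_abs ?(ltW dp) //; last by rewrite subr_ge0; apply: u0.
  by rewrite mulrC; move: (v * i%:Z) (u) => w u1; apply/idP/idP; pure_lia.
have dmul i : (i < l)%N -> d *+ i \in C /\ psi (d *+ i) = v * i%:Z.
  elim: i => [_|i IH iL]; first by rewrite mulr0n psi0 mulr0.
  have [|dC' e] := IH; first by apply: ltnW.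
  rewrite mulrSr; have [|-> ->] := CD dC' dC.
    by rewrite e; move: iL; rewrite il -[i.+1]addn1 PoszD mulrDr mulr1.
  by rewrite e -[i.+1]addn1 PoszD mulrDr mulr1.
have hd h i : h \in H -> (i < l)%N -> h + d *+ i \in C /\ psi (h + d *+ i) = v * i%:Z.
  move=> /HP[hC h0] iL; have [dC' e] := dmul i iL.
  by have [|-> ->] := CD hC dC'; rewrite h0 e add0r // -il.
exists H, d, l; split=> //.
  apply: card_cprog => h h' i i' hH hH' iL iL' e.
  have [_ e1] := hd _ _ hH iL; have [_ e2] := hd _ _ hH' iL'.
  have ii : i = i'.
    by have : v * i%:Z = v * i'%:Z; [rewrite -e1 -e2 e|move/(mulfI (lt0r_neq0 dp)) => -[]].
  by move: e; rewrite ii => /addIr ->.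
apply/setP => x; apply/cprogP/idP => [[h [i [hH iL ->]]]|].
  by case: (hd _ _ hH iL).
have [n] := ubnP `|psi x|%N; elim: n x => // n IH x xn xC.
have [xp|xp] := ltP 0 (psi x); last first.
  exists x, 0%N; rewrite mulr0n addr0; split=> //; apply/HP; split=> //.
  by move: (psiC xC) xp; move: (psi x) (psi t2); pure_lia.
have [xdC xd] := CB xC dC (dmin x xC xp).
have [|h [i [hH iL e]]] := IH _ _ xdC.
  by move: dp xn (psiC xdC); rewrite xd; move: (psi x) (psi d) (psi t2); pure_lia.
have [_ e2] := hd _ _ hH iL.
exists h, i.+1; split=> //; last by rewrite mulrSr addrA -e subrK.
rewrite il -[i.+1]addn1 PoszD mulrDr mulr1 -e2 -e xd subrK.
by case/andP: (psiC xC).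
Qed.

End Closed.
End LocalHom.

Ltac pure_lra := repeat match goal with H : _ |- _ => clear H end; intros; lra.
Ltac pure_nra := repeat match goal with H : _ |- _ => clear H end; intros; nra.

Lemma exp8 n : (2 ^ (3 * n + 2) = 4 * 8 ^ n)%N.
Proof. by rewrite expnD expnM mulnC. Qed.

(* As the [2j]-fold sumset contains [j+1] disjoint translates of [Cset j], it grows by
   nearly [8 * 3/2] each time [j] is multiplied by [8] if [Cset] grows by [3/2].
   This is more than [(21/10) ^ 3]. *)
Lemma cprog_of_local_hom (R : realType) : exists L : nat,
  forall (G : finZmodType) (B : {set G}) (psi : G -> int), 0 \in B -> symmetric B ->
  (forall x y, x \in nfold (2 ^ L) B -> y \in nfold (2 ^ L) B -> x + y \in nfold (2 ^ L) B ->
    psi (x + y) = psi x + psi y) ->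
  (exists2 x, x \in B & psi x != 0) ->
  (forall l, (l <= L)%N -> (#|nfold (2 ^ l) B|%:R : R) <= (21 / 10) ^+ l * #|B|%:R) ->
  exists H d l, [/\ subgroup H, (0 < l)%N, #|cprog H d l| = (#|H| * l)%N,
    cprog H d l \subset nfold (2 ^ L) B & (#|B| <= 3 * #|cprog H d l|)%N].
Proof.
(* Were [Cset] to grow by 3/2 at all [n] steps, then [2 * 12 ^ n <= (21/10) ^ (3n + 2) * 3]. As
   [(21/10) ^ 3 < 96/10] and [12 = (96/10) * (5/4)], this would force [(5/4) ^ n < 7]. *)
have [|n hn] := @expr_unbounded R (5 / 4) 7; first by lra.
exists (3 * n + 2)%N => G B psi B0 symB psiD [x0 x0B x00] growth.
have {hn} := hn n (leqnn n) => hn.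
have K0 : (0 < 2 ^ (3 * n + 2))%N by rewrite expn_gt0.
have nN x : x \in B -> psi (- x) = - psi x.
  move=> xB; have xj : x \in nfold 1 B by rewrite nfold1.
  exact: (psiN B0 symB K0 psiD K0 xj).
have [t2 [t2B t2max u0]] : exists t2, [/\ t2 \in B, forall x, x \in B -> psi x <= psi t2 & 0 < psi t2].
  have [t tB tmax] : exists2 t, t \in B & forall x, x \in B -> psi x <= psi t.
    have [t tB tmax] := @Order.TotalTheory.arg_maxP _ _ _ x0 (mem B) psi x0B.
    by exists t.
  exists t; split=> //.
  have [p|p|e] := ltgtP 0 (psi x0); last by rewrite -e eqxx in x00.
    exact: lt_le_trans (tmax _ x0B).
  apply: lt_le_trans (tmax (- x0) _); first by rewrite nN // oppr_gt0.
  exact: (symmetricP _ symB).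
pose C := Cset B psi t2.
have [/forallP all|/forallPn[i]] := boolP [forall i : 'I_n, (3 * #|C (2 * 8 ^ i)%N| <= 2 * #|C (2 * 8 ^ i.+1)%N|)%N].
  pose c i : R := #|C (2 * 8 ^ i)%N|%:R.
  have c0 : 0 < c 0%N by rewrite ltr0n card_gt0; apply/set0Pn; exists 0; apply: (Cset_0 B0 symB K0 psiD u0).
  have cn i : (i <= n)%N -> (3 / 2) ^+ i * c 0%N <= c i.
    elim: i => [_|i IH iN]; first by rewrite expr0 mul1r.
    have := all (Ordinal iN); rewrite -(ler_nat R) !natrM => /= h.
    move: (IH (ltnW iN)) h; rewrite exprS -mulrA -/(c i) -/(c i.+1).
    by move: (_ * c 0%N) (c i) (c i.+1); pure_lra.
  have {}cn := cn n (leqnn n).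
  have jK : (2 * (2 * 8 ^ n) <= 2 ^ (3 * n + 2))%N by rewrite exp8 mulnA.
  have := card_Cset B0 symB K0 psiD t2B u0 jK; rewrite mulnA -exp8 -(ler_nat R) natrM -/(c n) => h.
  have {}h := le_trans h (growth _ (leqnn _)).
  have K2 : (2 <= 2 ^ (3 * n + 2))%N by rewrite exp8; move: (expn_gt0 8 n); move: (8 ^ n)%N; pure_lia.
  have := card_Cset2 B0 symB K0 psiD t2B t2max u0 K2; rewrite -(ler_nat R) natrM => h3.
  have {}h3 : #|B|%:R <= 3 * c 0%N := h3.
  exfalso.
  have lam : (21 / 10 : R) ^+ (3 * n + 2) <= (96 / 10) ^+ n * (441 / 100).
    rewrite exprD exprM; apply: ler_pM; rewrite ?exprn_ge0 //; try lra.
    by apply: lerXn2r; rewrite ?nnegrE; lra.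
  have e12 : (8 : R) ^+ n * (3 / 2) ^+ n = (96 / 10) ^+ n * (5 / 4) ^+ n.
    by rewrite -!exprMn; congr (_ ^+ n); lra.
  have q0 : 0 < (96 / 10 : R) ^+ n by rewrite exprn_gt0 //; lra.
  move: h; rewrite -addn1 natrD natrM natrX.
  have e80 : 0 <= (8 : R) ^+ n by rewrite exprn_ge0.
  have L0 : 0 <= (21 / 10 : R) ^+ (3 * n + 2) by rewrite exprn_ge0 //; lra.
  move: cn h3 lam e12 q0 hn c0 e80 L0.
  have t0 : 0 <= (3 / 2 : R) ^+ n by rewrite exprn_ge0 //; lra.
  move: t0; move: (8 ^+ n) ((3 / 2) ^+ n) ((96 / 10) ^+ n) ((5 / 4) ^+ n) ((21 / 10) ^+ _) (c 0%N) (c n) (#|B|%:R).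
  move=> E t P Q L c0 c' b t0 cn h3 lam e12 q0 hn c00 e80 L0 h.
  have h1 : E * (t * c0) <= E * c' by rewrite ler_wpM2l.
  have h2 : L * b <= P * (441 / 100) * (3 * c0).
    by apply: le_trans (ler_wpM2l L0 h3) (ler_wpM2r _ lam); lra.
  have c'0 : 0 <= c' by apply: le_trans cn; rewrite mulr_ge0 ?(ltW c00) //.
  have Pc : 0 < P * c0 by rewrite mulr_gt0.
  have h4 : P * c0 * 7 < P * c0 * Q by rewrite ltr_pM2l.
  have h5 : E * (t * c0) = P * c0 * Q by rewrite mulrA e12; ring.
  move: h h1 h2 c'0 h4 h5 Pc; rewrite mulrDl mul1r -!mulrA.
  pure_lra.
rewrite -ltnNge => small.
have iN : (8 ^ i.+1 <= 8 ^ n)%N by rewrite leq_exp2l.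
have i0 : (0 < 8 ^ i)%N by rewrite expn_gt0.
have e : (8 * (2 * 8 ^ i) = 2 * 8 ^ i.+1)%N by rewrite expnS mulnCA.
have jK : (8 * (2 * 8 ^ i) <= 2 ^ (3 * n + 2))%N.
  by rewrite e exp8; move: iN; move: (8 ^ i.+1)%N (8 ^ n)%N; pure_lia.
have [||H [d [l [sgH l0 cH HC]]]] := @Cset_cprog _ _ _ _ B0 symB K0 psiD _ t2B u0 (2 * 8 ^ i) _ jK.
- by move: i0; move: (8 ^ i)%N; pure_lia.
- by rewrite e.
exists H, d, l; split=> //; rewrite HC.
  apply/subsetP => x /CsetP[h _]; apply: (subsetP (nfold_mono B0 _)) h.
  by move: jK i0; move: (2 ^ _)%N (8 ^ i)%N; pure_lia.
apply: leq_trans (card_Cset2 B0 symB K0 psiD t2B t2max u0 _) _; first by rewrite exp8; move: (expn_gt0 8 n); move: (8 ^ n)%N; pure_lia.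
rewrite leq_mul2l /=; apply: subset_leq_card; apply: Cset_mono => //.
by move: i0; move: (8 ^ i)%N; pure_lia.
Qed.

(** * Local homomorphisms from large cosines *)

Section Characters.
Variables (R : realType) (q : nat).
Local Notation G := 'I_q.+1.
Implicit Types (a s u x y : G) (A B D V W : {set G}).
Local Notation w := (pi *+ 2 / q.+1%:R : R).

(** [ch] and [sn] are the real and imaginary parts of the characters of the cyclic group. All
    Fourier coefficients below are those of symmetric sets, so they are real and given by
    cosines. *)
Definition ch (a x : nat) : R := cos ((a * x)%:R * w).
Definition sn (a x : nat) : R := sin ((a * x)%:R * w).

Lemma chC (a x : nat) : ch a x = ch x a. Proof. by rewrite /ch mulnC. Qed.

Let phase_mod k : k%:R * w = (k %% q.+1)%:R * w + pi *+ 2 *+ (k %/ q.+1).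
Proof.
rewrite {1}(divn_eq k q.+1) natrD natrM mulrDl addrC; congr (_ + _).
by rewrite -mulrA [q.+1%:R * _]mulrC divfK ?pnatr_eq0 // mulrC mulr_natr.
Qed.

Lemma ch_mod (k l : nat) : k = l %[mod q.+1] -> cos (k%:R * w) = cos (l%:R * w).
Proof. by move=> e; rewrite phase_mod e (phase_mod l) !(periodicn (@cosD2pi R)). Qed.

Lemma sn_mod (k l : nat) : k = l %[mod q.+1] -> sin (k%:R * w) = sin (l%:R * w).
Proof. by move=> e; rewrite phase_mod e (phase_mod l) !(periodicn (@sinD2pi R)). Qed.

Lemma ch1D2sn2 a x : ch a x ^+ 2 + sn a x ^+ 2 = 1.
Proof. exact: cos2Dsin2. Qed.

Lemma chD a x y : ch a (x + y)%R = ch a x * ch a y - sn a x * sn a y.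
Proof.
rewrite /ch /sn -cosD -mulrDl -natrD -mulnDr; apply: ch_mod.
by rewrite /= modnMmr.
Qed.

Lemma snD a x y : sn a (x + y)%R = sn a x * ch a y + ch a x * sn a y.
Proof.
rewrite /ch /sn -sinD -mulrDl -natrD -mulnDr; apply: sn_mod.
by rewrite /= modnMmr.
Qed.

Lemma ch0 a : ch a (0%R : G) = 1. Proof. by rewrite /ch muln0 mul0r cos0. Qed.
Lemma sn0 a : sn a (0%R : G) = 0. Proof. by rewrite /sn muln0 mul0r sin0. Qed.

Lemma snN a x : sn a (- x)%R = - sn a x.
Proof.
have := ch1D2sn2 a x; have := chD a x (- x); have := snD a x (- x).
rewrite subrr ch0 sn0; move: (ch a x) (sn a x) (ch a (- x)%R) (sn a (- x)%R) => c s c' s' h1 h2 h3.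
have -> : s' = s' * (c ^+ 2 + s ^+ 2) by rewrite h3 mulr1.
have -> : s' * (c ^+ 2 + s ^+ 2) = c * (s * c' + c * s') - s * (c * c' - s * s') by ring.
by rewrite -h1 -h2 mulr0 mulr1 sub0r.
Qed.

(** Replacing [a] by [a + 1] rotates the vector of cosine and sine sums by the angle of [u]; for
    [u != 0] the rotation is nontrivial and fixes only the zero vector. *)
Lemma sum_ch u : \sum_(a : G) ch a u = (q.+1 * (u == 0%R))%N%:R.
Proof.
have [->|u0] := eqVneq u 0.
  by rewrite muln1 (eq_bigr (fun _ => 1)) => [|a _]; rewrite ?ch0 // sumr_const card_ord.
rewrite muln0; have q0 : (1 < q.+1)%N.
  by rewrite (leq_ltn_trans _ (ltn_ord u)) // lt0n.
pose e : G := inord 1.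
have eE : val e = 1%N by rewrite /= inordK.
have e1 : \sum_(a : G) ch a u = (\sum_(a : G) ch a u) * ch u e - (\sum_(a : G) sn a u) * sn u e.
  rewrite {1}(reindex_inj (addIr e)) /= !mulr_suml -sumrB; apply: eq_bigr => a _.
  by rewrite chC chD (chC a) /sn (mulnC a).
have e2 : \sum_(a : G) sn a u = (\sum_(a : G) sn a u) * ch u e + (\sum_(a : G) ch a u) * sn u e.
  rewrite {1}(reindex_inj (addIr e)) /= !mulr_suml -big_split; apply: eq_bigr => a _ /=.
  by rewrite /sn mulnC -/(sn _ _) snD (chC a) /sn (mulnC a).
have c1 : ch u e < 1.
  have u1 : (0 < val u)%N by rewrite lt0n.
  rewrite /ch eE muln1; set t := _ * w.
  have -> : t = (t / 2) *+ 2 by rewrite -mulr_natr divfK // pnatr_eq0.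
  have t2 : t / 2 = u%:R * (pi / q.+1%:R) by rewrite /t -mulrA mulrAC -(mulr_natr pi) mulfK // pnatr_eq0.
  have : 0 < sin (t / 2).
    apply: sin_gt0_pi; rewrite t2 !mulr_gt0 ?invr_gt0 ?ltr0n ?pi_gt0 //=.
    by rewrite mulrA ltr_pdivrMr ?ltr0n // mulrC ltr_pM2l ?pi_gt0 // ltr_nat.
  by have := sin2cos2 (t / 2); rewrite cos_mulr2n; move: (cos _) (sin _) => c s; pure_nra.
move: e1 e2 (ch1D2sn2 u e) c1.
move: (\sum_(a : G) ch a u) (\sum_(a : G) sn a u) (ch u e) (sn u e) => C S c s e1 e2 e3 c1.
have h : (C ^+ 2 + S ^+ 2) * (1 - c) = 0.
  have -> : (C ^+ 2 + S ^+ 2) * (1 - c) = C * (C - C * c) + S * (S - S * c) by ring.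
  have -> : C - C * c = - (S * s) by rewrite {1}e1; ring.
  have -> : S - S * c = C * s by rewrite {1}e2; ring.
  by ring.
move/eqP: h; rewrite mulf_eq0 (gt_eqF (_ : 0 < 1 - c)) ?subr_gt0 // orbF.
by rewrite paddr_eq0 ?sqr_ge0 // !sqrf_eq0 => /andP[/eqP].
Qed.

Definition beta W a : R := \sum_(x in W) ch a x.

Lemma sum_sn0 W a : symmetric W -> \sum_(x in W) sn a x = 0.
Proof.
move=> /symmetricP symW.
have h : \sum_(x in W) sn a x = - \sum_(x in W) sn a x.
  rewrite {1}(reindex_inj oppr_inj) -sumrN; apply: eq_big => [x|x _].
    by apply/idP/idP => [/symW|]; [rewrite opprK|apply: symW].
  exact: snN.
by move: h; move: (\sum_(_ in _) _); pure_lra.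
Qed.

Lemma beta_shift W a s : symmetric W -> \sum_(x in W) ch a (x + s)%R = beta W a * ch a s.
Proof.
move=> symW; rewrite (eq_bigr _ (fun x _ => chD a x s)) sumrB -!mulr_suml.
by rewrite sum_sn0 // mul0r subr0.
Qed.

Lemma sum_beta2 W : symmetric W -> \sum_(a : G) beta W a ^+ 2 = (q.+1 * #|W|)%N%:R.
Proof.
move=> symW.
have -> : \sum_(a : G) beta W a ^+ 2 = \sum_(a : G) \sum_(y in W) \sum_(x in W) ch a (x + y)%R.
  by apply: eq_bigr => a _; rewrite expr2 mulr_sumr; apply: eq_bigr => y _; rewrite beta_shift.
rewrite exchange_big natrM -sumr_const mulr_sumr /=; apply: eq_bigr => y yW; rewrite exchange_big /=.
rewrite (eq_bigr _ (fun x _ => sum_ch (x + y))) (bigD1 (- y)) ?(symmetricP _ symW) //= addNr eqxx muln1.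
rewrite big1 ?addr0 ?mulr1 // => x /andP[_ xy].
by rewrite -subr_eq0 opprK in xy; rewrite (negbTE xy) muln0.
Qed.

(** The sum counts solutions of [x + y + z = 0] with [x] in [V] and [y], [z] in [W]; every pair
    [(y, z)] has one. *)
Lemma sum_beta3 W V : symmetric W -> symmetric V -> sumset W W \subset V ->
  \sum_(a : G) beta W a ^+ 2 * beta V a = (q.+1 * (#|W| * #|W|))%N%:R.
Proof.
move=> symW symV WV.
have -> : \sum_(a : G) beta W a ^+ 2 * beta V a =
    \sum_(a : G) \sum_(z in W) \sum_(y in W) \sum_(x in V) ch a (x + (y + z))%R.
  apply: eq_bigr => a _; rewrite expr2 mulrAC mulr_sumr; apply: eq_bigr => z _.
  rewrite mulrAC -beta_shift // mulr_suml; apply: eq_bigr => y _.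
  by rewrite beta_shift // mulrC.
rewrite exchange_big !natrM -[#|W|%:R]sumr_const mulr_suml mulr_sumr /=; apply: eq_bigr => z zW.
rewrite exchange_big mul1r mulr_sumr /=; apply: eq_bigr => y yW; rewrite exchange_big /=.
rewrite (eq_bigr _ (fun x _ => sum_ch (x + (y + z)))) (bigD1 (- (y + z))) /=; last first.
  by apply: (symmetricP _ symV); apply: (subsetP WV); apply: mem_sumset.
rewrite addNr eqxx muln1 big1 ?addr0 ?mulr1 // => x /andP[_ xy].
by rewrite -subr_eq0 opprK in xy; rewrite (negbTE xy) muln0.
Qed.

Lemma beta_le W a : beta W a <= #|W|%:R.
Proof. by rewrite -sumr_const; apply: ler_sum => x _; apply: cos_le1. Qed.

(** Translation by [s] multiplies the coefficient by [ch a s], yet it only removes and adds [nu V s]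
    terms of absolute value at most 1. *)
Lemma beta_nu V a s : symmetric V -> beta V a * (1 - ch a s) <= 2 * (nu V s)%:R.
Proof.
move=> symV.
have e : beta V a * ch a s = \sum_(x in shift V s) ch a x.
  rewrite -beta_shift // [RHS](reindex_inj (addIr s)) /=.
  by apply: eq_bigl => x; rewrite in_shift addrK.
rewrite mulrBr mulr1 e /beta.
have d A B : \sum_(x in A) ch a x = \sum_(x in A :&: B) ch a x + \sum_(x in A :\: B) ch a x.
  by rewrite (big_setID B).
rewrite (d V (shift V s)) (d (shift V s) V) setIC opprD addrACA subrr add0r.
rewrite mulrDl mul1r; apply: lerD.
  rewrite -[(nu V s)%:R]sumr_const; apply: ler_sum => x _; apply: cos_le1.
rewrite -sumrN -nuN /nu -(card_shift _ s) shiftD shift_shift addNr shift0 -sumr_const; apply: ler_sum => x _.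
by rewrite lerNl; apply: cos_geN1.
Qed.

End Characters.

Section Frequency.
Variables (R : realType) (q : nat).
Local Notation G := 'I_q.+1.
Implicit Types (a s u x y : G) (A B D V W : {set G}).
Local Notation ch := (ch R q).
Local Notation beta := (beta R).
Local Notation "A '%:c'" := (#|A|%:R : R) (at level 2, format "A %:c").

Lemma beta_ge W a : - W%:c <= beta W a.
Proof.
by rewrite -sumr_const -sumrN; apply: ler_sum => x _; apply: cos_geN1.
Qed.

(* By Parseval for [V'] the annihilator of [B] has at most [q / |V'|] elements, so it
   carries at most half of the third moment of [W], [W], [V]. *)
Lemma exists_frequency B W V V' : W != set0 -> symmetric W -> symmetric V -> symmetric V' ->
  sumset W W \subset V -> (#|V| <= 5 * #|W|)%N -> (2 * #|V| <= #|V'|)%N ->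
  (forall a, (forall s, s \in B -> ch a s = 1) -> forall x, x \in V' -> ch a x = 1) ->
  exists a s, [/\ s \in B, ch a s != 1 & V%:c <= 10 * beta V a].
Proof.
move=> W0 symW symV symV' WV V5 VV' annV'.
pose Ann := [set a : G | [forall s in B, ch a s == 1]].
have AnnP a : reflect (forall s, s \in B -> ch a s = 1) (a \in Ann).
  rewrite inE; apply: (iffP forallP) => h s; first by move=> sB; apply/eqP; have := h s; rewrite sB.
  by apply/implyP => sB; rewrite h.
have [/existsP[a /andP[aA big]]|/existsPn none] :=
    boolP [exists a, (a \notin Ann) && (V%:c <= 10 * beta V a)].
  move: aA; rewrite inE => /forallPn[s]; rewrite negb_imply => /andP[sB cs].
  by exists a, s.
exfalso; have s2 := sum_beta2 R symW; have s3 := sum_beta3 R symW symV WV.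
have Wp : 0 < W%:c by rewrite ltr0n card_gt0.
have N0 : 0 < q.+1%:R :> R by rewrite ltr0n.
have Vp : 0 < V%:c.
  rewrite ltr0n card_gt0; case/set0Pn: W0 => x xW; apply/set0Pn; exists (x + x).
  by apply: (subsetP WV); apply: mem_sumset.
have {}VV' : 2 * V%:c <= V'%:c by rewrite -natrM ler_nat.
have {}V5 : V%:c <= 5 * W%:c by rewrite -natrM ler_nat.
have annN : Ann%:c * V'%:c <= q.+1%:R.
  have : Ann%:c * (V'%:c ^+ 2) <= q.+1%:R * V'%:c.
    rewrite -natrM -(sum_beta2 R symV') mulr_natl -sumr_const.
    rewrite [leRHS](bigID (mem Ann)) /= -[leLHS]addr0; apply: lerD; last first.
      by apply: sumr_ge0 => a _; apply: sqr_ge0.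
    apply: ler_sum => a /AnnP aA; rewrite /beta (eq_bigr (fun _ => 1)) ?sumr_const //.
    by move=> x xV'; apply: annV'.
  by rewrite expr2 mulrA ler_pM2r // (lt_le_trans _ VV') // mulr_gt0.
have b1 : \sum_(a in Ann) beta W a ^+ 2 * beta V a <= Ann%:c * (W%:c ^+ 2 * V%:c).
  rewrite mulr_natl -sumr_const; apply: ler_sum => a _.
  apply: le_trans (_ : beta W a ^+ 2 * V%:c <= _).
    by rewrite ler_wpM2l ?sqr_ge0 // beta_le.
  rewrite ler_wpM2r ?(ltW Vp) // -[leLHS]real_normK ?num_real //.
  by rewrite lerXn2r ?nnegrE ?(ltW Wp) // ler_norml beta_ge beta_le.
have b2 : \sum_(a | a \notin Ann) beta W a ^+ 2 * beta V a <=
    (W%:c / 2) * \sum_(a | a \notin Ann) beta W a ^+ 2.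
  rewrite mulr_sumr; apply: ler_sum => a aA; rewrite mulrC ler_wpM2r ?sqr_ge0 //.
  by have := none a; rewrite aA /= -ltNge; move: V5; move: (beta V a) (V%:c) (W%:c); pure_lra.
(* The zero frequency lies in [Ann]; the term [|W| ^ 2] it contributes to Parseval makes the final
   contradiction strict. *)
have b3 : W%:c ^+ 2 + \sum_(a | a \notin Ann) beta W a ^+ 2 <= q.+1%:R * W%:c.
  rewrite -natrM -s2 [leRHS](bigID (mem Ann)) /= lerD2r (bigD1 0) /=; last first.
    by apply/AnnP => s sB; rewrite chC ch0.
  have -> : beta W 0 = W%:c.
    by rewrite /beta (eq_bigr (fun _ => 1)) ?sumr_const // => x _; rewrite chC ch0.
  by rewrite lerDl; apply: sumr_ge0 => a _; apply: sqr_ge0.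
move: s3; rewrite (bigID (mem Ann)) /= !natrM.
have {}b1 : \sum_(a in Ann) beta W a ^+ 2 * beta V a <= q.+1%:R * W%:c ^+ 2 / 2.
  apply: le_trans b1 _; rewrite ler_pdivlMr // -mulrA.
  apply: le_trans (_ : W%:c ^+ 2 * (Ann%:c * V'%:c) <= _).
    by rewrite [leRHS]mulrCA ler_wpM2l // -mulrA ler_wpM2l ?sqr_ge0 // mulrC.
  by rewrite mulrC ler_wpM2r ?sqr_ge0.
move: b1 b2 b3 Wp; move: (\sum_(a in Ann) beta W a ^+ 2 * beta V a) (\sum_(a | a \notin Ann) beta W a ^+ 2 * beta V a).
move: (\sum_(a | a \notin Ann) beta W a ^+ 2).
move: (W%:c) (q.+1%:R : R) => W' N S2 S1 S3 b1 b2 b3 W'0 e.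
have := ler_wpM2l (ltW W'0) b3.
have : 0 < W' * (W' * W') by rewrite !mulr_gt0.
move: b1 b2 e; rewrite !expr2; pure_lra.
Qed.

(** The residue of [a * x] of least absolute value modulo [q.+1]. *)
Definition psi (a x : nat) : int :=
  let r := (a * x %% q.+1)%N in if (2 * r <= q.+1)%N then r%:Z else r%:Z - q.+1%:Z.

Lemma psi_bound (a x : nat) : 0 < ch a x -> 4 * `|psi a x| < q.+1%:Z.
Proof.
have N0 : 0 < q.+1%:R :> R by rewrite ltr0n.
have key r : (q.+1 <= 4 * r)%N -> (2 * r <= q.+1)%N -> cos (r%:R * (pi *+ 2 / q.+1%:R)) <= 0 :> R.
  rewrite -!(ler_nat R) !natrM => h1 h2; rewrite -[X in cos X]opprK cosN.
  set t := _ * _; have te : t = (2 * r%:R / q.+1%:R) * pi.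
    by rewrite /t -(mulr_natr pi) ; move: (q.+1%:R^-1); intros; ring.
  have : 0 <= cos (pi - t).
    apply: cos_ge0_pihalf; have p0 := pi_gt0 R; have {te} := te.
    have : 1 <= 2 * (2 * r%:R / q.+1%:R) :> R by rewrite !mulrA ler_pdivlMr // -natrM; move: h1; lra.
    have : 2 * r%:R / q.+1%:R <= 1 :> R by rewrite ler_pdivrMr // mul1r.
    move: (2 * r%:R / q.+1%:R) p0; pure_nra.
  by rewrite addrC cosDpi oppr_ge0.
rewrite /ch -(@ch_mod R q (a * x %% q.+1)) ?modn_mod // /psi.
have rN := ltn_pmod (a * x) (ltn0Sn q); move: (a * x %% q.+1)%N rN => r rN.
case: ifP => h.
  by have := key r; rewrite h; case: (leqP q.+1 (4 * r)) => [_ /(_ isT isT)|]; [rewrite leNgt => /negP h0 h1; case: (h0 h1)|move=> lt _ _; move: lt; pure_lia].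
have e : cos (r%:R * (pi *+ 2 / q.+1%:R)) = cos ((q.+1 - r)%:R * (pi *+ 2 / q.+1%:R)) :> R.
  rewrite natrB ?(ltnW rN) // mulrBl [q.+1%:R * _]mulrC divfK ?gt_eqF // addrC cosD2pi.
  by rewrite cosN.
have := key (q.+1 - r)%N; rewrite -e; have -> : (2 * (q.+1 - r) <= q.+1)%N by move: h; pure_lia.
case: (leqP q.+1 (4 * (q.+1 - r))) => [_ /(_ isT isT)|lt _ _].
  by rewrite leNgt => /negP h0 h1; case: (h0 h1).
by move: lt rN; pure_lia.
Qed.

Lemma psiP (a x : nat) : exists k : int, psi a x = a%:Z * x%:Z + k * q.+1%:Z.
Proof.
rewrite /psi -PoszM; have := divn_eq (a * x) q.+1.
move: (q.+1) (a * x)%N (a * x %% q.+1)%N (a * x %/ q.+1)%N => N n r d ->; rewrite PoszD PoszM.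
by case: ifP => _; [exists (- d%:Z)|exists (- d%:Z - 1)]; ring.
Qed.

(** A positive cosine puts [psi] below a quarter of the modulus; the defect of additivity is a
    multiple of the modulus and smaller than three quarters of it. *)
Lemma psi_additive a x y : 0 < ch a x -> 0 < ch a y -> 0 < ch a (x + y)%R ->
  psi a (x + y)%R = psi a x + psi a y.
Proof.
move=> /psi_bound hx /psi_bound hy /psi_bound hxy.
have [k1 e1] := psiP a x; have [k2 e2] := psiP a y; have [k3 e3] := psiP a (x + y)%R.
have e4 : (x + y)%R%:Z = x%:Z + y%:Z - ((x + y) %/ q.+1)%:Z * q.+1%:Z :> int.
  have := divn_eq (x + y) q.+1; rewrite /= -PoszD.
  move: (q.+1) (x + y)%N ((x + y) %% q.+1)%N ((x + y) %/ q.+1)%N => N n r d ->.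
  by rewrite PoszD PoszM; ring.
have : exists k : int, psi a (x + y)%R = psi a x + psi a y + k * q.+1%:Z.
  exists (k3 - k1 - k2 - a%:Z * ((x + y) %/ q.+1)%:Z); rewrite e3 e4 e1 e2; ring.
case=> k ek; move: hx hy hxy; rewrite ek.
move: (psi a x) (psi a y) => c d hx hy hxy.
have [->|kn0] := eqVneq k 0; first by rewrite mul0r addr0.
have N0 : 0 <= q.+1%:Z by [].
exfalso; have [k0|k0|k0] := ltgtP 0 k; last by rewrite -k0 eqxx in kn0.
  have : q.+1%:Z <= k * q.+1%:Z by rewrite ler_peMl //; move: k0; pure_lia.
  by move: hx hy hxy N0; move: (q.+1%:Z) => N; move: (k * N); pure_lia.
have : q.+1%:Z <= - k * q.+1%:Z by rewrite ler_peMl //; move: k0; pure_lia.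
by rewrite mulNr; move: hx hy hxy N0; move: (q.+1%:Z) => N; move: (k * N); pure_lia.
Qed.

Lemma psi_eq0 (a x : nat) : psi a x = 0 -> ch a x = 1.
Proof.
rewrite /psi /ch -(@ch_mod R q (a * x %% q.+1)) ?modn_mod //.
have rN := ltn_pmod (a * x) (ltn0Sn q); move: (a * x %% q.+1)%N rN => r rN.
have h : (if (2 * r <= q.+1)%N then r%:Z else r%:Z - q.+1%:Z) = 0 -> r = 0%N.
  by case: ifP => _; move: rN; pure_lia.
by move/h ->; rewrite mul0r cos0.
Qed.

End Frequency.

Lemma cprog_subgroup (G : finZmodType) (H : {set G}) : subgroup H ->
  #|cprog H 0 1| = (#|H| * 1)%N /\ cprog H 0 1 = H.
Proof.
move=> sgH; split; first by apply: card_cprog => h h' [|//] [|//] _ _ _ _; rewrite !addr0 => ->.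
apply/setP => x; apply/cprogP/idP => [[h [i [hH _ ->]]]|xH]; first by rewrite mul0rn addr0.
by exists x, 0%N; rewrite mul0rn addr0.
Qed.

Lemma nu_sumset (G : finZmodType) (K V : {set G}) s : 0 \in K -> s \in K ->
  (#|V| + nu V s <= #|sumset K V|)%N.
Proof.
move=> K0 sK; have : (#|V :|: shift V s| <= #|sumset K V|)%N.
  apply/subset_leq_card/subsetP => x; rewrite inE in_shift => /orP[xV|xV].
    by rewrite -[x]add0r mem_sumset.
  by rewrite -[x](subrK s) addrC mem_sumset.
by have := cardsU V (shift V s); have := cardsID (shift V s) V; rewrite /nu card_shift; clia.
Qed.

Lemma ch_nfold (R : realType) q (B : {set 'I_q.+1}) (a : 'I_q.+1) : (forall s, s \in B -> ch R q a s = 1) ->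
  forall k x, x \in nfold k B -> ch R q a x = 1.
Proof.
move=> aB; elim=> [|k IH] x; first by rewrite inE => /eqP ->; rewrite ch0.
rewrite nfoldS => /sumsetP[s [y [sB yk ->]]].
have := ch1D2sn2 R a s; rewrite chD aB // IH // mulr1 expr1n => /eqP.
by rewrite addrC -subr_eq0 addrK sqrf_eq0 => /eqP ->; rewrite mul0r subr0.
Qed.

Lemma growth_step (R : realFieldType) (f : nat -> nat) (a : R) n : 0 <= a ->
  (forall i, (i < n)%N -> a * (f i)%:R <= (f i.+1)%:R) -> a ^+ n * (f 0)%:R <= (f n)%:R.
Proof.
move=> a0; elim: n => [_|n IH h]; first by rewrite expr0 mul1r.
rewrite exprS -mulrA; apply: le_trans (h n (ltnSn n)); rewrite ler_wpM2l // IH // => i lin.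
by apply: h; apply: ltnW.
Qed.

(** A set [V = mK], with [K] a fixed multiple of [B], is found that adding [K] hardly enlarges. A
    large coefficient of [V] then has positive cosine on all of [K], which makes [psi] additive
    there, as [cprog_of_local_hom] requires. A multiple of [K] that is itself a subgroup ends the
    search earlier, with [l = 1]. *)
Lemma cprog_in_nfold (R : realType) : exists L : nat,
  forall q (B : {set 'I_q.+1}), 0%R \in B -> symmetric B ->
  (forall l, (l <= L)%N -> (#|nfold (2 ^ l) B|%:R : R) <= (21 / 10) ^+ l * #|B|%:R) ->
  exists H d l, [/\ subgroup H, (0 < l)%N, #|cprog H d l| = (#|H| * l)%N,
    cprog H d l \subset nfold (2 ^ L) B & (#|B| <= 3 * #|cprog H d l|)%N].
Proof.
have [Lc hLc] := cprog_of_local_hom R.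
pose A0 := (Lc + 6)%N.
(* [500 / 441] is 5 divided by [(21 / 10) ^+ 2]: growth by more than 5 at each of [I] steps of two
   doublings would exceed the assumed growth. *)
have [|I hI] := @expr_unbounded R (500 / 441) ((21 / 10) ^+ A0); first by lra.
have {hI} := hI I (leqnn I) => hI.
exists (A0 + 2 * I + 4)%N => q B B0 symB growth.
have Bp : 0 < #|B|%:R :> R by rewrite ltr0n card_gt0; apply/set0Pn; exists 0.
have Bf k : (0 < k)%N -> (#|B| <= #|nfold k B|)%N.
  by move=> k0; rewrite -{1}[B]nfold1; apply: subset_leq_card; apply: nfold_mono.
have [i iI hi] : exists2 i, (i < I)%N & (#|nfold (2 ^ (A0 + 2 * i.+1)) B| <= 5 * #|nfold (2 ^ (A0 + 2 * i)) B|)%N.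
  pose P i := (#|nfold (2 ^ (A0 + 2 * i.+1)) B| <= 5 * #|nfold (2 ^ (A0 + 2 * i)) B|)%N.
  have [/existsP[i Pi]|/existsPn none] := boolP [exists i : 'I_I, P i]; first by exists i.
  exfalso; have := @growth_step R (fun i => #|nfold (2 ^ (A0 + 2 * i)) B|) 5 I (ler0n _ _).
  have gs i : (i < I)%N -> 5 * #|nfold (2 ^ (A0 + 2 * i)) B|%:R <= #|nfold (2 ^ (A0 + 2 * i.+1)) B|%:R :> R.
    by move=> iI; have := none (Ordinal iI); rewrite /P /= -ltnNge => /ltnW; rewrite -natrM ler_nat.
  move/(_ gs).
  apply/negP; rewrite -ltNge; apply: le_lt_trans (growth _ _) _; first by rewrite leq_addr.
  apply: lt_le_trans (_ : 5 ^+ I * #|B|%:R <= _); last first.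
    by rewrite ler_wpM2l ?exprn_ge0 // ler_nat Bf // expn_gt0.
  rewrite ltr_pM2r // exprD exprM.
  have -> : 5 ^+ I = (500 / 441) ^+ I * ((21 / 10) ^+ 2) ^+ I :> R.
    by rewrite -exprMn; congr (_ ^+ I); lra.
  by rewrite ltr_pM2r // exprn_gt0 // exprn_gt0 //; lra.
pose M := (2 ^ (2 * i + 6))%N; pose K := nfold (2 ^ Lc) B.
have M64 : (64 <= M)%N by rewrite /M addnC expnD leq_pmulr // expn_gt0.
have K0 : 0 \in K by apply: nfold_0.
have symK : symmetric K by apply: nfold_symmetric.
have mono m n : (m <= n)%N -> nfold m K \subset nfold n K by apply: nfold_mono.
have sizeK m : (m <= 16 * M)%N -> nfold m K \subset nfold (2 ^ (A0 + 2 * I + 4)) B.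
  move=> mM; rewrite -nfoldM; apply: nfold_mono => //.
  apply: leq_trans (leq_mul mM (leqnn _)) _; rewrite /M -(expnD 2 4) -expnD leq_exp2l //.
  by move: iI; rewrite /A0; pure_lia.
pose W := nfold M K.
have W4 : (#|nfold (4 * M) K| <= 5 * #|W|)%N.
  move: hi; rewrite /W -!nfoldM /M -(expnD 2 2) -!expnD.
  have -> : (A0 + 2 * i.+1 = 2 + (2 * i + 6) + Lc)%N by rewrite /A0; pure_lia.
  by have -> : (A0 + 2 * i = (2 * i + 6) + Lc)%N by rewrite /A0; pure_lia.
(* Otherwise the growth from [2M] to [4M] is at least [1 + 2M / 21], more than 5 because [M >= 64];
   hence the 6 in [A0]. *)
have [m mM hm] : exists2 m, (2 * M <= m < 4 * M)%N & (21 * #|nfold m.+1 K| <= 22 * #|nfold m K|)%N.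
  pose P j := (21 * #|nfold (2 * M + j).+1 K| <= 22 * #|nfold (2 * M + j) K|)%N.
  have [/existsP[j Pj]|/existsPn none] := boolP [exists j : 'I_(2 * M), P j].
    exists (2 * M + j)%N => //; have := ltn_ord j; pure_lia.
  have a0 : 0 <= 1 + 1 / 21 :> R by lra.
  exfalso; have := @growth_step R (fun j => #|nfold (2 * M + j) K|) (1 + 1 / 21) (2 * M) a0.
  have gs j : (j < 2 * M)%N -> (1 + 1 / 21) * #|nfold (2 * M + j) K|%:R <= #|nfold (2 * M + j.+1) K|%:R :> R.
    move=> jM; have := none (Ordinal jM); rewrite /P /= -ltnNge addnS => /ltnW.
    by rewrite -(ler_nat R) !natrM; move: (#|_|%:R) (#|_|%:R); pure_lra.
  move/(_ gs); rewrite addn0 -mulnDl => h.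
  have h5 : (#|nfold ((2 + 2) * M) K|%:R : R) <= 5 * #|nfold (2 * M) K|%:R.
    rewrite -natrM ler_nat; apply: leq_trans W4 _; rewrite leq_mul2l /=; apply: subset_leq_card.
    by apply: mono; rewrite leq_pmull.
  have := le_trans h h5; apply/negP; rewrite -ltNge ltr_pM2r; last first.
    by rewrite ltr0n card_gt0; apply/set0Pn; exists 0; apply: nfold_0.
  apply: lt_le_trans (bernoulli _ _); last by lra.
  have : 64 <= M%:R :> R by rewrite ler_nat.
  rewrite natrM; lra.
move/andP: mM => [m2 m4]; pose V := nfold m K.
have symV : symmetric V by apply: nfold_symmetric.
have V0 : V != set0 by apply/set0Pn; exists 0; apply: nfold_0.
have Bout n : (0 < n <= 16 * M)%N -> subgroup (nfold n K) ->
   exists H d l, [/\ subgroup H, (0 < l)%N, #|cprog H d l| = (#|H| * l)%N,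
    cprog H d l \subset nfold (2 ^ (A0 + 2 * I + 4)) B & (#|B| <= 3 * #|cprog H d l|)%N].
  move=> /andP[n0 nM] sg; have [c1 c2] := cprog_subgroup sg.
  exists (nfold n K), 0, 1%N; split=> //; rewrite c2; first exact: sizeK.
  rewrite -nfoldM; apply: leq_trans (Bf _ _) (leq_pmull _ _) => //.
  by rewrite muln_gt0 n0 expn_gt0.
(* Doubling below 3/2 yields a subgroup at once; failing that twice, [|4mK| >= 9/4 * |V|], as
   [exists_frequency] needs. *)
have [sm|lg] := ltnP (2 * #|nfold (2 * m) K|) (3 * #|V|).
  apply: (Bout (2 * m)%N); first by move: m2 m4 M64; pure_lia.
  have e : (2 * m = m + m)%N by pure_lia.
  rewrite e nfoldD in sm *; exact: subgroup_of_small_doubling.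
have [sm|lg'] := ltnP (2 * #|nfold (4 * m) K|) (3 * #|nfold (2 * m) K|).
  apply: (Bout (4 * m)%N); first by move: m2 m4 M64; pure_lia.
  have e : (4 * m = 2 * m + 2 * m)%N by pure_lia.
  rewrite e nfoldD in sm *; apply: subgroup_of_small_doubling => //.
    exact: nfold_symmetric.
  by apply/set0Pn; exists 0; apply: nfold_0.
have [||||||||a [s0 [s0B cs0 Vbeta]]] := @exists_frequency R q B W V (nfold (4 * m) K).
- by apply/set0Pn; exists 0; apply: nfold_0.
- exact: nfold_symmetric.
- exact: nfold_symmetric.
- exact: nfold_symmetric.
- by rewrite -nfoldD addnn -mul2n; apply: mono.
- by apply: leq_trans W4; apply: subset_leq_card; apply: mono; apply: ltnW.
- by move: lg lg'; move: (#|_|) (#|_|) (#|_|); pure_lia.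
- by move=> a' aB x; rewrite -nfoldM; apply: ch_nfold.
(* A nonpositive cosine would give [beta V a <= 2 * nu V s <= 2/21 * |V|], less than [|V| / 10]. *)
have chK s : s \in K -> 0 < ch R q a s.
  move=> sK; have := beta_nu R a s symV; have := nu_sumset V K0 sK; rewrite -nfoldS.
  rewrite -(ler_nat R) natrD => h1 h2; move: hm; rewrite -(ler_nat R) !natrM => h3.
  have Vp : 0 < #|V|%:R :> R by rewrite ltr0n card_gt0.
  rewrite ltNge; apply/negP => c0; have := ler_wpM2l (ltW Vp) c0; rewrite mulr0.
  move: h1 h2 h3 Vbeta c0 Vp; rewrite -/V.
  move: (beta R V a) (ch R q a s) (#|V|%:R : R) (#|_|%:R) (_%:R) => b c v w n h1 h2 h3 h4 c0 v0 _.
  have : 0 <= b * - c by rewrite mulr_ge0 ?oppr_ge0 //; move: h4 v0; pure_lra.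
  by move: h1 h2 h3 h4 v0; rewrite mulrBr mulr1 mulrN; move: (b * c); pure_lra.
have [|||H [d [l [sgH l0 cH HB BH]]]] := hLc _ B (psi q a) B0 symB.
- move=> x y xK yK xyK; apply: psi_additive; exact: chK.
- by exists s0 => //; apply/eqP => /(@psi_eq0 R); apply/eqP.
- move=> l lL; apply: growth; apply: leq_trans lL _; rewrite /A0; pure_lia.
exists H, d, l; split=> //; apply: subset_trans HB _; rewrite -/K -[K]nfold1; apply: sizeK.
by move: M64; pure_lia.
Qed.

(** * Dense pieces of sets with few popular sums *)

Section Scales.
Variable R : realType.

(** Take [i] maximising [f i] divided by [(21/10) ^ i]; growth from [i] on is then at most 21/10 per
    step. If [i] lay within [L] of the end, the total growth would exceed [C * 2 ^ I]. *)
Lemma slow_growth_scale (f : nat -> R) (C : R) L I :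
  (forall i, (i <= I)%N -> f i <= f I) -> 0 < f 0%N -> f I <= C * 2 ^+ I * f 0%N ->
  C * (21 / 10) ^+ L < (21 / 20) ^+ I ->
  exists2 i, (i + L <= I)%N & forall l, (l <= L)%N -> f (i + l)%N <= (21 / 10) ^+ l * f i.
Proof.
move=> fI f0 fC CL; set mu : R := 21 / 10 in CL *.
have mu0 : 0 < mu by rewrite /mu; lra.
have [i _ imax] := @Order.TotalTheory.arg_maxP _ _ _ (@ord0 I) xpredT (fun i => f i * mu ^+ (I - i)) isT.
have {}imax j : (j <= I)%N -> f j * mu ^+ (I - j) <= f i * mu ^+ (I - i).
  by move=> jI; apply: (imax (Ordinal (jI : (j < I.+1)%N))).
have iI : (i <= I)%N by rewrite -ltnS.
have [iL|iL] := leqP (i + L) I.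
  exists i => // l lL; have ilI : (i + l <= I)%N by apply: leq_trans iL; rewrite leq_add2l.
  have := imax _ ilI; have -> : (I - i = l + (I - (i + l)))%N by move: ilI; pure_lia.
  by rewrite exprD mulrA ler_pM2r ?exprn_gt0 // mulrC.
exfalso; have := imax _ (leq0n I); rewrite subn0; apply/negP; rewrite -ltNge.
apply: le_lt_trans (_ : _ <= f I * mu ^+ L) _.
  apply: ler_pM; rewrite ?exprn_ge0 ?(ltW mu0) ?fI //.
    have := imax _ (leq0n I); rewrite subn0 => h.
    by rewrite -(pmulr_lge0 _ (exprn_gt0 (I - i) mu0)); apply: le_trans h; rewrite mulr_ge0 ?exprn_ge0 ?ltW.
  by rewrite ler_weXn2l //; [rewrite /mu; lra|move: iL iI; pure_lia].
apply: le_lt_trans (ler_wpM2r (exprn_ge0 _ (ltW mu0)) fC) _.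
have -> : mu ^+ I = (21 / 20) ^+ I * 2 ^+ I :> R by rewrite -exprMn; congr (_ ^+ I); rewrite /mu; lra.
have -> : C * 2 ^+ I * f 0%N * mu ^+ L = C * mu ^+ L * (2 ^+ I * f 0%N) by ring.
by rewrite [ltRHS]mulrC -[ltRHS]mulrA ltr_pM2r // mulr_gt0 ?exprn_gt0.
Qed.

Lemma dyadic_scale (x y : R) n : 0 < x -> 2 ^+ n.+1 * x <= y ->
  exists2 I, (n <= I)%N & 2 ^+ I.+1 * x <= y < 2 ^+ I.+2 * x.
Proof.
move=> x0 h; have ex : exists m, y < 2 ^+ m * x.
  have [|m /(_ m (leqnn m)) hm] := @expr_unbounded R 2 (y / x); first by lra.
  by exists m; rewrite -ltr_pdivrMr.
case: (ex_minnP ex) => m hm mmin.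
have nm : (n.+2 <= m)%N.
  rewrite leqNgt; apply/negP => mn; have : 2 ^+ m * x <= y.
    apply: le_trans h; rewrite ler_pM2r // ler_weXn2l //; lra.
  by rewrite leNgt hm.
exists m.-2; first by move: nm; pure_lia.
have -> : m.-2.+2 = m by move: nm; pure_lia.
rewrite hm andbT leNgt; apply/negP => /mmin; move: nm; pure_lia.
Qed.

End Scales.

Section AlmostPeriods.
Variable R : realType.
Local Notation "A '%:c'" := (#|A|%:R : R) (at level 2, format "A %:c").

(** When [T + x] and [T + y] lie almost inside [U], both [U] and [U + (x - y)] almost contain
    [T + x], so they differ by little more than [|U| - |T|]. *)
Lemma nu_fragment (G : finZmodType) (T U : {set G}) (x y : G) :
  (nu U (x - y)%R + #|T| <= #|U| + 2 * #|shift T x :\: U| + #|shift T y :\: U|)%N.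
Proof.
have h1 := card_setD_triangle U (shift T x) (shift U (x - y)).
have h2 : #|shift T x :\: shift U (x - y)%R| = #|shift T y :\: U|.
  by rewrite -(card_shift _ (y - x)) shiftD !shift_shift [(x + _)%R]addrC subrK -[(x - y)%R]opprB addNr shift0.
have h3 : (#|U :\: shift T x| + #|T| = #|U| + #|shift T x :\: U|)%N.
  have := cardsID (shift T x) U; have := cardsID U (shift T x); rewrite card_shift setIC.
  by clia.
by move: h1 h2 h3; rewrite /nu; move: (#|_|) (#|_|) (#|_|) (#|_|) (#|_|) (#|_|); pure_lia.
Qed.

(* The conclusion of [cprog_in_nfold], which holds for cyclic groups only. *)
Definition cprog_growth (L : nat) (G : finZmodType) := forall B : {set G}, 0 \in B -> symmetric B ->
  (forall l, (l <= L)%N -> (nfold (2 ^ l) B)%:c <= (21 / 10) ^+ l * B%:c) ->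
  exists H d l, [/\ subgroup H, (0 < l)%N, #|cprog H d l| = (#|H| * l)%N,
    cprog H d l \subset nfold (2 ^ L) B & (#|B| <= 3 * #|cprog H d l|)%N].

(* If the e-transforms end with a small [X], then the differences of most pairs in
   [X] are [2|X|]-almost periods of [U]. Their sumsets stay bounded by [2|U|] for many
   dyadic scales, over which the average growth is therefore less than [21/10]. *)
Lemma small_progression (kap eta : R) L : 0 < kap -> 0 < eta ->
  exists c g : R, [/\ 0 < c, 0 < g & forall (G : finZmodType) (S U : {set G}), cprog_growth L G -> S != set0 ->
    U%:c <= (2 + c) * S%:c -> (bad S S U)%:R <= g * S%:c ^+ 2 ->
  (exists H d l, [/\ subgroup H, (0 < l)%N, #|cprog H d l| = (#|H| * l)%N,
     c * S%:c <= (cprog H d l)%:c & forall p, p \in cprog H d l -> (nu U p)%:R <= kap * S%:c]) \/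
  (exists (H Z : {set G}), [/\ subgroup H, sumset Z H \subset Z, c * S%:c <= H%:c,
     (S :\: Z)%:c <= eta * S%:c & Z%:c <= U%:c + eta * S%:c])].
Proof.
move=> kap0 eta0; wlog kap1 : kap kap0 / kap <= 1 / 2.
  move=> h; have [||c [g [c0 g0 hcg]]] := h (Num.min kap (1 / 2)).
  - by rewrite lt_min kap0; lra.
  - by rewrite ge_min lexx orbT.
  exists c, g; split=> // G S U hL S0 hU hb; case: (hcg G S U hL S0 hU hb) => [[H [d [l [h1 h2 h3 h4 h5]]]]|]; [left|by right].
  exists H, d, l; split=> // p pP; apply: le_trans (h5 p pP) _.
  by rewrite ler_wpM2r // ge_min lexx.
have [|I0 hI0] := @expr_unbounded R (21 / 20) (48 / kap * (21 / 10) ^+ L); first by lra.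
have e0 : 0 < kap / 2 ^+ I0.+1 by rewrite divr_gt0 // exprn_gt0.
have e1 : kap / 2 ^+ I0.+1 < 1.
  rewrite ltr_pdivrMr ?exprn_gt0 // mul1r; apply: le_lt_trans kap1 _.
  by apply: lt_le_trans (exprn_ege1 _ _); lra.
(* The final [X] has size at most [kap * |S| / 2 ^ (I0 + 1)], which leaves at least [I0] doublings
   before the error reaches [kap * |S|]. *)
have [c0 c00 hc0] := etransform_dichotomy e0 e1 eta0.
pose c := Num.min (c0 / 6) (1 / 2).
have cp : 0 < c by rewrite lt_min; lra.
have cc0 : c * 6 <= c0 by have : c <= c0 / 6 by [rewrite ge_min lexx]; lra.
have c1 : c <= 1 / 2 by rewrite ge_min lexx orbT.
have [|g g0 hg] := hc0 (c0 * c / 2); first by rewrite divr_gt0 // mulr_gt0.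
exists c, g; split=> // G S U hL S0 hU hb.
have Sp : 0 < S%:c by rewrite ltr0n card_gt0.
have {}hU3 : U%:c <= 3 * S%:c by apply: le_trans hU _; rewrite ler_pM2r //; lra.
have [[T [X [XS ST TX /andP[cX Xe] badTX]]]|[H [Z [sgH ZH cH SZ ZU]]]] := hg _ S U S0 hU3 hb; last first.
  right; exists H, Z; split=> //; apply: le_trans cH; rewrite ler_pM2r //; move: cc0 cp; pure_lra.
left; have Xp : 0 < X%:c by apply: lt_le_trans cX; rewrite mulr_gt0.
pose X' := [set x in X | ~~ (c * S%:c < (#|shift T x :\: U|%:R : R))].
have cX' : X%:c <= 2 * X'%:c.
  have cS : 0 < c * S%:c by rewrite mulr_gt0.
  have h : (\sum_(x in X) #|shift T x :\: U|)%:R <= c0 * S%:c / 2 * (c * S%:c).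
    rewrite -bad_row; apply: le_trans badTX _.
    by have -> : c0 * c / 2 * S%:c ^+ 2 = (c0 * S%:c) / 2 * (c * S%:c) by rewrite expr2; ring.
  have {h} := markov_good cS h.
  by rewrite -/X'; move: cX; move: (c0 * S%:c) (X'%:c) (X%:c); pure_lra.
pose D := diffset X' X'.
have X'0 : X' != set0.
  by rewrite -card_gt0 -(ltr0n R); move: cX' Xp; pure_lra.
have D0 : 0 \in D by case/set0Pn: X'0 => x xX; rewrite -(subrr x); apply: mem_diffset.
have symD : symmetric D.
  by apply/symmetricP => _ /diffsetP[x [y [xX yX ->]]]; rewrite opprB; apply: mem_diffset.
(* [|U| - |T|] is at most [c * |S| + |X|] and the two translates add [3c * |S|]; the choice
   [6c <= c0] absorbs these into a second [|X|]. *)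
have nuD2 t : t \in D -> (nu U t <= 2 * #|X|)%N.
  case/diffsetP => x [y [+ + ->]]; rewrite !inE -!leNgt => /andP[_ hx] /andP[_ hy].
  have := nu_fragment T U x y; rewrite -!(ler_nat R) !natrM natrD natrD natrD natrM.
  have : 2 * S%:c = T%:c + X%:c by rewrite -natrM -TX natrD.
  have : c * 6 * S%:c <= c0 * S%:c by rewrite ler_pM2r.
  move: hx hy hU cX Xp; rewrite mulrDl (mulrC c 6) -(mulrA 6); move: (c * S%:c) (c0 * S%:c).
  by pure_lra.
have [|I I0I /andP[I1 I2]] := @dyadic_scale R X%:c (kap * S%:c) I0 Xp.
  by rewrite mulrC -ler_pdivlMr ?exprn_gt0 // mulrAC.
have nuI k t : t \in nfold k D -> (nu U t <= k * (2 * #|X|))%N by apply: nu_nfold.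
have U0 : S%:c <= U%:c.
  case/set0Pn: X'0 => x; rewrite !inE -leNgt => /andP[_ hx].
  have : T%:c <= U%:c + c * S%:c.
    have := cardsID U (shift T x); rewrite card_shift => <-; rewrite natrD lerD // ler_nat.
    by rewrite subset_leq_card // subsetIr.
  have : 2 * S%:c = T%:c + X%:c by rewrite -natrM -TX natrD.
  have : X%:c <= 1 / 2 * S%:c.
    apply: le_trans Xe _; rewrite ler_pM2r // ler_pdivrMr ?exprn_gt0 // exprS.
    by have : 1 <= 2 ^+ I0 :> R; [apply: exprn_ege1; lra|move: kap1; pure_lra].
  have : c * S%:c <= 1 / 2 * S%:c by rewrite ler_pM2r.
  pure_lra.
have cI : (#|nfold (2 ^ I) D| <= 2 * #|U|)%N.
  apply: leq_trans (card_ball (r := 2 ^ I * (2 * #|X|)) _ _).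
  - by apply/subset_leq_card/subsetP => t; rewrite inE; apply: nuI.
  - rewrite -(ler_nat R) !natrM natrX; apply: le_trans U0; move: I1; rewrite exprSr.
    have : kap * S%:c <= 1 / 2 * S%:c by rewrite ler_pM2r.
    move: (2 ^+ I) => z h1 h2; have e : 2 * (z * (2 * X%:c)) = 2 * (z * 2 * X%:c) by ring.
    by rewrite e; move: h1 h2; pure_lra.
  - by rewrite -(ltr0n R); apply: lt_le_trans U0.
have cD : X%:c <= 2 * D%:c.
  apply: le_trans cX' _; rewrite ler_pM2l ?ler_nat ?sub_card_diffset //; lra.
pose f i : R := #|nfold (2 ^ i) D|%:R.
(* The last sumset has at most [6 * |S|] elements, and [kap * |S| < 2 ^ (I + 2) * |X| <= 2 ^ (I + 3)
   * |D|]; thus [48 = 6 * 8]. *)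
have [||||i iI fi] := @slow_growth_scale R f (48 / kap) L I.
- move=> i iI; rewrite ler_nat; apply: subset_leq_card; apply: nfold_mono => //.
  by rewrite leq_exp2l.
- by rewrite ltr0n card_gt0; apply/set0Pn; exists 0; apply: nfold_0.
- rewrite /f expn0 nfold1; apply: le_trans (_ : 6 * S%:c <= _).
    by move: cI hU3; rewrite -(ler_nat R) natrM; pure_lra.
  have -> : 48 / kap * 2 ^+ I * D%:c = 48 * 2 ^+ I * D%:c / kap by ring.
  rewrite ler_pdivlMr //; move: I2; rewrite !exprS.
  have := ler_wpM2l (exprn_ge0 I (ler0n R 2)) cD; rewrite mulrCA => h1 h2.
  apply: le_trans (_ : 6 * (kap * S%:c) <= _); first by move: (kap) (S%:c) => u v; rewrite -mulrA [v * u]mulrC.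
  move: h1 (ltW h2); rewrite -!mulrA; move: (2 ^+ I * X%:c) (2 ^+ I * D%:c); pure_lra.
- exact: hI0.
have [|||H [d [l [sgH l0 cH HB BH]]]] := hL (nfold (2 ^ i) D).
- exact: nfold_0.
- exact: nfold_symmetric.
- by move=> l lL; rewrite -nfoldM -expnD addnC; apply: fi.
exists H, d, l; split=> //.
  have : D%:c <= 3 * (cprog H d l)%:c.
    rewrite -natrM ler_nat; apply: leq_trans BH; rewrite -{1}[D]nfold1.
    by apply: subset_leq_card; apply: nfold_mono; rewrite ?expn_gt0.
  have : c * 6 * S%:c <= c0 * S%:c by rewrite ler_pM2r.
  by move: cX cD; rewrite (mulrC c) -mulrA; move: (c * S%:c) (c0 * S%:c); pure_lra.
move=> p /(subsetP HB); rewrite -nfoldM -expnD => /nuI h.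
apply: le_trans I1; apply: le_trans (_ : (2 ^ (L + i) * (2 * #|X|))%N%:R <= _); first by rewrite ler_nat.
rewrite mulnA -expnSr natrM natrX ler_pM2r // ler_weXn2l //; first by lra.
by move: iI; pure_lia.
Qed.
End AlmostPeriods.

(** * Smoothing a set and its popular sums by almost periods *)

Section Smoothing.
Variables (R : realType) (G : finZmodType).
Implicit Types (S P U : {set G}) (x y z p : G) (tau : R).
Local Notation "A '%:c'" := (#|A|%:R : R) (at level 2, format "A %:c").

Definition conv S P x := #|[set p in P | (x - p)%R \in S]|.
Definition conv2 U P z := (\sum_(p in P) \sum_(p' in P) ((z - p - p')%R \in U : nat))%N.
Definition thick tau S P := [set x | tau * P%:c <= (conv S P x)%:R].
Definition thick2 tau U P := [set z | tau * P%:c ^+ 2 <= (conv2 U P z)%:R].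

Lemma convE S P x : conv S P x = (\sum_(p in P) ((x - p)%R \in S : nat))%N.
Proof. by rewrite sum_predE. Qed.

Lemma conv_le S P x : (conv S P x <= #|P|)%N.
Proof. by apply: subset_leq_card; apply/subsetP => p; rewrite inE => /andP[]. Qed.

Lemma sum_conv_in S P (E : {set G}) :
  (\sum_(x in E) conv S P x = \sum_(p in P) #|S :&: shift E (- p)|)%N.
Proof.
rewrite (eq_bigr _ (fun x _ => convE S P x)) exchange_big; apply: eq_bigr => p _.
rewrite sum_predE -(card_shift _ (- p)); apply: eq_card => x.
by rewrite !inE opprK addrK andbC.
Qed.

Lemma sum_conv S P : (\sum_x conv S P x = #|S| * #|P|)%N.
Proof.
have -> : (\sum_x conv S P x = \sum_(x in [set: G]) conv S P x)%N by apply: eq_bigl => x; rewrite inE.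
rewrite sum_conv_in mulnC -sum_nat_const; apply: eq_bigr => p _; apply: eq_card => x.
by rewrite !inE andbT.
Qed.

Lemma conv_sumset S P x : x \notin sumset S P -> conv S P x = 0%N.
Proof.
move=> xn; apply/eqP; rewrite cards_eq0; apply/eqP/setP => p; rewrite !inE.
by apply/negP => /andP[pP xpS]; rewrite -[x](subrK p) mem_sumset in xn.
Qed.

Lemma sum_conv_thick tau S P : 0 <= tau ->
  S%:c * P%:c - tau * P%:c * (sumset S P)%:c <= (\sum_(x in thick tau S P) conv S P x)%:R.
Proof.
move=> tau0; rewrite -natrM -sum_conv (bigID (mem (thick tau S P))) /= natrD.
rewrite lerBlDr lerD2l natr_sum mulr_natr -sumr_const.
rewrite [leLHS](bigID (mem (sumset S P))) /= [X in _ + X]big1 ?addr0; last first.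
  by move=> x /andP[_ /conv_sumset ->].
rewrite [leLHS]big_mkcond [leRHS]big_mkcond /=; apply: ler_sum => x _.
case: (x \in sumset S P); rewrite ?andbF ?andbT //.
case: ifP => [|_]; last by rewrite mulr_ge0.
by rewrite inE -ltNge => /ltW.
Qed.

Lemma thick_sub tau S P : 0 < tau -> P != set0 -> thick tau S P \subset sumset S P.
Proof.
move=> tau0 P0; apply/subsetP => x; rewrite inE; apply: contraTT => /conv_sumset ->.
by rewrite -ltNge mulr_gt0 // ltr0n card_gt0.
Qed.

(** For [x], [y] in the thick set, at least [tau ^+ 2 * |P| ^ 2] pairs [(p, p')] bring both back
    into [S]. If [x + y] is not in [thick2], fewer than half that many bring it into [U], and the
    others are bad pairs of [S]; each bad pair arises [|P| ^ 2] times. *)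
Lemma bad_thick tau S U P : 0 <= tau ->
  tau ^+ 2 / 2 * P%:c ^+ 2 * (bad (thick tau S P) (thick tau S P) (thick2 (tau ^+ 2 / 2) U P))%:R <=
  P%:c ^+ 2 * (bad S S U)%:R.
Proof.
move=> tau0; set T := thick tau S P; set V := thick2 _ U P.
pose B x y := (\sum_(p in P) \sum_(p' in P)
  [&& (x - p)%R \in S, (y - p')%R \in S & (x + y - p - p')%R \notin U])%N.
have BE : (\sum_x \sum_y B x y = #|P| * (#|P| * bad S S U))%N.
  have e p p' : (\sum_x \sum_y
      [&& (x - p)%R \in S, (y - p')%R \in S & (x + y - p - p')%R \notin U] = bad S S U)%N.
    rewrite /bad [RHS]big_mkcond (reindex_inj (addIr p)); apply: eq_bigr => x _.
    rewrite addrK; case: (x \in S); last by rewrite big1.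
    rewrite [RHS]big_mkcond (reindex_inj (addIr p')); apply: eq_bigr => y _.
    have -> : x + p + (y + p') - p - p' = x + y by rewrite addrACA -(addrA (x + y + _)) -opprD addrK.
    by rewrite addrK; case: (y \in S).
  rewrite (eq_bigr _ (fun x _ => exchange_big _ _ _ _ _ _)) exchange_big -sum_nat_const.
  apply: eq_bigr => p _ /=.
  rewrite (eq_bigr _ (fun x _ => exchange_big _ _ _ _ _ _)) exchange_big -sum_nat_const.
  by apply: eq_bigr => p' _ /=; apply: e.
rewrite -[X in _ <= X * _]natrX -natrM expnS expn1 -mulnA -BE.
rewrite /bad !natr_sum mulr_sumr [leLHS]big_mkcond; apply: ler_sum => x _.
case: ifP => [xT|_]; last by [].
rewrite !natr_sum mulr_sumr [leLHS]big_mkcond; apply: ler_sum => y _.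
case: ifP => [yT|_]; last by [].
have [_|] := boolP (x + y \in V); first by rewrite mulr0.
rewrite mulr1 inE -ltNge => /ltW small.
have key : (conv S P x * conv S P y <= conv2 U P (x + y)%R + B x y)%N.
  rewrite !convE big_distrlr /= /conv2 /B -big_split; apply: leq_sum => p _ /=.
  rewrite -big_split; apply: leq_sum => p' _ /=.
  by case: (_ - p \in S); case: (_ - p' \in S); case: (_ \in U).
move: key; rewrite -(ler_nat R) natrM natrD => key.
move: xT yT; rewrite !inE => xT yT.
have := ler_pM (mulr_ge0 tau0 (ler0n _ _)) (mulr_ge0 tau0 (ler0n _ _)) xT yT.
have -> : tau * P%:c * (tau * P%:c) = tau ^+ 2 / 2 * P%:c ^+ 2 + tau ^+ 2 / 2 * P%:c ^+ 2 by field.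
move: key small; move: (_ * P%:c ^+ 2) (_ * _); pure_lra.
Qed.

(** For fixed [p], [p'], at most [nu U (p + p') <= 2k] points outside [U] come from [U] by adding
    [p + p']; a point of [thick2] needs [tau * |P| ^ 2] such pairs. *)
Lemma card_thick2 tau U P (k : R) : (forall p, p \in P -> (nu U p)%:R <= k) -> 0 < tau -> P != set0 ->
  (thick2 tau U P :\: U)%:c * tau <= 2 * k.
Proof.
move=> Pk tau0 P0; have Pp : 0 < P%:c by rewrite ltr0n card_gt0.
rewrite -(ler_pM2r (exprn_gt0 2 Pp)) -mulrA [leLHS]mulr_natl -[leLHS]sumr_const.
apply: le_trans (_ : \sum_(z in thick2 tau U P :\: U) (conv2 U P z)%:R <= _).
  by apply: ler_sum => z; rewrite !inE => /andP[_].
rewrite -natr_sum exchange_big /=.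
have -> : 2 * k * P%:c ^+ 2 = \sum_(p in P) \sum_(p' in P) (2 * k).
  by rewrite !sumr_const -!(mulr_natr (2 * k)) -[X in _ = X]mulr_natr; ring.
rewrite natr_sum; apply: ler_sum => p pP; rewrite exchange_big /= natr_sum; apply: ler_sum => p' pP'.
rewrite sum_predE; apply: le_trans (_ : (nu U (p + p')%R)%:R <= _).
  rewrite ler_nat -nuN /nu -[leqRHS](card_shift _ (p + p')) shiftD shift_shift addNr shift0.
  apply/subset_leq_card/subsetP => z; rewrite !inE opprD addrA => /andP[/andP[-> _] ->] //.
apply: le_trans (_ : (nu U p + nu U p')%N%:R <= _); first by rewrite ler_nat nuD.
by rewrite natrD; have := Pk _ pP; have := Pk _ pP'; pure_lra.
Qed.

(** A coset progression has a centre of symmetry, so a large value of [conv S P] means high density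
    on a translate of [P] itself. *)
Lemma opp_cprog (H : {set G}) d l x : subgroup H -> (0 < l)%N ->
  [set y | x - y \in cprog H d l] = shift (cprog H d l) (x - d *+ l.-1).
Proof.
move=> sgH l0; apply/setP => y; rewrite inE in_shift; apply/cprogP/cprogP => -[h [i [hH il e]]].
  exists (- h), (l.-1 - i)%N; split; first exact: subgroupN.
    by move: l0 il; pure_lia.
  rewrite mulrnBr; last by move: l0 il; pure_lia.
  have -> : y - (x - d *+ l.-1) = d *+ l.-1 - (x - y) by rewrite !opprB addrCA.
  by rewrite e opprD addrCA.
exists (- h), (l.-1 - i)%N; split; first exact: subgroupN.
  by move: l0 il; pure_lia.
rewrite mulrnBr; last by move: l0 il; pure_lia.
have -> : x - y = d *+ l.-1 - (y - (x - d *+ l.-1)).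
  by rewrite opprB addrA (addrCA (d *+ _)) subrr addr0.
by rewrite e opprD addrCA.
Qed.

End Smoothing.

Section DensePieces.
Variable R : realType.
Local Notation "A '%:c'" := (#|A|%:R : R) (at level 2, format "A %:c").

Lemma coset_density (G : finZmodType) (H Z S : {set G}) (eps a b : R) :
  subgroup H -> sumset Z H \subset Z -> S != set0 -> (1 - a) * S%:c <= (S :&: Z)%:c ->
  Z%:c <= (2 + b) * S%:c -> 0 < 1 - a -> 0 < 2 + b -> (1 / 2 - eps) * (2 + b) <= 1 - a ->
  exists z, (1 / 2 - eps) * H%:c <= (S :&: shift H z)%:c.
Proof.
move=> sgH ZH S0 SZ Z2 a1 b2 ab; have Sp : 0 < S%:c by rewrite ltr0n card_gt0.
have Z0 : Z != set0.
  apply/eqP => Z0; move: SZ; rewrite Z0 setI0 cards0 leNgt => /negP; apply.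
  exact: mulr_gt0.
have [z] := invariant_density S sgH ZH Z0; rewrite -(ler_nat R) !natrM => h.
exists z; rewrite -(ler_pM2r (mulr_gt0 b2 Sp)).
apply: le_trans (_ : (S :&: shift H z)%:c * Z%:c <= _); last by rewrite ler_wpM2l.
apply: le_trans h; apply: le_trans (_ : H%:c * ((1 - a) * S%:c) <= _); last by rewrite ler_wpM2l.
have -> : (1 / 2 - eps) * H%:c * ((2 + b) * S%:c) = H%:c * ((1 / 2 - eps) * (2 + b) * S%:c) by ring.
by rewrite ler_wpM2l // ler_wpM2r.
Qed.

Lemma exists_ge_avg (I : finType) (P : {set I}) (f : I -> nat) (a : R) : P != set0 ->
  a * P%:c <= (\sum_(i in P) f i)%:R -> exists2 i, i \in P & a <= (f i)%:R.
Proof.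
move=> /set0Pn[i0 i0P] h; have [/existsP[i /andP[iP ai]]|/existsPn none] :=
  boolP [exists i, (i \in P) && (a <= (f i)%:R)]; first by exists i.
exfalso; move: h; apply/negP; rewrite -ltNge natr_sum mulr_natr -sumr_const.
apply: ltr_sum => [|i iP]; last by have := none i; rewrite iP ltNge.
by apply/hasP; exists i0; rewrite ?mem_index_enum.
Qed.

Lemma exists_le_avg (I : finType) (P : {set I}) (f : I -> nat) (a : R) : P != set0 ->
  (\sum_(i in P) f i)%:R <= a * P%:c -> exists2 i, i \in P & (f i)%:R <= a.
Proof.
move=> /set0Pn[i0 i0P] h; have [/existsP[i /andP[iP ai]]|/existsPn none] :=
  boolP [exists i, (i \in P) && ((f i)%:R <= a)]; first by exists i.
exfalso; move: h; apply/negP; rewrite -ltNge natr_sum mulr_natr -sumr_const.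
apply: ltr_sum => [|i iP]; last by have := none i; rewrite iP ltNge.
by apply/hasP; exists i0; rewrite ?mem_index_enum.
Qed.

Lemma sumset_shift (G : finZmodType) (Z H : {set G}) t : sumset Z H \subset Z ->
  sumset (shift Z t) H \subset shift Z t.
Proof.
move=> /subsetP ZH; apply/subsetP => _ /sumsetP[z [h [zZ hH ->]]].
by rewrite in_shift addrAC; apply: ZH; apply: mem_sumset => //; rewrite -in_shift.
Qed.

(* [T] is the set where [1_S * 1_P] is not small, and [V] the set where
   [1_U * 1_P * 1_P] is not; [T] inherits from [S] that most of its sums lie in [V].
   After e-transforms of [T] ending with a small fragment, [|T|] is at most about
   [|V| / 2], hence at most about [|S|], and the average of [1_S * 1_P] over [T] is
   close to its maximum [|P|]. *)
Lemma dense_translate (e : R) : 0 < e -> e <= 1 / 64 ->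
  exists c g : R, [/\ 0 < c, 0 < g & forall (G : finZmodType) (S U P : {set G}),
    P != set0 -> S != set0 -> (forall p, p \in P -> (nu U p)%:R <= e * (e / 6) ^+ 2 / 4 * S%:c) ->
    U%:c <= (2 + e) * S%:c -> (bad S S U)%:R <= g * S%:c ^+ 2 ->
    (exists x, (1 - 8 * e) * P%:c <= (conv S P x)%:R) \/
    (exists (H Z : {set G}), [/\ subgroup H, sumset Z H \subset Z, c * S%:c <= H%:c,
       (1 - 8 * e) * S%:c <= (S :&: Z)%:c & Z%:c <= (2 + 8 * e) * S%:c])].
Proof.
move=> e0 e64; have e1 : e < 1 by lra.
have [c0 c00 hc0] := etransform_dichotomy e0 e1 e0.
have [|g0 g00 hg0] := hc0 (e * c0); first by rewrite mulr_gt0.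
(* The sumset [S1 + P] has at most [6 * |S|] elements, so the points below the threshold carry at
   most the share [e] of the mass. *)
have [tau tauE] : exists tau, tau = e / 6 by exists (e / 6).
have tau0 : 0 < tau by rewrite tauE; lra.
have tau2 : 0 < tau ^+ 2 / 2 by rewrite divr_gt0 // exprn_gt0.
pose g := Num.min (e * e) (g0 * (tau ^+ 2 / 2) / 4).
have gp : 0 < g by rewrite lt_min mulr_gt0 // divr_gt0 // mulr_gt0.
have ge2 : g <= e * e by rewrite ge_min lexx.
have gg : g * 4 <= g0 * (tau ^+ 2 / 2) by rewrite -ler_pdivlMr // ge_min lexx orbT.
exists (c0 / 2), g; split=> //; first by rewrite divr_gt0.
move=> G S U P P0 S0; set kap := e * _ ^+ 2 / 4 => Pk hU hb.
have Sp : 0 < S%:c by rewrite ltr0n card_gt0.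
have Pp : 0 < P%:c by rewrite ltr0n card_gt0.
have kape : kap * 4 = e * tau ^+ 2 by rewrite /kap -tauE; field.
have kap1 : kap <= e.
  have : e * tau ^+ 2 <= e * 1 by rewrite ler_wpM2l ?(ltW e0) // expr_le1 // tauE; lra.
  by move: kape e0; move: (e * tau ^+ 2); pure_lra.
pose S1 := [set s in S | ~~ (e * S%:c < (#|shift S s :\: U|%:R : R))].
have S1S : S1 \subset S by apply/subsetP => s; rewrite inE => /andP[].
have S1c : (1 - e) * S%:c <= S1%:c.
  have h : (\sum_(x in S) #|shift S x :\: U|)%:R <= e * S%:c * (e * S%:c).
    rewrite -bad_row; apply: le_trans hb _; rewrite mulrACA -expr2.
    by rewrite ler_wpM2r ?exprn_ge0 ?(ltW Sp).
  have {h} := markov_good (mulr_gt0 e0 Sp) h.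
  by rewrite -/S1 mulrBl mul1r; move: (e * S%:c) (S1%:c); pure_lra.
(* Rows in [S1] lie almost in [U] and [P] hardly moves [U], so every [y] in the sumset puts at least
   half of [S + y] into [U]; these incidences total at most [|U| * |S|]. *)
have sumS : (sumset S1 P)%:c <= 6 * S%:c.
  have h y : y \in sumset S1 P -> 1 / 2 * S%:c <= #|U :&: shift S y|%:R.
    case/sumsetP => s [p [+ pP ->]]; rewrite inE -leNgt => /andP[sS hs].
    have t := card_setD_triangle (shift S (s + p)) (shift U p) U.
    have t1 : #|shift S (s + p)%R :\: shift U p| = #|shift S s :\: U|.
      by rewrite -(card_shift (shift S s :\: U) p) shiftD shift_shift.
    have t2 : #|shift U p :\: U| = nu U p.
      by rewrite -nuN /nu -[RHS](card_shift _ p) shiftD shift_shift addNr shift0.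
    have := cardsID U (shift S (s + p)); rewrite card_shift setIC => t3.
    have := Pk _ pP; move: t hs; rewrite t1 t2 -(ler_nat R) natrD.
    have : kap * S%:c <= e * S%:c by rewrite ler_pM2r.
    have : e * S%:c <= 1 / 64 * S%:c by rewrite ler_pM2r.
    have : S%:c = #|U :&: shift S (s + p)%R|%:R + #|shift S (s + p)%R :\: U|%:R by rewrite -natrD t3.
    by move: Sp; move: (kap * S%:c) (e * S%:c); pure_lra.
  have : \sum_(y in sumset S1 P) (1 / 2 * S%:c) <= (\sum_y #|U :&: shift S y|)%:R.
    rewrite natr_sum big_mkcond /=; apply: ler_sum => y _.
    by case: ifP => // /h.
  rewrite sum_shiftI sumr_const natrM => h'; rewrite -[leLHS]mulr_natr mulrAC ler_pM2r // in h'.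
  have : (2 + e) * S%:c <= 3 * S%:c by rewrite ler_pM2r //; move: e1; pure_lra.
  by move: h' hU; pure_lra.
pose T := thick tau S1 P; pose V := thick2 (tau ^+ 2 / 2) U P.
have mass : (1 - 2 * e) * S%:c * P%:c <= (\sum_(x in T) conv S1 P x)%:R.
  apply: le_trans (sum_conv_thick S1 P (ltW tau0)).
  have -> : S1%:c * P%:c - tau * P%:c * (sumset S1 P)%:c = (S1%:c - tau * (sumset S1 P)%:c) * P%:c by ring.
  rewrite ler_pM2r //; have : tau * (sumset S1 P)%:c <= tau * (6 * S%:c) by rewrite ler_pM2l.
  have -> : tau * (6 * S%:c) = e * S%:c by rewrite tauE; field.
  move: S1c; rewrite !mulrBl mul1r -mulrA; move: (e * S%:c) (tau * (sumset S1 P)%:c); pure_lra.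
have T2 : (1 - 2 * e) * S%:c <= T%:c.
  rewrite -(ler_pM2r Pp); apply: le_trans mass _; rewrite -natrM -sum_nat_const ler_nat.
  by apply: leq_sum => x _; apply: conv_le.
have T6 : T%:c <= 6 * S%:c.
  by apply: le_trans sumS; rewrite ler_nat subset_leq_card // thick_sub.
have Tp : 0 < T%:c by apply: lt_le_trans T2; rewrite mulr_gt0 //; move: e64; pure_lra.
have T0 : T != set0 by rewrite -card_gt0 -(ltr0n R).
have V2 : V%:c <= (2 + 2 * e) * S%:c.
  have h := card_thick2 Pk tau2 P0; rewrite -/V in h.
  have {}h : (V :\: U)%:c <= e * S%:c.
    rewrite -(ler_pM2r tau2); apply: le_trans h _.
    have -> : 2 * (kap * S%:c) = (kap * 4) * S%:c / 2 by field.
    by rewrite kape; have -> : e * S%:c * (tau ^+ 2 / 2) = e * tau ^+ 2 * S%:c / 2 by field.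
  have : V%:c <= U%:c + (V :\: U)%:c.
    rewrite -natrD ler_nat -(cardsID U V) leq_add2r subset_leq_card //; exact: subsetIr.
  have -> : (2 + 2 * e) * S%:c = (2 + e) * S%:c + e * S%:c by ring.
  by move: h hU; move: (e * S%:c) ((2 + e) * _); pure_lra.
have V3 : V%:c <= 3 * T%:c.
  apply: le_trans V2 _; apply: le_trans (_ : 3 * ((1 - 2 * e) * S%:c) <= _).
    by rewrite mulrA ler_pM2r //; move: e64; pure_lra.
  by rewrite ler_pM2l //.
have badT : (bad T T V)%:R <= g0 * T%:c ^+ 2.
  have := bad_thick S1 U P (ltW tau0); rewrite -/T -/V mulrAC [leLHS]mulrC ler_pM2l ?exprn_gt0 // => h.
  rewrite -(ler_pM2l tau2); apply: le_trans h _.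
  apply: le_trans (_ : g * S%:c ^+ 2 <= _).
    by apply: le_trans hb; rewrite ler_nat bad_sub.
  apply: le_trans (_ : g * 4 * T%:c ^+ 2 <= _).
    rewrite -mulrA ler_pM2l // -[4](_ : 2 ^+ 2 = _); last by lra.
    rewrite -exprMn lerXn2r ?nnegrE ?mulr_ge0 //; apply: le_trans (ler_wpM2l _ T2) => //.
    by rewrite mulrA ler_peMl ?(ltW Sp) //; move: e64; pure_lra.
  have -> : tau ^+ 2 / 2 * (g0 * T%:c ^+ 2) = g0 * (tau ^+ 2 / 2) * T%:c ^+ 2 by ring.
  by rewrite ler_wpM2r ?exprn_ge0.
have [[F [X [XT TF FX /andP[cX Xe] badF]]]|[H [Z [sgH ZH cH SZ ZU]]]] := hg0 _ T V T0 V3 badT.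
  left; have X0 : X != set0.
    by rewrite -card_gt0 -(ltr0n R); apply: lt_le_trans cX; rewrite mulr_gt0.
  have [|x xX hx] := @exists_le_avg _ X (fun x => #|shift F x :\: V|) (e * T%:c) X0.
    rewrite -bad_row; apply: le_trans badF _.
    have -> : e * c0 * T%:c ^+ 2 = e * T%:c * (c0 * T%:c) by rewrite expr2; ring.
    by rewrite ler_pM2l // mulr_gt0.
  have hF : F%:c <= V%:c + e * T%:c.
    have := cardsID V (shift F x); rewrite card_shift => <-; rewrite natrD lerD // ler_nat.
    by rewrite subset_leq_card // subsetIr.
  (* From [2|T| = |F| + |X|]: the first term is at most [|V| + e * |T|] and the second at most
     [e * |T|]. *)
  have hT : (1 - e) * T%:c <= (1 + e) * S%:c.
    have : 2 * T%:c = F%:c + X%:c by rewrite -natrM -FX natrD.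
    move: hF Xe V2; rewrite mulrBl !mulrDl -mulrA !mul1r; move: (e * T%:c) (e * S%:c); pure_lra.
  have [|y yT hy] := @exists_ge_avg _ T (conv S1 P) ((1 - 8 * e) * P%:c) T0.
    apply: le_trans mass; rewrite mulrAC ler_pM2r // -(@ler_pM2l _ (1 - e)); last by rewrite subr_gt0.
    rewrite mulrCA; apply: le_trans (ler_wpM2l _ hT) _; first by move: e64; pure_lra.
    rewrite !mulrA ler_pM2r //; move: e0 e64; pure_nra.
  exists y; apply: le_trans hy _; rewrite ler_nat; apply: subset_leq_card; apply/subsetP => p.
  by rewrite !inE => /andP[-> /andP[-> _]].
right.
(* [Z] nearly contains [T], not [S]. Since it carries most of the mass of the convolution, one of
   its translates by [-p] contains most of [S]. *)
have mZ : (1 - 8 * e) * S%:c * P%:c <= (\sum_(x in Z) conv S1 P x)%:R.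
  have h1 : (\sum_(x in T :\: Z) conv S1 P x)%:R <= e * T%:c * P%:c.
    apply: le_trans (_ : (T :\: Z)%:c * P%:c <= _); last by rewrite ler_pM2r.
    by rewrite -natrM ler_nat -sum_nat_const; apply: leq_sum => x _; apply: conv_le.
  have h2 : (\sum_(x in T) conv S1 P x <= \sum_(x in Z) conv S1 P x + \sum_(x in T :\: Z) conv S1 P x)%N.
    rewrite (big_setID Z) /= leq_add2r; apply: leq_sum_sub; exact: subsetIr.
  have h3 : e * T%:c * P%:c <= e * (6 * S%:c) * P%:c by rewrite ler_pM2r // ler_pM2l.
  move: h1 h2 h3 mass; rewrite -(ler_nat R) natrD.
  have -> : (1 - 8 * e) * S%:c * P%:c = (1 - 2 * e) * S%:c * P%:c - e * (6 * S%:c) * P%:c by ring.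
  by move: (e * (6 * S%:c) * P%:c) (e * T%:c * P%:c) ((1 - 2 * e) * S%:c * P%:c); pure_lra.
rewrite sum_conv_in in mZ; have [p pP hp] := exists_ge_avg P0 mZ.
exists H, (shift Z (- p)); split=> //.
- exact: sumset_shift.
- apply: le_trans cH; rewrite -mulrA ler_pM2l //; apply: le_trans T2.
  by rewrite ler_pM2r //; move: e64; pure_lra.
- by apply: le_trans hp _; rewrite ler_nat subset_leq_card // setSI.
rewrite card_shift; apply: le_trans ZU _.
have : e * T%:c <= e * (6 * S%:c) by rewrite ler_pM2l.
rewrite mulrCA; move: V2; rewrite !mulrDl -!mulrA; move: (e * S%:c) (e * T%:c); pure_lra.
Qed.

End DensePieces.

Lemma dense_piece (R : realType) (eps : R) L : 0 < eps -> exists c g : R, [/\ 0 < c, 0 < g &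
  forall (G : finZmodType) (S U : {set G}), cprog_growth R L G -> S != set0 ->
  (#|U|%:R : R) <= (2 + c) * #|S|%:R -> (bad S S U)%:R <= g * #|S|%:R ^+ 2 ->
  (exists H z, [/\ subgroup H, c * #|S|%:R <= #|H|%:R &
     (1 / 2 - eps) * #|H|%:R <= #|S :&: shift H z|%:R]) \/
  (exists H d l z, [/\ subgroup H, (0 < l)%N, #|cprog H d l| = (#|H| * l)%N,
     c * #|S|%:R <= #|cprog H d l|%:R &
     (1 - eps) * #|cprog H d l|%:R <= #|S :&: shift (cprog H d l) z|%:R])].
Proof.
move=> eps0; wlog eps1 : eps eps0 / eps <= 1 / 2.
  move=> h; have [||c [g [c0 g0 hcg]]] := h (Num.min eps (1 / 2)).
  - by rewrite lt_min eps0; lra.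
  - by rewrite ge_min lexx orbT.
  have le : Num.min eps (1 / 2) <= eps by rewrite ge_min lexx.
  exists c, g; split=> // G S U gr S0 hU hb.
  case: (hcg G S U gr S0 hU hb) => [[H [z [h1 h2 h3]]]|[H [d [l [z [h1 h2 h3 h4 h5]]]]]]; [left|right].
    by exists H, z; split=> //; apply: le_trans h3; rewrite ler_wpM2r // lerD2l lerN2.
  by exists H, d, l, z; split=> //; apply: le_trans h5; rewrite ler_wpM2r // lerD2l lerN2.
have [e ee] : exists e, e = eps / 32 by exists (eps / 32).
have e0 : 0 < e by rewrite ee divr_gt0.
have e64 : e <= 1 / 64 by rewrite ee; lra.
(* The quality of almost periods demanded by [dense_translate], passed to [small_progression] as its
   [kap]. *)
have k0 : 0 < e * (e / 6) ^+ 2 / 4 by rewrite divr_gt0 // mulr_gt0 // exprn_gt0 // divr_gt0.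
have [c1 [g1 [c10 g10 h1]]] := dense_translate e0 e64.
have [c2 [g2 [c20 g20 h2]]] := small_progression L k0 e0.
pose c := Num.min e (Num.min c1 c2); have cp : 0 < c by rewrite !lt_min e0 c10.
have ce : c <= e by rewrite ge_min lexx.
have cc1 : c <= c1 by rewrite !ge_min lexx orbT.
have cc2 : c <= c2 by rewrite !ge_min lexx !orbT.
exists c, (Num.min g1 g2); split=> //; first by rewrite lt_min g10.
move=> G S U gr S0 hU hb; have Sp : 0 < #|S|%:R :> R by rewrite ltr0n card_gt0.
have hUc x : c <= x -> #|U|%:R <= (2 + x) * #|S|%:R :> R.
  by move=> cx; apply: le_trans hU _; rewrite ler_pM2r // lerD2l.
have hbg x : Num.min g1 g2 <= x -> (bad S S U)%:R <= x * #|S|%:R ^+ 2.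
  by move=> cx; apply: le_trans hb _; rewrite ler_pM2r // exprn_gt0.
have hb1 : (bad S S U)%:R <= g1 * #|S|%:R ^+ 2 by apply: hbg; rewrite ge_min lexx.
have hb2 : (bad S S U)%:R <= g2 * #|S|%:R ^+ 2 by apply: hbg; rewrite ge_min lexx orbT.
have [[H [d [l [sgH l0 cP Pc Pnu]]]]|[H [Z [sgH ZH cH SZ ZU]]]] := h2 G S U gr S0 (hUc _ cc2) hb2.
  have P0 : cprog H d l != set0.
    by rewrite -card_gt0 -(ltr0n R); apply: lt_le_trans Pc; rewrite mulr_gt0.
  have [[x hx]|[H' [Z [sgH' ZH cH SZ ZU]]]] := h1 G S U _ P0 S0 Pnu (hUc _ ce) hb1.
    right; exists H, d, l, (x - d *+ l.-1); split=> //.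
      by apply: le_trans Pc; rewrite ler_pM2r.
    apply: le_trans (_ : (1 - 8 * e) * #|cprog H d l|%:R <= _); first by rewrite ler_wpM2r // ee; lra.
    apply: le_trans hx _; rewrite ler_nat -opp_cprog // /conv.
    rewrite -(card_imset _ (subrI x)); apply/subset_leq_card/subsetP => _ /imsetP[p + ->].
    by rewrite !inE opprB (addrC x (p - x)) subrK => /andP[-> ->].
  left; have [|||z hz] := @coset_density _ _ H' Z S eps (8 * e) (8 * e) sgH' ZH S0 SZ ZU; try by rewrite ?ee; lra.
    by rewrite ee; nra.
  by exists H', z; split=> //; apply: le_trans cH; rewrite ler_pM2r.
left; have [|||||z hz] := @coset_density _ _ H Z S eps e (2 * e) sgH ZH S0.
- have : #|S|%:R = #|S :&: Z|%:R + #|S :\: Z|%:R :> R by rewrite -natrD cardsID.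
  by move: SZ; rewrite mulrBl mul1r; move: (e * #|S|%:R); pure_lra.
- apply: le_trans ZU _; have : (2 + 2 * e) * #|S|%:R = (2 + e) * #|S|%:R + e * #|S|%:R :> R by ring.
  by move=> ->; rewrite lerD2r; apply: hUc.
- by move: e64; pure_lra.
- by move: e0; pure_lra.
- by rewrite ee; nra.
by exists H, z; split=> //; apply: le_trans cH; rewrite ler_pM2r.
Qed.

(** * Almost periodicity of convolutions *)

Section ListSums.
Variables (R : realFieldType) (G : finZmodType).
Implicit Types (A S : {set G}) (F : seq G -> R) (s : seq G).
Local Notation "A '%:c'" := (#|A|%:R : R) (at level 2, format "A %:c").

(** Summation over [k]-tuples, recursive in the first entry so that identities follow by induction
    on [k]. *)
Fixpoint sumk A k F : R :=
  if k is k'.+1 then \sum_(a in A) sumk A k' (fun s => F (a :: s)) else F [::].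

Lemma sumk_le A k F F' : (forall s, size s = k -> F s <= F' s) -> sumk A k F <= sumk A k F'.
Proof.
elim: k F F' => [|k IH] F F' h /=; first exact: h.
by apply: ler_sum => a _; apply: IH => s sk; apply: h; rewrite /= sk.
Qed.

Lemma sumk_eq A k F F' : (forall s, size s = k -> F s = F' s) -> sumk A k F = sumk A k F'.
Proof. by move=> h; apply/eqP; rewrite eq_le !sumk_le // => s /h ->. Qed.

Lemma sumk_const A k (c : R) : sumk A k (fun _ => c) = A%:c ^+ k * c.
Proof.
elim: k => [|k IH] /=; first by rewrite expr0 mul1r.
by rewrite (eq_bigr (fun _ => A%:c ^+ k * c)) // sumr_const exprS -mulrA [RHS]mulr_natl.
Qed.

Lemma sumkD A k F F' : sumk A k (fun s => F s + F' s) = sumk A k F + sumk A k F'.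
Proof.
elim: k F F' => [|k IH] F F' //=; rewrite -big_split /=; apply: eq_bigr => a _; exact: IH.
Qed.

Lemma sumkZ A k F (c : R) : sumk A k (fun s => c * F s) = c * sumk A k F.
Proof.
elim: k F => [|k IH] F //=; rewrite mulr_sumr; apply: eq_bigr => a _; exact: (IH (fun s => F (a :: s))).
Qed.

Lemma sumk_sum (I : finType) (T : {set I}) A k (F : I -> seq G -> R) :
  sumk A k (fun s => \sum_(t in T) F t s) = \sum_(t in T) sumk A k (F t).
Proof.
elim: k F => [|k IH] F //=; rewrite exchange_big /=; apply: eq_bigr => a _.
exact: (IH (fun t s => F t (a :: s))).
Qed.

Lemma sumk_translate A S k t F : (forall s, 0 <= F s) ->
  sumk A k (fun s => (all (fun a => a + t \in S) s)%:R * F s) <=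
  sumk S k (fun s => F (map (fun b => b - t) s)).
Proof.
move=> F0; elim: k F F0 => [|k IH] F F0 /=; first by rewrite mul1r.
rewrite [leLHS]big_mkcond [leRHS]big_mkcond /= [leRHS](reindex_inj (addIr t)) /=.
apply: ler_sum => a _; rewrite addrK; case: ifP => aA; last first.
  case: ifP => // _; have := @sumk_le S k (fun _ => 0) (fun s => F (a :: [seq b - t | b <- s])).
  by rewrite sumk_const mulr0; apply.
case: (a + t \in S) => /=; first exact: (IH (fun s => F (a :: s))).
have -> : sumk A k (fun s => 0%:R * F (a :: s)) = sumk A k (fun _ => 0).
  by apply: sumk_eq => s _; rewrite mul0r.
by rewrite sumk_const mulr0.
Qed.

Lemma sumk_all A k (p : pred G) : sumk A k (fun s => (all p s)%:R) = [set a in A | p a]%:c ^+ k.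
Proof.
elim: k => [|k IH] //=; rewrite exprS -{1}sum_predE natr_sum mulr_suml; apply: eq_bigr => a _.
case: (p a) => /=; first by rewrite IH mul1r.
by rewrite sumk_const mulr0 mul0r.
Qed.

(** The variance of a sum of [k] independent centred variables. The offset [h] collects the entries
    already fixed in the induction; the factor [|A|] avoids division. *)
Lemma sumk_second_moment A k (g : G -> G -> R) (h : G -> R) :
  (forall x, \sum_(a in A) g a x = 0) ->
  A%:c * sumk A k (fun s => \sum_x (h x + \sum_(a <- s) g a x) ^+ 2) =
  A%:c ^+ k.+1 * (\sum_x h x ^+ 2) + k%:R * A%:c ^+ k * \sum_(a in A) \sum_x g a x ^+ 2.
Proof.
move=> g0; elim: k h => [|k IH] h /=.
  rewrite mul0r mul0r addr0 expr1; congr (_ * _); apply: eq_bigr => x _.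
  by rewrite big_nil addr0.
rewrite mulr_sumr (eq_bigr (fun a => A%:c ^+ k.+1 * (\sum_x (h x + g a x) ^+ 2) +
   k%:R * A%:c ^+ k * \sum_(a in A) \sum_x g a x ^+ 2)); last first.
  move=> a _; rewrite -(IH (fun x => h x + g a x)); congr (_ * _); apply: sumk_eq => s _.
  by apply: eq_bigr => x _; rewrite big_cons addrA.
set Gam := \sum_(a in A) _; rewrite big_split /= -mulr_sumr sumr_const.
have -> : \sum_(a in A) \sum_x (h x + g a x) ^+ 2 = A%:c * (\sum_x h x ^+ 2) + Gam.
  rewrite (eq_bigr (fun a => \sum_x h x ^+ 2 + (\sum_x 2 * h x * g a x + \sum_x g a x ^+ 2))); last first.
    by move=> a _; rewrite -!big_split; apply: eq_bigr => x _ /=; ring.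
  rewrite !big_split /= sumr_const [A%:c * _]mulr_natl -/Gam; congr (_ + _).
  rewrite exchange_big /= big1 ?add0r // => x _.
  by rewrite -mulr_sumr g0 mulr0.
rewrite -[_ *+ #|A|]mulr_natl -natr1 !exprS; ring.
Qed.

End ListSums.

Lemma bernoulli_sub (R : realFieldType) (a c : R) k : 0 <= c -> c <= a ->
  a ^+ k.+1 - k%:R * a ^+ k * (a - c) <= a * c ^+ k.
Proof.
move=> c0 ca; have a0 := le_trans c0 ca.
elim: k => [|k IH]; first by rewrite !mul0r subr0 expr1 mulr1.
rewrite [c ^+ _]exprS mulrCA; apply: le_trans (ler_wpM2l c0 IH).
have : 0 <= k%:R * a ^+ k * ((a - c) * (a - c)).
  by rewrite !mulr_ge0 ?exprn_ge0 ?subr_ge0.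
by rewrite -natr1 !exprS; move: (a ^+ k) => v; move: (k%:R); pure_nra.
Qed.

Section CrootSisask.
Variables (R : realType) (G : finZmodType).
Implicit Types (A S : {set G}).
Local Notation "A '%:c'" := (#|A|%:R : R) (at level 2, format "A %:c").

(* Croot-Sisask: for most [k]-tuples [s] in [A], the convolution [1_A * 1_A] is close in
   [L^2] to the average of the translates of [1_A] by [s]. If two translates [s + t] and
   [s' + t'] of such tuples coincide, then [t - t'] is an almost period; as most translates
   remain in [S^k], where [|S| <= 5|A|], some tuple occurs for many [t]. *)
Lemma almost_periods A S k (d : R) : A != set0 -> S%:c <= 5 * A%:c -> (0 < k)%N -> 4 * k%:R * d <= 1 ->
  (bad A A S)%:R <= d * A%:c ^+ 2 ->
  exists T : {set G}, [/\ T \subset A, A%:c <= 8 * 5 ^+ k * T%:c &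
    forall t t', t \in T -> t' \in T ->
      \sum_x ((conv A A (x - t))%:R - (conv A A (x - t'))%:R) ^+ 2 <= 8 * A%:c ^+ 3 / k%:R].
Proof.
move=> A0 S5 k0 kd hb; have n0 : 0 < A%:c by rewrite ltr0n card_gt0.
pose n := A%:c; pose f x : R := (conv A A x)%:R.
(* The translate of the indicator of [A] by [a], scaled by [n] and centred: its sum over [a] in [A]
   is zero. *)
pose g (a x : G) : R := n * (x - a \in A)%:R - f x.
pose E s : R := \sum_x (\sum_(a <- s) g a x) ^+ 2.
have fE x : f x = \sum_(a in A) (x - a \in A)%:R by rewrite /f convE natr_sum.
have g0 x : \sum_(a in A) g a x = 0.
  by rewrite sumrB -mulr_sumr -fE sumr_const -[X in _ - X]mulr_natl subrr.
have kp : 0 < k%:R :> R by rewrite ltr0n.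
have E0 s : 0 <= E s by apply: sumr_ge0 => x _; apply: sqr_ge0.
have Gam : \sum_(a in A) \sum_x g a x ^+ 2 <= n ^+ 4.
  rewrite exchange_big /=; apply: le_trans (_ : \sum_x n ^+ 2 * f x <= _).
    apply: ler_sum => x _.
    have -> : \sum_(a in A) g a x ^+ 2 = n ^+ 2 * f x - n * f x ^+ 2.
      rewrite (eq_bigr (fun a => (n ^+ 2 - 2 * n * f x) * (x - a \in A)%:R + f x ^+ 2)); last first.
        by move=> a _; rewrite /g; case: (_ \in A); rewrite ?mulr1 ?mulr0; ring.
      rewrite big_split /= -mulr_sumr -fE sumr_const -[X in _ + X]mulr_natl -/n; ring.
    by rewrite gerBl mulr_ge0 ?sqr_ge0 // ltW.
  rewrite -mulr_sumr -natr_sum sum_conv natrM -/n.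
  by have -> : n ^+ 4 = n ^+ 2 * (n * n) by ring.
have EA : sumk A k E <= k%:R * n ^+ k * n ^+ 3.
  have := sumk_second_moment k (fun _ => 0) g0; rewrite [X in _ * X + _]big1 ?mulr0 ?add0r; last first.
    by move=> x _; rewrite expr0n.
  rewrite (_ : sumk A k _ = sumk A k E); last first.
    by apply: sumk_eq => s _; apply: eq_bigr => x _; rewrite add0r.
  move=> e; rewrite -(ler_pM2l n0) e; apply: le_trans (ler_wpM2l _ Gam) _.
    by rewrite mulr_ge0 // exprn_ge0 // ltW.
  by have -> : n * (k%:R * n ^+ k * n ^+ 3) = k%:R * n ^+ k * n ^+ 4 by ring.
pose good s := E s <= 2 * k%:R * n ^+ 3.
have badE : sumk A k (fun s => (~~ good s)%:R) <= n ^+ k / 2.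
  have h : sumk A k (fun s => (~~ good s)%:R) * (2 * k%:R * n ^+ 3) <= k%:R * n ^+ k * n ^+ 3.
    apply: le_trans EA; rewrite mulrC -sumkZ; apply: sumk_le => s _.
    rewrite /good; case: (leP (E s) _) => [_|/ltW] /=; first by rewrite mulr0 E0.
    by rewrite mulr1.
  have p : 0 < 2 * k%:R * n ^+ 3 by rewrite !mulr_gt0 ?exprn_gt0.
  rewrite -(ler_pM2r p); apply: le_trans h _.
  by have -> : n ^+ k / 2 * (2 * k%:R * n ^+ 3) = k%:R * n ^+ k * n ^+ 3 by field.
pose c t := [set a in A | a + t \in S].
(* Few bad pairs and Bernoulli's inequality keep at least 3/4 of the pairs (tuple, [t]) inside [S];
   at most half of the tuples are not good. *)
have ct : \sum_(t in A) sumk A k (fun s => (all (fun a => a + t \in S) s)%:R * (good s)%:R) >= n ^+ k.+1 / 4.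
  have h1 t : sumk A k (fun s => (all (fun a => a + t \in S) s)%:R * (good s)%:R) >=
     (c t)%:c ^+ k - sumk A k (fun s => (~~ good s)%:R).
    rewrite lerBlDr -sumk_all -sumkD; apply: sumk_le => s _.
    by case: (all _ s); case: (good s); rewrite ?mulr1 ?mulr0 ?addr0 ?add0r.
  apply: le_trans (ler_sum _ (fun t _ => h1 t)); rewrite sumrB sumr_const -[X in _ - X]mulr_natl -/n.
  have h2 t : n * (c t)%:c ^+ k >= n ^+ k.+1 - k%:R * n ^+ k * (n - (c t)%:c).
    apply: bernoulli_sub => //; rewrite ler_nat; apply: subset_leq_card.
    by apply/subsetP => a; rewrite inE => /andP[].
  have h3 : \sum_(t in A) (n - (c t)%:c) = (bad A A S)%:R.
    rewrite /bad natr_sum; apply: eq_bigr => t _; rewrite sum_predE.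
    have := cardsID (c t) A; rewrite /n => <-; rewrite natrD.
    have -> : A :&: c t = c t by apply/setP => a; rewrite !inE andbA andbb.
    rewrite addrAC subrr add0r; congr (_%:R); apply: eq_card => a.
    by rewrite !inE [t + a]addrC; case: (a \in A); rewrite /= ?andbT ?andbF.
  have h4 : n * \sum_(t in A) (c t)%:c ^+ k >= n ^+ k.+2 - k%:R * n ^+ k * (d * n ^+ 2).
    rewrite mulr_sumr; apply: le_trans (ler_sum _ (fun t _ => h2 t)).
    rewrite sumrB sumr_const -[_ *+ #|A|]mulr_natl -/n -mulr_sumr h3 -exprS lerB // ler_wpM2l //.
    by rewrite mulr_ge0 // exprn_ge0 // ltW.
  rewrite -(ler_pM2l n0) -/n; have h5 := ler_wpM2l (ltW n0) (ler_wpM2l (ltW n0) badE).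
  have h6 : 4 * k%:R * d * n ^+ k.+2 <= n ^+ k.+2 by rewrite ler_piMl // exprn_ge0 // ltW.
  move: h4 h5 h6; rewrite mulrBr !exprS; move: (\sum_(_ in A) _) (n ^+ k) => u v h4 h5 h6.
  have e1 : k%:R * v * (d * (n * n)) = 4 * k%:R * d * (n * (n * v)) / 4 by field.
  move: h4 h5 h6; rewrite expr0 !mulr1 e1 !mulrA; pure_lra.
have ub : \sum_(t in A) sumk A k (fun s => (all (fun a => a + t \in S) s)%:R * (good s)%:R) <=
    sumk S k (fun s => [set t in A | good (map (fun b => b - t) s)]%:c).
  apply: le_trans (_ : \sum_(t in A) sumk S k (fun s => (good (map (fun b => b - t) s))%:R) <= _).
    by apply: ler_sum => t _; apply: (@sumk_translate _ _ A S k t (fun s => (good s)%:R)).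
  rewrite -sumk_sum; apply: sumk_le => s _.
  by rewrite -natr_sum sum_predE.
have [s [sk hs]] : exists s, size s = k /\ n <= 8 * 5 ^+ k * [set t in A | good (map (fun b => b - t) s)]%:c.
  apply: contrapT => none; have := le_trans ct ub; apply/negP; rewrite -ltNge.
  apply: le_lt_trans (_ : S%:c ^+ k * (n / (8 * 5 ^+ k)) < _).
    rewrite -sumk_const; apply: sumk_le => s sk.
    have [h|/ltW h] := leP n (8 * 5 ^+ k * [set t in A | good (map (fun b => b - t) s)]%:c).
      by case: none; exists s.
    by rewrite ler_pdivlMr ?mulr_gt0 ?exprn_gt0 // mulrC.
  apply: le_lt_trans (_ : (5 * n) ^+ k * (n / (8 * 5 ^+ k)) < _).
    apply: ler_wpM2r; first by rewrite divr_ge0 ?ltW // mulr_gt0 ?exprn_gt0.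
    by rewrite lerXn2r ?nnegrE // mulr_ge0 // ltW.
  rewrite exprMn exprS; have p5 : 0 < 5 ^+ k :> R by rewrite exprn_gt0.
  have -> : 5 ^+ k * n ^+ k * (n / (8 * 5 ^+ k)) = n * n ^+ k / 8 by field; rewrite gt_eqF.
  by rewrite ltr_pM2l ?mulr_gt0 ?exprn_gt0 //; lra.
exists [set t in A | good (map (fun b => b - t) s)]; split=> //.
  by apply/subsetP => t; rewrite inE => /andP[].
move=> t t'; rewrite !inE /good => /andP[_ ht] /andP[_ ht'].
(* The first term does not involve [u], so the translates of [f] by [t] and by [t'] are both close
   to the same function. *)
have Et u : E (map (fun b => b - u) s) = \sum_x (n * \sum_(b <- s) (x - b \in A)%:R - k%:R * f (x - u)) ^+ 2.
  rewrite /E [RHS](reindex_inj (addIr u)) /=; apply: eq_bigr => x _; congr (_ ^+ 2).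
  rewrite big_map /g addrK; elim: (s) (k) sk => [|b s' IH] [|k'] //=; first by rewrite !big_nil mul0r mulr0 subr0.
  by case=> sk; rewrite !big_cons (IH _ sk) opprB (addrA x u) -natr1; ring.
rewrite ler_pdivlMr // -(ler_pM2r kp).
have key : \sum_x (f (x - t) - f (x - t')) ^+ 2 * k%:R ^+ 2 <= 2 * (E (map (fun b => b - t) s) + E (map (fun b => b - t') s)).
  rewrite !Et -big_split mulr_sumr; apply: ler_sum => x _ /=.
  move: (n * _) (f (x - t)) (f (x - t')) => u v w.
  by have := sqr_ge0 (u - k%:R * v + (u - k%:R * w)); rewrite !expr2; pure_nra.
apply: le_trans (_ : 2 * (2 * k%:R * n ^+ 3 + 2 * k%:R * n ^+ 3) <= _).
  apply: le_trans (_ : 2 * (E (map (fun b => b - t) s) + E (map (fun b => b - t') s)) <= _).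
    by apply: le_trans key; rewrite -mulr_suml expr2 mulrA.
  by rewrite ler_pM2l // lerD.
by have -> : 8 * A%:c ^+ 3 * k%:R = 2 * (2 * k%:R * n ^+ 3 + 2 * k%:R * n ^+ 3) by rewrite /n; ring.
Qed.

End CrootSisask.

Section LevelSets.
Variables (R : realType).
Local Notation "A '%:c'" := (#|A|%:R : R) (at level 2, format "A %:c").

Lemma bad_conv (G : finZmodType) (A S : {set G}) : bad A A S = (\sum_(x | x \notin S) conv A A x)%N.
Proof.
rewrite /bad (eq_bigr (fun t => \sum_x (((x - t)%R \in A) && (x \notin S) : nat))%N); last first.
  move=> t _; rewrite [LHS]big_mkcond (reindex_inj (addrI (- t))) /=; apply: eq_bigr => x _.
  by rewrite addrA subrr add0r addrC; case: (_ \in A).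
rewrite exchange_big [RHS]big_mkcond; apply: eq_bigr => x _ /=.
rewrite convE; case: (x \in S) => /=; first by rewrite big1 // => t _; rewrite andbF.
by apply: eq_bigr => t _; rewrite andbT.
Qed.

Section Thick.
Variables (G : finZmodType) (A S : {set G}) (d gam : R).
Hypotheses (A0 : A != set0) (gam0 : 0 < gam) (hb : (bad A A S)%:R <= d * A%:c ^+ 2).
Let n0 : 0 < A%:c. Proof. by rewrite ltr0n card_gt0. Qed.

Lemma card_thick_diff : (thick gam A A :\: S)%:c <= d / gam * A%:c.
Proof.
rewrite -(ler_pM2r (mulr_gt0 gam0 n0)) mulr_natl -sumr_const.
apply: le_trans (_ : d * A%:c ^+ 2 <= _); last first.
  by rewrite (_ : d / gam * A%:c * (gam * A%:c) = d * A%:c ^+ 2) //; field; rewrite gt_eqF.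
apply: le_trans hb; rewrite bad_conv natr_sum [leLHS]big_mkcond [leRHS]big_mkcond.
apply: ler_sum => x _; rewrite inE; case: (x \in S) => //=; rewrite inE.
by case: ifP.
Qed.

Lemma card_thick_le : (thick gam A A)%:c <= S%:c + d / gam * A%:c.
Proof.
apply: le_trans (lerD (lexx _) card_thick_diff).
by rewrite -natrD ler_nat -(cardsID S (thick _ _ _)) leq_add2r subset_leq_card // subsetIr.
Qed.

Lemma bad_thick_le : S%:c <= 5 * A%:c -> d <= gam ->
  (bad A A (thick gam A A))%:R <= 6 * gam * A%:c ^+ 2.
Proof.
move=> S5 dg; rewrite bad_conv natr_sum (bigID (mem S)) /=.
have h1 : \sum_(x | (x \notin thick gam A A) && (x \in S)) (conv A A x)%:R <= S%:c * (gam * A%:c) :> R.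
  rewrite mulr_natl -sumr_const [leLHS]big_mkcond [leRHS]big_mkcond; apply: ler_sum => x _ /=.
  case: (x \in S); rewrite ?andbF // andbT; case: ifP => [|_]; last by rewrite mulr_ge0 // ltW.
  by rewrite inE -ltNge => /ltW.
have h2 : \sum_(x | (x \notin thick gam A A) && (x \notin S)) (conv A A x)%:R <= d * A%:c ^+ 2 :> R.
  apply: le_trans hb; rewrite bad_conv natr_sum [leLHS]big_mkcond [leRHS]big_mkcond; apply: ler_sum => x _ /=.
  by case: (x \in S); rewrite ?andbF //= andbT; case: ifP.
have h3 : S%:c * (gam * A%:c) <= 5 * A%:c * (gam * A%:c) by rewrite ler_pM2r // mulr_gt0.
have h4 : d * A%:c ^+ 2 <= gam * A%:c ^+ 2 by rewrite ler_pM2r // exprn_gt0.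
have -> : 6 * gam * A%:c ^+ 2 = 5 * A%:c * (gam * A%:c) + gam * A%:c ^+ 2 by ring.
by apply: lerD; [apply: le_trans h3|apply: le_trans h4].
Qed.

End Thick.

Lemma thick_mono (G : finZmodType) (A : {set G}) (g g' : R) : g' <= g ->
  thick g A A \subset thick g' A A.
Proof.
by move=> gg; apply/subsetP => x; rewrite !inE; apply: le_trans; rewrite ler_wpM2r.
Qed.

(** Chebyshev: at a point of the higher level set outside the translated lower one, the convolution
    drops by at least [g / 2 * |A|] under the translation. *)
Lemma nu_thick (G : finZmodType) (A : {set G}) (g g' e : R) t t' :
  A != set0 -> 0 < g -> g' <= g / 2 ->
  \sum_x ((conv A A (x - t))%:R - (conv A A (x - t'))%:R) ^+ 2 <= e ->
  (nu (thick g' A A) (t - t')%R)%:R * (g / 2 * A%:c) ^+ 2 <=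
    (thick g' A A :\: thick g A A)%:c * (g / 2 * A%:c) ^+ 2 + e.
Proof.
move=> A0 g0 gg he; have n0 : 0 < A%:c by rewrite ltr0n card_gt0.
set V := thick g' A A; set V0 := thick g A A.
have h : (nu V (t - t')%R <= #|V :\: V0| + #|V0 :\: shift V (t - t')%R|)%N by apply: card_setD_triangle.
move: h; rewrite -(ler_nat R) natrD => h; apply: le_trans (ler_wpM2r (sqr_ge0 _) h) _.
rewrite mulrDl lerD2l; apply: le_trans he; rewrite mulr_natl -sumr_const.
rewrite [leRHS](reindex_inj (addIr t')) [leLHS]big_mkcond /=; apply: ler_sum => x _; rewrite addrK.
case: ifP => [|_]; last exact: sqr_ge0.
rewrite inE in_shift opprB [t' - t]addrC addrA addrAC !inE -ltNge => /andP[lo hi].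
have gn : 0 < g / 2 * A%:c by rewrite mulr_gt0 // divr_gt0.
have hn : g / 2 * A%:c <= (conv A A x)%:R - (conv A A (x + t' - t))%:R.
  have eg : g * A%:c = g / 2 * A%:c + g / 2 * A%:c by field.
  have h2 := ler_wpM2r (ltW n0) gg.
  by move: lo hi h2; rewrite eg; move: (g / 2 * A%:c) (g' * A%:c); pure_lra.
by rewrite -[leRHS]sqrrN opprB lerXn2r ?nnegrE ?(ltW gn) // (le_trans (ltW gn)).
Qed.

(* The level sets [V j] increase and have at most about [|S|] elements, so
   [V (j+1)] is hardly larger than [V j] for some [j]. *)
Lemma almost_invariant_level (kap : R) (kk : R -> nat) (F : R -> R) (J : nat) :
  0 < kap -> (forall g, 0 < g -> (0 < kk g)%N /\ 32 <= kap * g ^+ 2 * (kk g)%:R) ->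
  (forall g, 0 < g -> 0 < F g <= g / 2) -> 7 <= kap * J%:R ->
  forall (G : finZmodType) (A S : {set G}) (d : R), A != set0 -> S%:c <= 5 * A%:c ->
    (bad A A S)%:R <= d * A%:c ^+ 2 ->
    (forall j, (j < J)%N -> d <= iter j.+1 F 1 /\ 4 * (kk (iter j F 1))%:R * d <= 1) ->
  exists j (T : {set G}), let g := iter j F 1 in let V := thick (F g) A A in
    [/\ (j < J)%N, T \subset A, A%:c <= 8 * 5 ^+ kk g * T%:c,
      (forall t t', t \in T -> t' \in T -> (nu V (t - t')%R)%:R <= 2 * kap * A%:c) &
      V%:c <= S%:c + d / F g * A%:c /\ (bad A A V)%:R <= 6 * F g * A%:c ^+ 2].
Proof.
move=> kap0 hkk hF hJ G A S d A0 S5 hb hd.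
have n0 : 0 < A%:c by rewrite ltr0n card_gt0.
pose gam j := iter j F 1; pose V j := thick (gam j) A A.
have g0 j : 0 < gam j by elim: j => [|j IH]; [exact: ltr01|rewrite /gam /=; case/andP: (hF _ IH)].
have gS j : gam j.+1 <= gam j / 2 by case/andP: (hF _ (g0 j)).
have dg j : (j < J)%N -> d <= gam j.+1 by move=> /hd[].
have [j jJ hj] : exists2 j, (j < J)%N & (V j.+1)%:c <= (V j)%:c + kap * A%:c.
  have [/existsP[j hj]|/existsPn none] := boolP [exists j : 'I_J, (V j.+1)%:c <= (V j)%:c + kap * A%:c].
    by exists j.
  exfalso; have h i : (i <= J)%N -> i%:R * (kap * A%:c) <= (V i)%:c.
    elim: i => [_|i IH iJ]; first by rewrite mul0r.
    have := none (Ordinal iJ); rewrite -ltNge /= => /ltW; apply: le_trans.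
    by rewrite -natr1 mulrDl mul1r lerD2r IH // ltnW.
  have J0 : (0 < J)%N by rewrite lt0n; apply/eqP => e; move: hJ; rewrite e mulr0; lra.
  have := h J (leqnn _); apply/negP; rewrite -ltNge.
  have dJ : d <= gam J by rewrite -(prednK J0); apply: dg; rewrite prednK.
  apply: le_lt_trans (card_thick_le A0 (g0 J) hb) _; rewrite mulrA [J%:R * _]mulrC.
  have h1 : d / gam J * A%:c <= 1 * A%:c by rewrite ler_pM2r // ler_pdivrMr // mul1r.
  have h2 : 7 * A%:c <= kap * J%:R * A%:c by rewrite ler_pM2r.
  by move: S5 h1 h2 n0; move: (_ * _ * A%:c) (_ / _ * A%:c); pure_lra.
have [d1 d2] := hd _ jJ; have [k0 k32] := hkk _ (g0 j).
have [T [TA cT hT]] := almost_periods A0 S5 k0 d2 hb.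
exists j, T => /=; split=> // [t t' tT t'T|].
  have gn : 0 < (gam j / 2 * A%:c) ^+ 2 by rewrite exprn_gt0 // mulr_gt0 // divr_gt0.
  rewrite -(ler_pM2r gn); apply: le_trans (nu_thick A0 (g0 j) (gS j) (hT t t' tT t'T)) _.
  have h1 : (V j.+1 :\: V j)%:c <= kap * A%:c.
    have := cardsID (V j) (V j.+1); rewrite (setIidPr (thick_mono A _)) => [e|]; last first.
      by apply: le_trans (gS j) _; rewrite ler_pdivrMr // ler_pMr // ; lra.
    by move: hj; rewrite -e natrD lerD2l.
  have -> : 2 * kap * A%:c * (gam j / 2 * A%:c) ^+ 2 =
     kap * A%:c * (gam j / 2 * A%:c) ^+ 2 + kap * gam j ^+ 2 / 4 * A%:c ^+ 3 by field.
  apply: lerD; first by rewrite ler_pM2r.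
  rewrite ler_pdivrMr ?ltr0n // mulrAC ler_pM2r ?exprn_gt0 //.
  by move: k32; move: (kk _)%:R => K; rewrite -/(gam j); move: (kap * _) => w; rewrite mulrAC; move: (w * K); pure_lra.
split; first exact: (card_thick_le A0 (g0 j.+1) hb).
exact: (bad_thick_le A0 (g0 j.+1) hb S5 d1).
Qed.

End LevelSets.

(** * Cells of length q *)

Section Cells.
Variables (N q' : nat).
Local Notation G := 'I_N.+1.
Local Notation q := q'.+1.
Implicit Types (A S T V X : {set G}) (a b v x : G).

Definition residue x : 'I_q := inord (val x %% q)%N.
Definition cell A i := [set a in A | (val a %/ q)%N == i].
(* The sum of two elements of [cell A i] lies in the [i]-th cell of length [2q]. *)
Definition cell2 V i := [set v in V | (val v %/ (2 * q))%N == i].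

Lemma val_residue x : val (residue x) = (val x %% q)%N.
Proof. by rewrite /residue /= inordK // ltn_pmod. Qed.

Lemma residueP x y : (residue x == residue y) = (val x == val y %[mod q])%N.
Proof. by rewrite -val_eqE !val_residue. Qed.

Lemma cell_val A i a : a \in cell A i -> val a = (i * q + val (residue a))%N.
Proof. by rewrite inE val_residue => /andP[_ /eqP <-]; exact: divn_eq. Qed.

Lemma residue_inj A i : {in cell A i &, injective residue}.
Proof.
move=> a b aA bA e; apply: val_inj => /=; rewrite (cell_val aA) (cell_val bA) e //.
Qed.

Lemma valD a b : (val a + val b <= N)%N -> val (a + b) = (val a + val b)%N.
Proof. by move=> h; rewrite /= modn_small. Qed.

Lemma residueD a b : (val a + val b <= N)%N -> residue (a + b) = residue a + residue b.
Proof. by move=> h; apply: val_inj; rewrite val_residue valD //= !val_residue modnDm. Qed.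

Lemma bad_cell A V i : {in A, forall a, 4 * val a <= N}%N ->
  (bad (residue @: cell A i) (residue @: cell A i) (residue @: cell2 V i) <= bad A A V)%N.
Proof.
move=> AN; rewrite /bad big_imset /=; last exact: residue_inj.
have cA : cell A i \subset A by apply/subsetP => a; rewrite inE => /andP[].
apply: leq_trans (leq_sum_sub _ cA); apply: leq_sum => a aC.
rewrite big_imset /=; last exact: residue_inj.
apply: leq_trans (leq_sum_sub _ cA); apply: leq_sum => b bC.
have [aA bA] := (subsetP cA _ aC, subsetP cA _ bC).
have ab : (val a + val b <= N)%N by move: (AN _ aA) (AN _ bA); pure_lia.
have [abV|] := boolP (a + b \in V); last by case: (_ \notin _).
rewrite -residueD // imset_f //= inE abV valD //=.
have := cell_val aC; have := cell_val bC; move: (ltn_ord (residue a)) (ltn_ord (residue b)) => /=.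
move: (val (residue a)) (val (residue b)) => r s rq sq -> ->; apply/eqP.
have -> : (i * q + r + (i * q + s) = i * (2 * q) + (r + s))%N by rewrite mulnCA; move: (i * q)%N; pure_lia.
by rewrite divnMDl // divn_small ?addn0 //; move: rq sq; pure_lia.
Qed.

Lemma sum_cell2 (I : {set 'I_N.+1}) X : (\sum_(i in I) #|cell2 X i| <= #|X|)%N.
Proof.
rewrite -[leqRHS]sum1_card (eq_bigr (fun i : 'I_N.+1 => \sum_(v in X) ((val v %/ (2 * q))%N == i : nat))%N).
  rewrite exchange_big /=; apply: leq_sum => v _; rewrite sum_predE.
  by apply/card_le1_eqP => x y; rewrite !inE => /andP[_ /eqP ex] /andP[_ /eqP ey]; apply: val_inj; rewrite /= -ex -ey.
by move=> i _; rewrite sum_predE.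
Qed.

Lemma val_cell2 v : val v = (val v %/ (2 * q) * (2 * q) + odd (val v %/ q)%N * q + val v %% q)%N.
Proof.
rewrite (mulnC 2) divnMA; have e1 := divn_eq (val v) q; have e2 := divn_eq (val v %/ q) 2.
by rewrite modn2 in e2; rewrite {1}e1 {1}e2 mulnDl -mulnA (mulnC 2).
Qed.

Lemma cell2_digits i (b : bool) r (m : nat) : (r < q)%N -> m = (i * (2 * q) + b * q + r)%N ->
  [/\ (m %/ (2 * q) = i)%N, odd (m %/ q)%N = b & (m %% q = r)%N].
Proof.
move=> rq ->.
have e : (i * (2 * q) + b * q + r = (2 * i + b) * q + r)%N by rewrite mulnDl mulnCA mulnA.
split.
- rewrite -addnA divnMDl // divn_small ?addn0 //.
  by case: (b) => /=; move: rq; pure_lia.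
- by rewrite e divnMDl // divn_small // addn0 mul2n oddD odd_double oddb.
- by rewrite e modnMDl modn_small.
Qed.

Lemma valB a b : (val b <= val a)%N -> val (a - b) = (val a - val b)%N.
Proof.
move=> ba; pose w : G := inord (val a - val b).
have wv : val w = (val a - val b)%N.
  by rewrite /w /= inordK // ltnS; apply: leq_trans (leq_subr _ _) _; rewrite -ltnS.
have h : (val w + val b <= N)%N by rewrite wv subnK // -ltnS ltn_ord.
have e : a = w + b by apply: val_inj; rewrite valD // wv subnK.
by rewrite {1}e addrK wv.
Qed.

(** [V0] and [V1] are the lower and upper halves of the cell. Each of them realises every residue,
    except those of elements that a shift by [q] takes out of [V]; adding the two bounds gives the
    claim. *)
Lemma card_cell2 V i (qG : G) : {in V, forall v, 2 * val v <= N}%N -> val qG = q -> (4 * q <= N)%N ->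
  (2 * #|residue @: cell2 V i| <= #|cell2 V i| + #|cell2 (V :\: shift V qG) i| + #|cell2 (V :\: shift V (- qG)) i|)%N.
Proof.
move=> VN qGv qN.
pose V0 := [set v in cell2 V i | ~~ odd (val v %/ q)%N]; pose V1 := [set v in cell2 V i | odd (val v %/ q)%N].
have V01 : (#|V0| + #|V1| = #|cell2 V i|)%N.
  rewrite -(cardsID V1 (cell2 V i)) addnC; congr (_ + _)%N; apply: eq_card => v; rewrite !inE.
    by case: (v \in V) => //=; case: (_ == i) => //=.
  by case: (v \in V) => //=; case: (_ == i) => //=; rewrite andbT.
have sub0 : residue @: cell2 V i \subset residue @: V0 :|: residue @: cell2 (V :\: shift V qG) i.
  apply/subsetP => _ /imsetP[v vC ->]; have [ov|ev] := boolP (odd (val v %/ q)%N); last first.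
    by rewrite inE [residue v \in _](_ : _ = true) //; apply: imset_f; rewrite inE vC.
  have [vV vi] : v \in V /\ (val v %/ (2 * q))%N = i by move: vC; rewrite inE => /andP[-> /eqP].
  have [vs|vs] := boolP (v \in shift V qG); last first.
    by rewrite inE orbC imset_f // inE in_setD vs vV vi eqxx.
  have := val_cell2 v; rewrite ov vi mul1n => ve.
  have qv : (q <= val v)%N by rewrite ve; move: (i * _)%N; pure_lia.
  pose w := v - qG; have wv : val w = (val v - q)%N by rewrite /w valB qGv.
  have [||w1 w2 w3] := @cell2_digits i false (val v %% q) (val w); rewrite ?ltn_pmod //.
    by rewrite wv {1}ve mul0n addn0 addnAC addnK.
  rewrite inE; apply/orP; left; apply/imsetP; exists w; last by apply/eqP; rewrite residueP w3.
  by rewrite !inE w1 w2 eqxx !andbT -in_shift.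
have sub1 : residue @: cell2 V i \subset residue @: V1 :|: residue @: cell2 (V :\: shift V (- qG)) i.
  apply/subsetP => _ /imsetP[v vC ->]; have [ov|ev] := boolP (odd (val v %/ q)%N).
    by rewrite inE [residue v \in _](_ : _ = true) //; apply: imset_f; rewrite inE vC.
  have [vV vi] : v \in V /\ (val v %/ (2 * q))%N = i by move: vC; rewrite inE => /andP[-> /eqP].
  have [vs|vs] := boolP (v \in shift V (- qG)); last first.
    by rewrite inE orbC imset_f // inE in_setD vs vV vi eqxx.
  have := val_cell2 v; rewrite (negbTE ev) vi mul0n addn0 => ve.
  pose w := v + qG; have wv : val w = (val v + q)%N.
    by rewrite /w valD qGv //; move: (VN _ vV) qN; move: (val v); pure_lia.
  have [||w1 w2 w3] := @cell2_digits i true (val v %% q) (val w); rewrite ?ltn_pmod //.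
    by rewrite wv {1}ve mul1n addnAC.
  rewrite inE; apply/orP; left; apply/imsetP; exists w; last by apply/eqP; rewrite residueP w3.
  by rewrite !inE w1 w2 eqxx !andbT /w -[qG]opprK -in_shift.
have := leq_trans (subset_leq_card sub0) (leq_card_setU _ _).
have := leq_trans (subset_leq_card sub1) (leq_card_setU _ _).
have := leq_imset_card residue V0; have := leq_imset_card residue V1.
have := leq_imset_card residue (cell2 (V :\: shift V qG) i).
have := leq_imset_card residue (cell2 (V :\: shift V (- qG)) i).
by move: V01; move: #|V0| #|V1| #|cell2 V i| #|cell2 (V :\: shift V qG) i| #|cell2 (V :\: shift V (- qG)) i|; move: #|_| #|_| #|_| #|_| #|_|; pure_lia.
Qed.

End Cells.

Section HeavyCell.
Variable N : nat.
Local Notation G := 'I_N.+1.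
Implicit Types (A S T V : {set G}) (a t v : G).

(** One representative per occupied cell sends at least half of [T] into [S]. A given [s] is reached
    from at most two cells, as its representative lies in an interval of length [q] ending at
    [s - t0]. *)
Lemma card_cells q' A T S (t0 : nat) :
  (forall t, t \in T -> (t0 <= val t <= t0 + q'.+1)%N) ->
  (forall a t, a \in A -> t \in T -> (val a + val t <= N)%N) ->
  (forall a, a \in A -> (#|T| <= 2 * #|[set t in T | (a + t)%R \in S]|)%N) ->
  (#|[set i : G | [exists a in A, (val a %/ q'.+1)%N == i]]| * #|T| <= 4 * #|S|)%N.
Proof.
set q := q'.+1; set I := [set i | _] => Tq AT AS.
pose rep (i : G) : G := odflt 0 [pick a in A | (val a %/ q)%N == i].
have repP i : i \in I -> rep i \in A /\ (val (rep i) %/ q)%N = i.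
  rewrite inE /rep; case: pickP => [a /andP[aA /eqP ai] _|none /existsP[a]]; first by [].
  by rewrite none.
have -> : 4%N = (2 * 2)%N by []; rewrite -mulnA -sum_nat_const.
apply: leq_trans (_ : 2 * \sum_(i in I) #|[set t in T | (rep i + t)%R \in S]| <= _)%N.
  by rewrite big_distrr; apply: leq_sum => i /repP[iA _]; apply: AS.
rewrite leq_mul2l /= (eq_bigr (fun i => \sum_(s in S) ((s - rep i)%R \in T : nat))%N); last first.
  move=> i _; rewrite sum_predE -[LHS](card_shift _ (rep i)); apply: eq_card => s.
  by rewrite !inE (addrC (rep i)) subrK andbC.
rewrite exchange_big [leqRHS]mulnC -sum_nat_const; apply: leq_sum => s _ /=; rewrite sum_predE.
pose k := ((val s - t0) %/ q)%N.
have c1 : (#|[set i : G | val i == k]| <= 1)%N.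
  by apply/card_le1_eqP => x y; rewrite !inE => /eqP ex /eqP ey; apply: val_inj; rewrite ex ey.
have c2 : (#|[set i : G | (val i).+1 == k]| <= 1)%N.
  by apply/card_le1_eqP => x y; rewrite !inE => /eqP ex /eqP ey; apply: val_inj; apply/eqP; rewrite -eqSS ex ey.
apply: leq_trans (leq_add c1 c2); apply: leq_trans (leq_card_setU _ _).
apply/subset_leq_card/subsetP => i; rewrite inE => /andP[iI sT].
have [rA ri] := repP i iI; have /andP[l1 l2] := Tq _ sT.
have vs : val s = (val (rep i) + val (s - rep i)%R)%N.
  by rewrite -valD ?AT // addrC subrK.
have d1 : (i <= k)%N by rewrite -ri; apply: leq_div2r; rewrite vs; move: l1; pure_lia.
have d2 : (k <= i.+1)%N.
  rewrite -ri /k; apply: leq_trans (_ : (val (rep i) + q) %/ q <= _)%N.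
    by apply: leq_div2r; rewrite vs; move: l2; pure_lia.
  by rewrite -[X in (_ + X)%N]mul1n addnC divnMDl // add1n.
by rewrite !inE /=; move: d1 d2; move: (nat_of_ord i) (k) => a b; pure_lia.
Qed.

Variable R : realType.
Local Notation "A '%:c'" := (#|A|%:R : R) (at level 2, format "A %:c").

(* With [q] the diameter of [T], a popular [a + T] meets at most two cells of length [q], so the
   popular [a] occupy few cells. As [V] is almost invariant under translation by
   [q], the residues of its elements in a cell of length [2q] number about half of
   these elements, so the bound [4|A|] becomes [2|SA|]. *)
Lemma heavy_cell A S T V (c e kap d : R) : 0 < c -> c <= 1 -> A != set0 ->
  {in A, forall a, 4 * val a <= N}%N -> {in V, forall v, 2 * val v <= N}%N ->
  T \subset A -> (1 < #|T|)%N -> S%:c <= 5 * A%:c -> (bad A A S)%:R <= d * A%:c ^+ 2 ->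
  2 * d * A%:c <= c / 16 * T%:c ->
  (forall t t', t \in T -> t' \in T -> (nu V (t - t')%R)%:R <= 2 * kap * A%:c) ->
  V%:c <= (4 + e) * A%:c -> e + 4 * kap <= c ->
  exists q' i, let SA := residue q' @: cell q' A i in let UV := residue q' @: cell2 q' V i in
    [/\ UV%:c <= (2 + c) * SA%:c, c / 320 * T%:c <= SA%:c & (bad SA SA UV <= bad A A V)%N].
Proof.
move=> c0 c1 A0 AN VN TA T1 S5 hb dT nuT hV ek.
have n0 : 0 < A%:c by rewrite ltr0n card_gt0.
have Tp : 0 < T%:c by rewrite ltr0n; apply: leq_trans T1.
have /card_gt0P[t tT] : (0 < #|T|)%N by apply: leq_trans T1.
have [tmin tminT hmin] := @arg_minnP _ t (mem T) val tT.
have [tmax tmaxT hmax] := @arg_maxnP _ t (mem T) val tT.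
have {}hmin x : x \in T -> (val tmin <= val x)%N by apply: hmin.
have {}hmax x : x \in T -> (val x <= val tmax)%N by apply: hmax.
have lt : (val tmin < val tmax)%N.
  rewrite ltnNge; apply/negP => le; move: T1; apply/negP; rewrite -leqNgt.
  apply/card_le1_eqP => x y xT yT; apply: val_inj.
  by move: (hmin _ xT) (hmax _ xT) (hmin _ yT) (hmax _ yT) le; move: (val x) (val y) (val tmin) (val tmax); pure_lia.
(* The diameter of [T] is both a difference of two elements of [T], hence an almost period of [V],
   and long enough for [T] to fit in an interval of that length. *)
pose q' := (val tmax - val tmin).-1; pose q := q'.+1.
have qE : q = (val tmax - val tmin)%N by rewrite /q /q' prednK // subn_gt0.
pose qG := tmax - tmin; have qGv : val qG = q by rewrite /qG valB ?qE // ltnW.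
have qN : (4 * q <= N)%N.
  by apply: leq_trans (AN _ (subsetP TA _ tmaxT)); rewrite qE leq_mul2l /= leq_subr.
pose A' := [set a in A | (#|T| <= 2 * #|[set t in T | (a + t)%R \in S]|)%N].
pose I := [set i : G | [exists a in A', (val a %/ q)%N == i]].
have AT a t' : a \in A -> t' \in T -> (val a + val t' <= N)%N.
  by move=> /AN h1 /(subsetP TA) /AN; move: h1; move: (val a) (val t'); pure_lia.
have cI : I%:c * T%:c <= 20 * A%:c.
  have := @card_cells q' A' T S (val tmin); rewrite -/I -(ler_nat R) !natrM => h.
  apply: le_trans (h _ _ _) _.
  - move=> x xT; rewrite hmin //= -/q qE subnKC ?hmax //; exact: ltnW.
  - by move=> a t'; rewrite inE => /andP[aA _]; apply: AT.
  - by move=> a; rewrite inE => /andP[].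
  - by move: S5; pure_lra.
have cA' : (A :\: A')%:c <= c / 16 * A%:c.
  have h : ((#|A :\: A'| * #|T|) <= 2 * bad A A S)%N.
    rewrite -sum_nat_const; apply: leq_trans (_ : 2 * bad (A :\: A') T S <= _)%N; last first.
      by rewrite leq_mul2l /= bad_sub // subsetDl.
    rewrite /bad big_distrr /=; apply: leq_sum => a; rewrite in_setD => /andP[aA' aA].
    rewrite sum_predE; move: aA'; rewrite inE aA /= -ltnNge.
    have := cardsID [set t in T | (a + t)%R \in S] T.
    have -> : T :&: [set t in T | (a + t)%R \in S] = [set t in T | (a + t)%R \in S].
      by apply/setP => x; rewrite !inE andbA andbb.
    have -> : T :\: [set t in T | (a + t)%R \in S] = [set t in T | (a + t)%R \notin S].
      by apply/setP => x; rewrite !inE; case: (x \in T) => //=; rewrite ?andbT ?andbF.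
    by move: #|_| #|_| #|_|; pure_lia.
  move: h; rewrite -(ler_nat R) !natrM => h; rewrite -(ler_pM2r Tp); apply: le_trans h _.
  apply: le_trans (_ : 2 * (d * A%:c ^+ 2) <= _); first by rewrite ler_pM2l.
  have -> : 2 * (d * A%:c ^+ 2) = 2 * d * A%:c * A%:c by ring.
  by rewrite [leRHS]mulrAC ler_pM2r.
pose heavy (i : G) := c / 320 * T%:c <= (cell q' A i)%:c.
have cS i : #|residue q' @: cell q' A i| = #|cell q' A i|.
  by apply: card_in_imset; apply: residue_inj.
(* If every heavy cell fails, summing over the heavy cells, which contain a share [1 - c / 8] of
   [A], contradicts the bound on [V]. At most [20 * |A| / |T|] cells are in play, so the light ones
   lose at most [c / 16] of [A]; thus [320 = 20 * 16]. *)
have [/existsP[i /andP[/andP[iI hi] Ui]]|/existsPn none] :=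
  boolP [exists i : G, (i \in I) && heavy i && ((residue q' @: cell2 q' V i)%:c <= (2 + c) * (cell q' A i)%:c)].
  exists q', (val i) => /=; rewrite cS; split=> //; exact: bad_cell.
exfalso.
have light : \sum_(i in I | ~~ heavy i) (cell q' A i)%:c <= c / 16 * A%:c.
  apply: le_trans (_ : I%:c * (c / 320 * T%:c) <= _).
    rewrite mulr_natl -sumr_const [leRHS](bigID heavy) /= -[leLHS]add0r; apply: lerD.
      by apply: sumr_ge0 => i _; rewrite mulr_ge0 // divr_ge0 // ltW.
    by apply: ler_sum => i /andP[_]; rewrite -ltNge => /ltW.
  have -> : I%:c * (c / 320 * T%:c) = c / 320 * (I%:c * T%:c) by ring.
  have -> : c / 16 * A%:c = c / 320 * (20 * A%:c) by field.
  by rewrite ler_pM2l // divr_gt0.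
have covA' : A'%:c <= \sum_(i in I) (cell q' A i)%:c.
  rewrite -natr_sum ler_nat -sum1_card.
  apply: leq_trans (_ : \sum_(a in A') \sum_(i in I) ((val a %/ q)%N == i) <= _)%N.
    apply: leq_sum => a aA'; pose i : G := inord (val a %/ q).
    have vi : val i = (val a %/ q)%N.
      by rewrite /i /= inordK // ltnS; apply: leq_trans (leq_div _ _) _; rewrite -ltnS ltn_ord.
    rewrite (bigD1 i) /=; last by rewrite inE; apply/existsP; exists a; rewrite aA' /= -vi.
    by rewrite -vi eqxx.
  rewrite exchange_big; apply: leq_sum => i _ /=; rewrite sum_predE; apply: subset_leq_card.
  by apply/subsetP => a; rewrite !inE => /andP[/andP[-> _] ->].
have UI : 2 * \sum_(i in I) (residue q' @: cell2 q' V i)%:c <= V%:c + 4 * kap * A%:c.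
  rewrite -natr_sum -natrM.
  apply: le_trans (_ : (#|V| + nu V qG + nu V (- qG)%R)%N%:R <= _).
    rewrite ler_nat big_distrr /=.
    apply: leq_trans (_ : \sum_(i in I) (#|cell2 q' V i| + #|cell2 q' (V :\: shift V qG) i| +
       #|cell2 q' (V :\: shift V (- qG)) i|) <= _)%N.
      by apply: leq_sum => i _; apply: (card_cell2 _ VN qGv qN).
    by rewrite !big_split /= !leq_add // sum_cell2.
  rewrite nuN !natrD; have := nuT _ _ tmaxT tminT; rewrite -/qG.
  have -> : 4 * kap * A%:c = 2 * kap * A%:c + 2 * kap * A%:c by ring.
  by move: (2 * kap * A%:c); pure_lra.
have heavyU : (2 + c) * \sum_(i in I | heavy i) (cell q' A i)%:c <= \sum_(i in I) (residue q' @: cell2 q' V i)%:c.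
  rewrite mulr_sumr [leRHS](bigID heavy) /= -[leLHS]addr0; apply: lerD; last by apply: sumr_ge0.
  apply: ler_sum => i /andP[iI hi]; have := none i; rewrite iI hi /= -ltNge; exact: ltW.
have An : A%:c <= A'%:c + (A :\: A')%:c.
  by rewrite -natrD ler_nat -(cardsID A' A) leq_add2r subset_leq_card // subsetIr.
move: covA'; rewrite (bigID heavy) /= => covA'.
have h1 : (1 - c / 8) * A%:c <= \sum_(i in I | heavy i) (cell q' A i)%:c.
  have -> : (1 - c / 8) * A%:c = A%:c - (c / 16 * A%:c + c / 16 * A%:c) by field.
  move: light covA' cA' An; move: (\sum_(i in I | heavy i) _) (\sum_(i in I | _) _) (c / 16 * _); pure_lra.
have h2 : (4 + e) * A%:c + 4 * kap * A%:c <= (4 + c) * A%:c.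
  by rewrite -mulrDl ler_pM2r //; move: ek; pure_lra.
have h3 : (4 + c) * A%:c < 2 * ((2 + c) * ((1 - c / 8) * A%:c)).
  by rewrite !mulrA ltr_pM2r //; move: c0 c1; pure_nra.
have h4 : (2 + c) * ((1 - c / 8) * A%:c) <= (2 + c) * \sum_(i in I | heavy i) (cell q' A i)%:c.
  by rewrite ler_pM2l // addr_gt0.
move: hV UI heavyU h2 h3 h4; move: ((2 + c) * \sum_(i in I | heavy i) (cell q' A i)%:c) ((2 + c) * ((1 - c / 8) * A%:c)).
move: (\sum_(i in I) (residue q' @: cell2 q' V i)%:c) ((4 + e) * A%:c) ((4 + c) * A%:c) (4 * kap * A%:c); pure_lra.
Qed.

End HeavyCell.

(** * Progressions of integers from coset progressions *)

Section CyclicSubgroups.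
Variable q : nat.
Local Notation Q := q.+1.
Local Notation G := 'I_Q.
Implicit Types (H : {set G}) (x z : G).

Lemma inZpD m n : inZp (m + n) = (inZp m : G) + inZp n.
Proof. by apply: val_inj; rewrite /= modnDm. Qed.

Lemma inZpM k n : inZp (k * n) = (inZp n : G) *+ k.
Proof. by elim: k => [|k IH]; [apply: val_inj; rewrite /= mod0n|rewrite mulSn inZpD IH mulrS]. Qed.

Lemma subgroupMn (K : finZmodType) (H : {set K}) (x : K) n : subgroup H -> x \in H -> x *+ n \in H.
Proof.
move=> sgH xH; elim: n => [|n IH]; last by rewrite mulrS; apply: subgroupD.
by rewrite mulr0n; case/subgroupP: sgH.
Qed.

Lemma subgroup_multiples H : subgroup H -> exists r,
  [/\ (0 < r)%N, (r %| Q)%N & forall n, (inZp n \in H) = (r %| n)%N].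
Proof.
move=> sgH; have H0 : 0 \in H by case/subgroupP: sgH.
pose P n := (0 < n)%N && (inZp n \in H).
have ex : exists n, P n by exists Q; rewrite /P (_ : inZp Q = 0) //; apply: val_inj; rewrite /= modnn.
case: (ex_minnP ex) => r /andP[r0 rH] rmin.
have HP n : (inZp n \in H) = (r %| n)%N.
  apply/idP/idP => [nH|/dvdnP[k ->]]; last by rewrite inZpM subgroupMn.
  have sH : inZp (n %% r) \in H.
    have e : inZp n = inZp (n %/ r * r) + inZp (n %% r) :> G by rewrite -inZpD -divn_eq.
    have -> : inZp (n %% r) = inZp n - inZp (n %/ r * r) :> G by rewrite e addrAC subrr add0r.
    by apply: (subgroupP _ sgH).2 => //; rewrite inZpM subgroupMn.
  rewrite /dvdn; case: (posnP (n %% r)) => // s0.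
  by have := rmin (n %% r)%N; rewrite /P s0 sH leqNgt ltn_pmod // => /(_ isT).
exists r; split=> //; rewrite -HP (_ : inZp Q = 0) //; apply: val_inj; rewrite /= modnn //.
Qed.

(** Subgroups of a cyclic group consist of the multiples of a divisor [r] of the order, so a coset
    read in [[0, Q)] is a residue class modulo [r]. *)
Lemma coset_ap H z : subgroup H -> exists r x0 : nat, [/\ (0 < r)%N &
  forall x, x \in shift H z -> exists2 i, (i < #|H|)%N & val x = (x0 + i * r)%N].
Proof.
move=> sgH; have [r [r0 rQ HP]] := subgroup_multiples sgH.
have HPx x : (x \in H) = (r %| val x)%N by rewrite -HP valZpK.
have cH : (Q %/ r <= #|H|)%N.
  have inj : injective (fun i : 'I_(Q %/ r) => inZp (i * r) : G).
    move=> i j /(congr1 val) /=; rewrite !modn_small; last 2 first.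
    - by rewrite -ltn_divRL.
    - by rewrite -ltn_divRL.
    by move/eqP; rewrite eqn_mul2r gtn_eqF //= => /eqP /val_inj.
  rewrite -[X in (X <= _)%N]card_ord -cardsT -(card_imset _ inj); apply: subset_leq_card.
  by apply/subsetP => _ /imsetP[i _ ->]; rewrite HP dvdn_mull.
exists r, (val z %% r)%N; split=> // x; rewrite in_shift HPx => xz.
exists (val x %/ r)%N.
  by apply: leq_trans cH; rewrite ltn_divLR // divnK // ltn_ord.
have e : (val x = val z %[mod r])%N.
  rewrite -{1}[x](subrK z) /= modn_dvdm // -modnDml.
  by move: xz; rewrite /dvdn /= => /eqP ->; rewrite add0n.
by rewrite -e addnC -divn_eq.
Qed.

End CyclicSubgroups.

Section LatticeBox.
Variables (q l : nat).
Local Notation Q := q.+1.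
Local Notation G := 'I_Q.
Local Notation X := (Q * l)%N.
Variables (H : {set G}) (d z : G).
Hypotheses (sgH : subgroup H) (l0 : (0 < l)%N).
Hypothesis proper : #|cprog H d l| = (#|H| * l)%N.

Let X0 : (0 < X)%N. Proof. by rewrite muln_gt0 l0. Qed.

(* The points of [z + H + d [0, l)] lifted to the rectangle [[0, Q) x [0, l)]. Their
   differences lie in the lattice [lat]; [nrm] rescales the rectangle to a square of
   side [X]. *)
Definition box := [set p : G * 'I_l | p.1 - z - d *+ p.2 \in H].
Definition reduce (t : int) : G := (inZp 1 : G) *~ t.
Definition lat (v : int * int) := reduce v.1 - d *~ v.2 \in H.
Definition diff (p p' : G * 'I_l) : int * int :=
  ((val p.1)%:Z - (val p'.1)%:Z, (val p.2)%:Z - (val p'.2)%:Z).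
Definition nrm (v : int * int) : nat := maxn (`|v.1| * l) (`|v.2| * Q).

Lemma reduce_val (x : G) : reduce (val x)%:Z = x.
Proof. by rewrite /reduce -pmulrn -inZpM muln1 valZpK. Qed.

Lemma reduceD : {morph reduce : s t / s + t}.
Proof. by move=> s t; rewrite /reduce mulrzDr. Qed.

Lemma latD v w : lat v -> lat w -> lat (v + w).
Proof.
rewrite /lat /= reduceD mulrzDr opprD addrACA; exact: subgroupD.
Qed.

Lemma latN v : lat v -> lat (- v).
Proof. by rewrite /lat /reduce /= !mulrNz -opprD; exact: subgroupN. Qed.

Lemma lat0 : lat 0.
Proof. by rewrite /lat /reduce /= !mulr0z subrr; case/subgroupP: sgH. Qed.

Lemma latMn v n : lat v -> lat (v *+ n).
Proof.
move=> vL; elim: n => [|n IH]; first by rewrite mulr0n; apply: lat0.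
by rewrite mulrS; apply: latD.
Qed.

Lemma boxE p : (p \in box) = (reduce (val p.1)%:Z - z - d *~ (val p.2)%:Z \in H).
Proof. by rewrite inE reduce_val -pmulrn. Qed.

Lemma lat_diff p p' : p \in box -> p' \in box -> lat (diff p p').
Proof.
rewrite !boxE => pB pB'; have := subgroupD sgH pB (subgroupN sgH pB').
have reduceN t : reduce (- t) = - reduce t by rewrite /reduce mulrNz.
rewrite /lat /diff /= reduceD reduceN mulrzBr.
move: (reduce (val p.1)%:Z) (reduce (val p'.1)%:Z) (d *~ (val p.2)%:Z) (d *~ (val p'.2)%:Z) => A B S T.
by rewrite !opprB [T + _]addrC addrACA subrKA [- S + T]addrC.
Qed.

(** Two rows over one residue would give that residue, minus [z], two representations in the proper
    coset progression. *)
Lemma box_inj p p' : p \in box -> p' \in box -> p.1 = p'.1 -> p = p'.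
Proof.
case: p p' => [x j] [x' j']; rewrite !inE /= => pB pB' e; rewrite -e in pB' *.
have /imset_injP inj : #|cprog H d l| == #|setX H [set: 'I_l]|.
  by rewrite proper cardsX cardsT card_ord.
have m1 : (x - z - d *+ j, j) \in setX H [set: 'I_l] by rewrite in_setX pB inE.
have m2 : (x - z - d *+ j', j') \in setX H [set: 'I_l] by rewrite in_setX pB' inE.
have ed : x - z - d *+ j + d *+ j = x - z - d *+ j' + d *+ j' by rewrite !subrK.
by have e2 := inj _ _ m1 m2 ed; congr (_, _); apply: (congr1 snd e2).
Qed.

Lemma card_box_fiber (j : 'I_l) : #|[set x : G | (x, j) \in box]| = #|H|.
Proof.
rewrite -[RHS](card_shift H (z + d *+ j)); apply: eq_card => x.
by rewrite !inE /= opprD addrA.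
Qed.

Lemma card_box_rows (J : {set 'I_l}) : #|[set p in box | p.2 \in J]| = (#|J| * #|H|)%N.
Proof.
rewrite -sum_nat_const -(eq_bigr _ (fun j _ => card_box_fiber j)).
rewrite -sum1_card (partition_big (fun p : G * 'I_l => p.2) (mem J)) /=; last by move=> p; rewrite inE => /andP[].
apply: eq_bigr => j jJ; rewrite sum1_card -(card_imset _ (_ : injective (fun x : G => (x, j)))); last by move=> x y [].
apply: eq_card => -[x j']; rewrite unfold_in /= inE; apply/idP/imsetP => /=.
  by move=> /andP[/andP[pB _] /eqP <-]; exists x; rewrite // inE.
by case=> y; rewrite inE => yB [-> ->]; rewrite yB jJ eqxx.
Qed.

Lemma card_box : #|box| = (l * #|H|)%N.
Proof.
rewrite -[X in (X * _)%N]card_ord -cardsT -card_box_rows; apply: eq_card => p.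
by rewrite [RHS]inE in_setT andbT.
Qed.

Lemma nrm_diff p p' : (nrm (diff p p') < X)%N.
Proof.
rewrite /nrm /diff /= gtn_max [X in _ && (_ < X)%N]mulnC !ltn_pmul2r //.
have := ltn_ord p.1; have := ltn_ord p'.1; have := ltn_ord p.2; have := ltn_ord p'.2.
by move: (q.+1) (nat_of_ord p.1) (nat_of_ord p'.1) (nat_of_ord p.2) (nat_of_ord p'.2) => Q' a b c e; pure_lia.
Qed.

Lemma diff0 p p' : diff p p' = 0 -> p = p'.
Proof.
case: p p' => [x j] [x' j'] [/eqP + /eqP]; rewrite !subr_eq0 => /eqP[e1] /eqP[e2].
by congr (_, _); apply: val_inj.
Qed.

Lemma nrm0 v : nrm v = 0%N -> v = 0.
Proof.
rewrite /nrm => /eqP; rewrite -leqn0 geq_max !leqn0 !muln_eq0 orbF (gtn_eqF l0) orbF !absz_eq0.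
by case: v => s t /= /andP[/eqP -> /eqP ->].
Qed.

(** If no pair qualifies, the zero vector with [lam = X] serves as default: [X] exceeds every norm
    of a difference, and such a direction later receives length 1. *)
Lemma minimal_vector (Pr : G * 'I_l -> G * 'I_l -> bool) : (forall p, ~~ Pr p p) ->
  exists v lam, [/\ (0 < lam <= X)%N, lat v, (nrm v <= lam)%N,
    forall p p', p \in box -> p' \in box -> Pr p p' -> (lam <= nrm (diff p p'))%N &
    (lam < X)%N -> exists p p', [/\ Pr p p', p \in box, p' \in box & v = diff p p']].
Proof.
move=> irr; pose P (pp : (G * 'I_l) * (G * 'I_l)) := [&& pp.1 \in box, pp.2 \in box & Pr pp.1 pp.2].
have [/existsP[pp0 P0]|/existsPn none] := boolP [exists pp, P pp].
  have [[p p'] /and3P[/= pB pB' pr] pmin] := arg_minnP (fun pp => nrm (diff pp.1 pp.2)) P0.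
  exists (diff p p'), (nrm (diff p p')); split=> //.
  - rewrite (ltnW (nrm_diff _ _)) andbT lt0n; apply/eqP => /nrm0 /diff0 e.
    by move: pr; rewrite e (negbTE (irr _)).
  - exact: lat_diff.
  - by move=> r r' rB rB' prr; apply: (pmin (r, r')); rewrite /P /= rB rB'.
  - by move=> _; exists p, p'.
exists 0, X; split=> //; first by rewrite X0 leqnn.
- exact: lat0.
- by move=> p p' pB pB' pr; have := none (p, p'); rewrite /P /= pB pB' pr.
- by rewrite ltnn.
Qed.

End LatticeBox.

Lemma floor_close (a b m : nat) : (0 < m)%N -> (a %/ m = b %/ m)%N -> (`|a%:Z - b%:Z| < m)%N.
Proof.
move=> m0 e; have := divn_eq a m; have := divn_eq b m; rewrite e.
have := ltn_pmod a m0; have := ltn_pmod b m0.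
by move: (a %% m)%N (b %% m)%N (b %/ m * m)%N => r s k; pure_lia.
Qed.

Definition cross (v w : int * int) : int := v.1 * w.2 - v.2 * w.1.

Section Minima.
Variables (q l : nat).
Local Notation Q := q.+1.
Local Notation G := 'I_Q.
Local Notation X := (Q * l)%N.
Variables (H : {set G}) (d z : G).
Local Notation box := (box l H d z).
Hypothesis l0 : (0 < l)%N.

(* The rounded coordinates of the points of the box are distinct. *)
Lemma card_box_le (mu nu : nat) : (0 < mu)%N -> (0 < nu)%N ->
  (forall p p' : G * 'I_l, p \in box -> p' \in box -> (`|(diff p p').1| * l < mu)%N ->
     (`|(diff p p').2| * Q < nu)%N -> p = p') ->
  (#|box| * (mu * nu) <= 4 * (maxn X mu * maxn X nu))%N.
Proof.
move=> mu0 nu0 inj.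
pose F (p : G * 'I_l) : 'I_(X %/ mu).+1 * 'I_(X %/ nu).+1 :=
  (inord (val p.1 * l %/ mu)%N, inord (val p.2 * Q %/ nu)%N).
have b1 (p : G * 'I_l) : (val p.1 * l %/ mu < (X %/ mu).+1)%N.
  by rewrite ltnS leq_div2r // leq_mul2r (ltnW (ltn_ord _)) orbT.
have b2 (p : G * 'I_l) : (val p.2 * Q %/ nu < (X %/ nu).+1)%N.
  by rewrite ltnS leq_div2r // mulnC leq_mul2l (ltnW (ltn_ord _)) orbT.
have Finj : {in box &, injective F}.
  move=> p p' pB pB' e; apply: inj => //.
    have := congr1 (fun u => val u.1) e; rewrite /= (inordK (b1 p)) (inordK (b1 p')); move/(floor_close mu0).
    by rewrite !PoszM -mulrBl abszM absz_nat.
  have := congr1 (fun u => val u.2) e; rewrite /= (inordK (b2 p)) (inordK (b2 p')); move/(floor_close nu0).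
  by rewrite !PoszM -mulrBl abszM absz_nat.
have := subset_leq_card (subsetT (F @: box)); rewrite card_in_imset // cardsT card_prod !card_ord => h.
apply: leq_trans (leq_mul h (leqnn _)) _; rewrite mulnACA.
have aux m : (0 < m)%N -> ((X %/ m).+1 * m <= 2 * maxn X m)%N.
  move=> m0; rewrite mulSn mul2n -addnn; apply: leq_add; first exact: leq_maxr.
  by apply: leq_trans (leq_trunc_div _ _) _; exact: leq_maxl.
apply: leq_trans (leq_mul (aux _ mu0) (aux _ nu0)) _; by rewrite mulnACA.
Qed.

(** An analogue of Minkowski's second theorem. Cells have side [lam1] along the dominant coordinate
    of [v] and [lam2] along the other. Two points of one cell are at distance below [lam2], so their
    difference is parallel to [v]; its dominant coordinate makes its norm less than [lam1], so they
    coincide. *)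
Lemma card_box_minima (v : int * int) (lam1 lam2 : nat) :
  (0 < lam1)%N -> (lam1 <= lam2)%N -> (lam2 <= X)%N ->
  (forall p p' : G * 'I_l, p \in box -> p' \in box -> p != p' -> (lam1 <= nrm q l (diff p p'))%N) ->
  (forall p p' : G * 'I_l, p \in box -> p' \in box -> cross (diff p p') v != 0 ->
     (lam2 <= nrm q l (diff p p'))%N) ->
  ((lam1 < X)%N -> v != 0) ->
  (#|box| * (lam1 * lam2) <= 4 * (X * X))%N.
Proof.
move=> l10 l12 l2X min1 min2 v0.
have key (p p' : G * 'I_l) : p \in box -> p' \in box -> (nrm q l (diff p p') < lam2)%N ->
    ((lam1 < X)%N -> v != 0 -> cross (diff p p') v = 0 -> (nrm q l (diff p p') < lam1)%N) -> p = p'.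
  move=> pB pB' n2 n1; apply/eqP; apply: contraT => pp; have m1 := min1 p p' pB pB' pp.
  have c0 : cross (diff p p') v = 0.
    by apply/eqP; apply: contraT => /(min2 p p' pB pB'); rewrite leqNgt n2.
  have lX : (lam1 < X)%N by apply: leq_ltn_trans m1 (nrm_diff l0 p p').
  by have := n1 lX (v0 lX) c0; rewrite ltnNge m1.
have mX m : (m <= X)%N -> maxn X m = X by move/maxn_idPl.
have l20 := leq_trans l10 l12.
have [dom|dom] := leqP (`|v.2| * Q) (`|v.1| * l).
  have := @card_box_le lam1 lam2 l10 l20; rewrite !mX // ?(leq_trans l12) //; apply.
  move=> p p' pB pB' h1 h2; apply: key => //.
    by rewrite /nrm gtn_max h2 (leq_trans h1).
  move=> lX vn0 c0; rewrite /nrm gtn_max h1 /=; apply: leq_ltn_trans h1.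
  have v10 : (0 < `|v.1|)%N.
    rewrite lt0n; apply/eqP => e; move: dom; rewrite e mul0n leqn0 muln_eq0 orbF absz_eq0 => /eqP e2.
    by move/eqP: e; rewrite absz_eq0 => /eqP e1; move: vn0; case: (v) e1 e2 => a b /= -> ->; rewrite eqxx.
  rewrite -(leq_pmul2l v10).
  have e : (`|v.1| * `|(diff p p').2| = `|(diff p p').1| * `|v.2|)%N.
    by move/eqP: c0; rewrite subr_eq0 => /eqP; rewrite -!abszM => ->; rewrite mulrC.
  by rewrite mulnA e -mulnA; apply: leq_trans (leq_mul (leqnn _) dom) _; rewrite mulnCA.
have := @card_box_le lam2 lam1 l20 l10; rewrite !mX // ?(leq_trans l12) // (mulnC lam2); apply.
move=> p p' pB pB' h1 h2; apply: key => //.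
  by rewrite /nrm gtn_max h1 (leq_trans h2).
move=> lX vn0 c0; rewrite /nrm gtn_max h2 andbT; apply: leq_ltn_trans h2.
have v20 : (0 < `|v.2|)%N by case: (`|v.2|)%N dom => //; rewrite mul0n.
rewrite -(leq_pmul2l v20).
have e : (`|v.2| * `|(diff p p').1| = `|(diff p p').2| * `|v.1|)%N.
  by move/eqP: c0; rewrite subr_eq0 => /eqP; rewrite -!abszM => <-; rewrite mulrC.
by rewrite mulnA e -mulnA; apply: leq_trans (leq_mul (leqnn _) (ltnW dom)) _; rewrite mulnCA.
Qed.

Lemma central_rows : (l <= 2 * #|[set j : 'I_l | (l %/ 4 <= j) && (j + l %/ 4 < l)]|)%N.
Proof.
pose k := (l %/ 4)%N; have k4 : (4 * k <= l)%N by rewrite mulnC leq_trunc_div.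
have inj : injective (fun i : 'I_(l - 2 * k) => insubd (Ordinal l0) (k + i)%N : 'I_l).
  move=> i j /(congr1 val); rewrite !val_insubd.
  have := ltn_ord i; have := ltn_ord j => hi hj; rewrite !ifT; last 2 first.
  - by move: hi k4; move: (k) (nat_of_ord j); pure_lia.
  - by move: hj k4; move: (k) (nat_of_ord i); pure_lia.
  by move/eqP; rewrite eqn_add2l => /eqP /val_inj.
apply: leq_trans (_ : 2 * (l - 2 * k) <= _)%N; first by move: k4; move: (k) => ?; pure_lia.
rewrite leq_mul2l /= -{1}[(l - _)%N]card_ord -cardsT -(card_imset _ inj).
apply/subset_leq_card/subsetP => _ /imsetP[i _ ->]; rewrite inE val_insubd.
have hi := ltn_ord i; rewrite ifT -/k; first by move: hi k4; move: (k) (nat_of_ord i) => a b; pure_lia.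
by move: hi k4; move: (k) (nat_of_ord i) => a b; pure_lia.
Qed.

End Minima.

Lemma flip_sign (low : bool) (t : int) : exists e : int,
  (e = 1 \/ e = -1) /\ (if low then 0 <= e * t else e * t <= 0).
Proof.
have [t0|t0] := leP 0 t; case: low.
- by exists 1; split; [left|rewrite mul1r].
- by exists (-1); split; [right|rewrite mulN1r oppr_le0].
- by exists (-1); split; [right|rewrite mulN1r oppr_ge0 ltW].
- by exists 1; split; [left|rewrite mul1r ltW].
Qed.

(** Each walk moves by at most an eighth of either side, so two of them together use at most the
    quarter kept free around the starting points. *)
Lemma nrm_steps q l (v : int * int) (lam i : nat) : (0 < l)%N -> (0 < lam)%N -> (nrm q l v <= lam)%N ->
  (i < (q.+1 * l %/ (8 * lam)).+1)%N ->
  (8 * absz (v.1 * i%:Z)%R <= q.+1)%N /\ (8 * absz (v.2 * i%:Z)%R <= l)%N.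
Proof.
move=> l0 lam0; rewrite geq_max => /andP[n1 n2]; rewrite ltnS leq_divRL ?muln_gt0 // => hi.
split.
  rewrite -(leq_pmul2r l0); apply: leq_trans hi; rewrite abszM absz_nat.
  by move: n1; move: (absz v.1) => a h; have := leq_mul (leqnn (8 * i)) h; rewrite !mulnA; move: (_ * l)%N (_ * lam)%N; nia.
rewrite -(@leq_pmul2r q.+1) // [leqRHS]mulnC; apply: leq_trans hi; rewrite abszM absz_nat.
by move: n2; move: (absz v.2) => a h; have := leq_mul (leqnn (8 * i)) h; nia.
Qed.

Section Gap.
Variables (R : realType) (q : nat).
Local Notation Q := q.+1.
Local Notation G := 'I_Q.

(* The steps are two vectors realising the successive minima of [nrm] on the
   differences of points of the box, with signs chosen so that walks started in the
   middle rows of the lower (or upper) half of the box stay in the box, where they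
   do not wrap around. *)
Lemma gap_of_cprog (H S : {set G}) (d z : G) (l : nat) (eps : R) : 0 < eps -> subgroup H -> (0 < l)%N ->
  #|cprog H d l| = (#|H| * l)%N ->
  (1 - eps) * #|cprog H d l|%:R <= #|S :&: shift (cprog H d l) z|%:R ->
  exists (x0 a1 a2 : int) (n1 n2 : nat) (Y : {set 'I_n1 * 'I_n2}),
  [/\ (0 < n1)%N && (0 < n2)%N, (#|cprog H d l| <= 256 * (n1 * n2))%N,
     forall i i' k k' : nat, (i < n1)%N -> (i' < n1)%N -> (k < n2)%N -> (k' < n2)%N ->
       x0 + a1 * i%:Z + a2 * k%:Z = x0 + a1 * i'%:Z + a2 * k'%:Z -> i = i' /\ k = k',
     (1 - 4 * eps) * (n1 * n2)%N%:R <= #|Y|%:R &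
     forall ik, ik \in Y -> exists2 s, s \in S & (val s)%:Z = x0 + a1 * (val ik.1)%:Z + a2 * (val ik.2)%:Z].
Proof.
move=> eps0 sgH l0 proper dens; pose X := (Q * l)%N.
have X0 : (0 < X)%N by rewrite muln_gt0 l0.
have bH : #|box l H d z| = #|cprog H d l| by rewrite card_box proper mulnC.
have [|v1 [lam1 [/andP[l10 l1X] lat1 nrm1 min1 ex1]]] := @minimal_vector q l H d z sgH l0 (fun p p' => p != p').
  by move=> p; rewrite eqxx.
have [|v2 [lam2 [/andP[l20 l2X] lat2 nrm2 min2 ex2]]] :=
    @minimal_vector q l H d z sgH l0 (fun p p' => cross (diff p p') v1 != 0).
  by move=> p; rewrite /cross /diff !subrr !mul0r subrr eqxx.
have l12 : (lam1 <= lam2)%N.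
  move: l2X; rewrite leq_eqVlt => /orP[/eqP ->//|/ex2[p [p' [c pB pB' e]]]].
  apply: leq_trans nrm2; rewrite e; apply: min1 => //; apply/eqP => pp; move: c.
  by rewrite pp /cross /diff !subrr !mul0r subrr eqxx.
have v10 : (lam1 < X)%N -> v1 != 0.
  by case/ex1 => p [p' [pp _ _ ->]]; apply: contra pp => /eqP /diff0 ->.
have c21 : (lam2 < X)%N -> cross v2 v1 != 0.
  by case/ex2 => p [p' [c _ _ ->]].
have cB := card_box_minima l0 l10 l12 l2X min1 min2 v10.
pose n1 := (X %/ (8 * lam1)).+1; pose n2 := (X %/ (8 * lam2)).+1.
have hn m : (0 < m)%N -> (X <= (X %/ (8 * m)).+1 * (8 * m))%N.
  by move=> m0; apply: ltnW; apply: ltn_ceil; rewrite muln_gt0.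
have c256 : (#|box l H d z| <= 256 * (n1 * n2))%N.
  have p0 : (0 < lam1 * lam2)%N by rewrite muln_gt0 l10.
  rewrite -(leq_pmul2r p0); apply: leq_trans cB _.
  apply: leq_trans (leq_mul (leqnn 4) (leq_mul (hn _ l10) (hn _ l20))) _.
  by rewrite -/n1 -/n2; move: n1 n2 => a b; nia.
pose J := [set j : 'I_l | (l %/ 4 <= j) && (j + l %/ 4 < l)]%N.
pose B := [set p in box l H d z | p.2 \in J].
have cBB : (#|box l H d z| <= 2 * #|B|)%N.
  by rewrite card_box /B card_box_rows mulnA leq_mul2r central_rows // orbT.
(* All rows hold equally many points, so the middle ones hold half of the box. Columns need not be
   balanced, so the fuller half is kept and the walks are directed into the other one. *)
have [low] : exists low : bool, (#|box l H d z| <= 4 * #|[set p in B | (2 * val p.1 < Q)%N == low]|)%N.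
  have := cardsID [set p | (2 * val p.1 < Q)%N] B.
  have -> : B :&: [set p | (2 * val p.1 < Q)%N] = [set p in B | (2 * val p.1 < Q)%N == true].
    by apply/setP => p; rewrite !inE eqb_id.
  have -> : B :\: [set p | (2 * val p.1 < Q)%N] = [set p in B | (2 * val p.1 < Q)%N == false].
    by apply/setP => p; rewrite !inE eqbF_neg andbC.
  move=> e; have [h|h] := leqP #|[set p in B | (2 * val p.1 < Q)%N == false]| #|[set p in B | (2 * val p.1 < Q)%N == true]|.
    by exists true; move: cBB e h; move: #|_| #|_| #|_| #|_|; pure_lia.
  by exists false; move: cBB e h; move: #|_| #|_| #|_| #|_|; pure_lia.
set B0 := [set p in B | _] => hlow.
have [e1 [e1E s1]] := flip_sign low v1.1; have [e2 [e2E s2]] := flip_sign low v2.1.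
have e1n0 : e1 != 0 by case: e1E => ->.
have e2n0 : e2 != 0 by case: e2E => ->.
pose u1 := (e1 * v1.1, e1 * v1.2); pose u2 := (e2 * v2.1, e2 * v2.2).
have nrmE (e : int) v : e = 1 \/ e = -1 -> nrm q l (e * v.1, e * v.2) = nrm q l v.
  by case=> ->; rewrite /nrm /= ?mul1r // !mulN1r !abszN.
have latE (e : int) v : e = 1 \/ e = -1 -> lat H d v -> lat H d (e * v.1, e * v.2).
  case=> -> vL; first by rewrite !mul1r; case: (v) vL.
  by rewrite !mulN1r; have := latN sgH vL.
have L1 : lat H d u1 by apply: latE.
have L2 : lat H d u2 by apply: latE.
have N1 : (nrm q l u1 <= lam1)%N by rewrite nrmE.
have N2 : (nrm q l u2 <= lam2)%N by rewrite nrmE.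
pose off (i k : nat) := (u1.1 * i%:Z + u2.1 * k%:Z, u1.2 * i%:Z + u2.2 * k%:Z).
have offL i k : lat H d (off i k).
  have mE (v : int * int) n : v *+ n = (v.1 * n%:Z, v.2 * n%:Z).
    elim: n => [|n IH]; first by rewrite mulr0n !mulr0.
    by rewrite mulrS IH; case: (v) => a b /=; rewrite -[n.+1]addn1 PoszD !mulrDr !mulr1 ![_ + a]addrC ![_ + b]addrC.
  by have := latD sgH (latMn sgH i L1) (latMn sgH k L2); rewrite !mE.
have bnd p i k : p \in B0 -> (i < n1)%N -> (k < n2)%N ->
   0 <= (val p.1)%:Z + (off i k).1 < Q%:Z /\ 0 <= (val p.2)%:Z + (off i k).2 < l%:Z.
  rewrite in_set => /andP[+ /eqP half] iI kI; rewrite in_set => /andP[_]; rewrite in_set => /andP[j1 j2].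
  have [a1 a2] := nrm_steps l0 l10 N1 iI; have [b1 b2] := nrm_steps l0 l20 N2 kI.
  have xQ := ltn_ord p.1; have jl := ltn_ord p.2.
  have q4 := divn_eq l 4; have r4 := ltn_pmod l (isT : 0 < 4)%N.
  split.
    have sg1 : if low then 0 <= u1.1 * i%:Z else u1.1 * i%:Z <= 0.
      by case: (low) s1 => h; [rewrite mulr_ge0|rewrite mulr_le0_ge0].
    have sg2 : if low then 0 <= u2.1 * k%:Z else u2.1 * k%:Z <= 0.
      by case: (low) s2 => h; [rewrite mulr_ge0|rewrite mulr_le0_ge0].
    move: half a1 b1 sg1 sg2 xQ; rewrite /off /=; move: (u1.1 * _) (u2.1 * _) (nat_of_ord p.1) => s t x.
    by case: (low); pure_lia.
  move: a2 b2 j1 j2 jl q4 r4; rewrite /off /=; move: (u1.2 * _) (u2.2 * _) (nat_of_ord p.2) => s t x.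
  by move: (l %/ 4)%N (l %% 4)%N; pure_lia.
(* By [bnd] the coordinates are in range, so the defaults of [inord] and [insubd] never occur. *)
pose pt (p : G * 'I_l) i k : G * 'I_l :=
  (inord (absz ((val p.1)%:Z + (off i k).1)), insubd (Ordinal l0) (absz ((val p.2)%:Z + (off i k).2))).
have ptE p i k : p \in B0 -> (i < n1)%N -> (k < n2)%N ->
   (val (pt p i k).1)%:Z = (val p.1)%:Z + (off i k).1 /\ (val (pt p i k).2)%:Z = (val p.2)%:Z + (off i k).2.
  move=> pB iI kI; have [/andP[x0 xQ] /andP[j0 jl]] := bnd p i k pB iI kI; split.
    by rewrite /pt /= inordK ?gez0_abs // -ltz_nat gez0_abs.
  by rewrite /pt /= val_insubd ifT ?gez0_abs // -ltz_nat gez0_abs.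
have B0box p : p \in B0 -> p \in box l H d z.
  by rewrite in_set => /andP[+ _]; rewrite in_set => /andP[].
have ptB p i k : p \in B0 -> (i < n1)%N -> (k < n2)%N -> pt p i k \in box l H d z.
  move=> pB iI kI; have [x1 x2] := ptE p i k pB iI kI.
  have rearrange (K : zmodType) (a b c s t : K) : b - t + (a - c - s) = a + b - c - (s + t).
    by rewrite [LHS]addrC addrACA opprD [a - c + b]addrAC.
  rewrite boxE x1 x2 reduceD mulrzDr -rearrange; apply: subgroupD => //; first exact: offL.
  by rewrite -boxE B0box.
pose Bd := [set p in box l H d z | p.1 \notin S].
have cBd : #|Bd|%:R <= eps * #|box l H d z|%:R :> R.
  have h : (#|S :&: shift (cprog H d l) z| <= #|[set p in box l H d z | p.1 \in S]|)%N.
    apply: leq_trans (leq_imset_card (fun p => p.1) _); apply/subset_leq_card/subsetP => x.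
    rewrite inE in_shift => /andP[xS /cprogP[h [j [hH jl e]]]].
    apply/imsetP; exists (x, Ordinal jl) => //.
    by rewrite in_set in_set /= xS andbT e addrK.
  have : (#|[set p in box l H d z | p.1 \in S]| + #|Bd| = #|box l H d z|)%N.
    rewrite -(cardsID [set p | p.1 \in S] (box l H d z)); congr (_ + _)%N; apply: eq_card => p.
      by rewrite [RHS]in_setI !in_set.
    by rewrite [RHS]in_setD !in_set andbC.
  move: dens; rewrite bH => dens e; have {}e : #|[set p in box l H d z | p.1 \in S]|%:R + #|Bd|%:R = #|cprog H d l|%:R :> R by rewrite -natrD e.
  have {}h : #|S :&: shift (cprog H d l) z|%:R <= #|[set p in box l H d z | p.1 \in S]|%:R :> R by rewrite ler_nat.
  by move: dens e h; rewrite mulrBl mul1r; move: (eps * _); pure_lra.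
(* For fixed [(i, k)] the endpoint determines the start, so each position meets a bad point from at
   most [|Bd|] starts. Averaging over [B0], at least a quarter of the box, turns [eps] into
   [4 * eps]. *)
pose f p := #|[set ik : 'I_n1 * 'I_n2 | pt p ik.1 ik.2 \in Bd]|.
have sf : (\sum_(p in B0) f p <= n1 * n2 * #|Bd|)%N.
  rewrite (eq_bigr (fun p => \sum_(ik : 'I_n1 * 'I_n2) (pt p ik.1 ik.2 \in Bd : nat))%N); last first.
    by move=> p _; rewrite /f -sum1dep_card big_mkcond /=; apply: eq_bigr => ik _; case: (_ \in _).
  rewrite exchange_big /=; apply: leq_trans (_ : \sum_(ik : 'I_n1 * 'I_n2) #|Bd| <= _)%N; last first.
    by rewrite sum_nat_const card_prod !card_ord.
  apply: leq_sum => -[i k] _ /=.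
  have -> : (\sum_(p in B0) (pt p i k \in Bd : nat) = #|[set p in B0 | pt p i k \in Bd]|)%N.
    by rewrite -sum1dep_card big_mkcondr /=; apply: eq_bigr => p _; case: (_ \in _).
  have inj : {in [set p in B0 | pt p i k \in Bd] &, injective (fun p => pt p i k)}.
    move=> p p' /setIdP[pB _] /setIdP[pB' _] e.
    have [x1 x2] := ptE p i k pB (ltn_ord i) (ltn_ord k).
    have [x1' x2'] := ptE p' i k pB' (ltn_ord i) (ltn_ord k).
    have {}x1 : (val p.1)%:Z = (val p'.1)%:Z by apply: (addIr (off i k).1); rewrite -x1 -x1' e.
    have {}x2 : (val p.2)%:Z = (val p'.2)%:Z by apply: (addIr (off i k).2); rewrite -x2 -x2' e.
    by case: p p' x1 x2 {pB pB' x1' x2' e} => [a b] [a' b'] /= [] ea [] eb; congr (_, _); apply: val_inj.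
  rewrite -(card_in_imset inj); apply/subset_leq_card/subsetP => _ /imsetP[p + ->].
  by case/setIdP.
have B00 : B0 != set0.
  have : (0 < #|box l H d z|)%N.
    rewrite card_box muln_gt0 l0 /= card_gt0; apply/set0Pn; exists 0; by case/subgroupP: sgH.
  by rewrite -card_gt0; move: hlow; move: #|_| #|_|; pure_lia.
have [|p pB hp] := @exists_le_avg R _ B0 f (4 * eps * (n1 * n2)%N%:R) B00.
  apply: le_trans (_ : (n1 * n2 * #|Bd|)%N%:R <= _); first by rewrite ler_nat.
  rewrite natrM; apply: le_trans (ler_wpM2l _ cBd) _ => //.
  have h : #|box l H d z|%:R <= 4 * #|B0|%:R :> R by rewrite -natrM ler_nat.
  apply: le_trans (_ : (n1 * n2)%N%:R * (eps * (4 * #|B0|%:R)) <= _).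
    by rewrite ler_wpM2l // ler_wpM2l // ltW.
  by rewrite (_ : _ * (eps * _) = 4 * eps * (n1 * n2)%N%:R * #|B0|%:R) //; ring.
exists (val p.1)%:Z, u1.1, u2.1, n1, n2, (~: [set ik : 'I_n1 * 'I_n2 | pt p ik.1 ik.2 \in Bd]); split=> //.
- by rewrite -bH.
- move=> i i' k k' iI iI' kI kI' e.
  have [x1 x2] := ptE p i k pB iI kI; have [x1' x2'] := ptE p i' k' pB iI' kI'.
  have e1' : (pt p i k).1 = (pt p i' k').1.
    by apply: val_inj; apply/eqP; rewrite -eqz_nat x1 x1' /off /= !addrA e.
  have ep := box_inj proper (ptB p i k pB iI kI) (ptB p i' k' pB iI' kI') e1'.
  have {}x2 : (off i k).2 = (off i' k').2 by apply: (addrI (val p.2)%:Z); rewrite -x2 -x2' ep.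
  have {}x1 : (off i k).1 = (off i' k').1 by apply: (addrI (val p.1)%:Z); rewrite -x1 -x1' ep.
  (* A second direction longer than 1 is not parallel to the first, so the determinant with the
     first step recovers [k]; otherwise [n2 = 1]. *)
  have kk : k = k'.
    move: l2X; rewrite leq_eqVlt => /orP[/eqP l2|/c21 c].
      have n21 : n2 = 1%N by rewrite /n2 l2 divn_small // ltn_Pmull.
      by move: kI kI'; rewrite n21; move: (k) (k'); pure_lia.
    pose C := u2.1 * u1.2 - u2.2 * u1.1.
    have C0 : C != 0.
      have -> : C = e1 * e2 * cross v2 v1 by rewrite /C /cross /u1 /u2 /=; ring.
      by rewrite !mulf_neq0 // ?e1n0 ?e2n0.
    have kC m n : n%:Z * C = (off m n).1 * u1.2 - (off m n).2 * u1.1 by rewrite /C /off /=; ring.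
    by have := kC i k; rewrite x1 x2 -kC => /(mulIf C0) [].
  split=> //.
  move: l1X; rewrite leq_eqVlt => /orP[/eqP l1|/v10 c].
    have n11 : n1 = 1%N by rewrite /n1 l1 divn_small // ltn_Pmull.
    by move: iI iI'; rewrite n11; move: (i) (i'); pure_lia.
  move: x1 x2; rewrite /off /= kk => /addIr x1 /addIr x2.
  have [u0|u0] := eqVneq u1.1 0; last by case: (mulfI u0 x1).
  have [w0|w0] := eqVneq u1.2 0; last by case: (mulfI w0 x2).
  exfalso; move: c; apply/negP; rewrite negbK; move/eqP: u0; move/eqP: w0.
  rewrite /u1 /= !mulf_eq0 (negbTE e1n0) /=; case: (v1) => a b /= /eqP -> /eqP ->.
  by rewrite eqxx.
- have := cardsC [set ik : 'I_n1 * 'I_n2 | pt p ik.1 ik.2 \in Bd]; rewrite card_prod !card_ord => e.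
  move: hp; rewrite /f; have -> : (n1 * n2)%N%:R = #|[set ik : 'I_n1 * 'I_n2 | pt p ik.1 ik.2 \in Bd]|%:R + #|~: [set ik : 'I_n1 * 'I_n2 | pt p ik.1 ik.2 \in Bd]|%:R :> R by rewrite -natrD e.
  by move: (#|_|%:R) (#|_|%:R) => a b; rewrite mulrBl mul1r; move: (4 * eps * _); pure_lra.
move=> [i k]; rewrite in_setC in_set /= => nBd.
have [x1 x2] := ptE p i k pB (ltn_ord i) (ltn_ord k).
exists (pt p i k).1; last by rewrite x1 addrA.
by move: nBd; rewrite in_set ptB //= negbK.
Qed.

End Gap.

(** * The dichotomy for sets of integers *)

Lemma exists_min_positive (R : realDomainType) (f : nat -> R) J : (forall j, 0 < f j) ->
  exists2 m, 0 < m & forall j, (j < J)%N -> m <= f j.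
Proof.
move=> f0; elim: J => [|J [m m0 hm]]; first by exists 1.
exists (Num.min m (f J)); first by rewrite lt_min m0 f0.
move=> j; rewrite ltnS leq_eqVlt => /orP[/eqP ->|/hm h]; first by rewrite ge_min lexx orbT.
by apply: le_trans h; rewrite ge_min lexx.
Qed.

Section Dichotomy.
Variable R : realType.
Local Notation "A '%:c'" := (#|A|%:R : R) (at level 2, format "A %:c").

Definition half_dense_ap N (A : {set 'I_N.+1}) (c eps : R) := exists (x0 r n : nat) (Y : {set 'I_N.+1}),
  [/\ (0 < n)%N && (0 < r)%N, c * A%:c <= n%:R, (1 / 2 - eps) * n%:R <= Y%:c, Y \subset A &
    forall y, y \in Y -> exists2 i, (i < n)%N & val y = (x0 + i * r)%N].

Definition dense_gap N (A : {set 'I_N.+1}) (c eps : R) :=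
  exists (x0 a1 a2 : int) (n1 n2 : nat) (Y : {set 'I_n1 * 'I_n2}),
  [/\ (0 < n1)%N && (0 < n2)%N, c * A%:c <= (n1 * n2)%N%:R,
     forall i i' k k' : nat, (i < n1)%N -> (i' < n1)%N -> (k < n2)%N -> (k' < n2)%N ->
       x0 + a1 * i%:Z + a2 * k%:Z = x0 + a1 * i'%:Z + a2 * k'%:Z -> i = i' /\ k = k',
     (1 - eps) * (n1 * n2)%N%:R <= Y%:c &
     forall ik, ik \in Y -> exists2 s, s \in A & (val s)%:Z = x0 + a1 * (val ik.1)%:Z + a2 * (val ik.2)%:Z].

Lemma cell_dichotomy (eps : R) : 0 < eps -> exists c g : R, [/\ 0 < c, 0 < g & c <= 1 /\
  forall N (A V : {set 'I_N.+1}) q' i (c' : R), A != set0 ->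
  let SA := residue q' @: cell q' A i in let UV := residue q' @: cell2 q' V i in
    0 < c' -> c' * A%:c <= SA%:c -> UV%:c <= (2 + c) * SA%:c -> (bad SA SA UV)%:R <= g * SA%:c ^+ 2 ->
  half_dense_ap A (c * c' / 256) eps \/ dense_gap A (c * c' / 256) eps].
Proof.
move=> eps0; have [L hL] := cprog_in_nfold R.
(* [gap_of_cprog] loses a factor 4 in the exceptional density, and the 256 in its size. *)
have e0 : 0 < eps / 4 by rewrite divr_gt0.
have [c1 [g [c10 g0 hg]]] := dense_piece L e0.
pose c := Num.min c1 1; have c0 : 0 < c by rewrite lt_min c10 ltr01.
have cc1 : c <= c1 by rewrite ge_min lexx.
exists c, g; split=> //; split; first by rewrite ge_min lexx orbT.
move=> N A V q' i c' A0 SA UV c'0 cSA hU hb.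
have n0 : 0 < A%:c by rewrite ltr0n card_gt0.
have SA0 : SA != set0 by rewrite -card_gt0 -(ltr0n R); apply: lt_le_trans cSA; rewrite mulr_gt0.
have SAp : 0 < SA%:c by rewrite ltr0n card_gt0.
have SAA s : s \in SA -> exists2 a, a \in cell q' A i & residue q' a = s /\ val a = (i * q'.+1 + val s)%N.
  by case/imsetP => a aA ->; exists a => //; split=> //; apply: cell_val aA.
have cA a : a \in cell q' A i -> a \in A by case/setIdP.
have cA1 (x : R) : c1 * SA%:c <= x -> c * c' * A%:c <= x.
  apply: le_trans; rewrite -mulrA; apply: le_trans (ler_wpM2l (ltW c0) cSA) _.
  by rewrite ler_pM2r.
have hU1 : UV%:c <= (2 + c1) * SA%:c by apply: le_trans hU _; rewrite ler_pM2r // lerD2l.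
have [[H [z [sgH cH hH]]]|[H [d [l [z [sgH l0 cP hP hd]]]]]] := hg _ SA UV (hL q') SA0 hU1 hb.
  left; have [r [x0 [r0 hr]]] := coset_ap z sgH.
  pose Y := [set a in cell q' A i | residue q' a \in shift H z].
  exists (i * q'.+1 + x0)%N, r, #|H|, Y; split.
  - by rewrite r0 subgroup_gt0.
  - apply: le_trans (cA1 _ cH); rewrite ler_pM2r // ler_pdivrMr // ler_peMr ?mulr_ge0 ?(ltW c0) ?(ltW c'0) //.
    by rewrite -[1]/(1%:R) ler_nat.
  - apply: le_trans (_ : (1 / 2 - eps / 4) * H%:c <= _); first by rewrite ler_wpM2r //; lra.
    apply: le_trans hH _; rewrite ler_nat; apply: leq_trans (leq_imset_card (residue q') Y).
    apply/subset_leq_card/subsetP => s; rewrite inE => /andP[/SAA[a aC [as_ _]] sH].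
    by apply/imsetP; exists a => //; rewrite in_set aC as_.
  - by apply/subsetP => a /setIdP[/cA].
  move=> a /setIdP[aC aH]; have [j jH ej] := hr _ aH; exists j => //.
  by rewrite (cell_val aC) ej addnA.
right.
have [x0 [a1 [a2 [n1 [n2 [Y [n12 cn inj hY YS]]]]]]] := gap_of_cprog e0 sgH l0 cP hd.
exists ((i * q'.+1)%N%:Z + x0), a1, a2, n1, n2, Y; split=> //.
- have := cA1 _ hP; move: cn; rewrite -(ler_nat R) natrM => h1 h2.
  by rewrite mulrAC ler_pdivrMr // [leRHS]mulrC; exact: le_trans h2 h1.
- move=> j j' k k' jI j'I kI k'I e; apply: inj => //.
  by apply: (addrI (i * q'.+1)%N%:Z); rewrite !addrA.
- apply: le_trans hY; rewrite ler_wpM2r // mulrC divfK ?lexx // pnatr_eq0 //.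
move=> ik /YS[s /SAA[a aC [_ ea]] es]; exists a; first exact: cA.
by rewrite ea PoszD es !addrA.
Qed.

Lemma ordinal_dichotomy (eps : R) : 0 < eps -> exists delta delta' c : R, [/\ 0 < delta, 0 < delta', 0 < c &
  forall N (A S : {set 'I_N.+1}), A != set0 -> {in A, forall a, 4 * val a <= N}%N ->
    S%:c <= (4 + delta) * A%:c -> (bad A A S)%:R <= delta' * A%:c ^+ 2 ->
  half_dense_ap A c eps \/ dense_gap A c eps].
Proof.
move=> eps0; have [c [g [c0 g0 [c1 hcell]]]] := cell_dichotomy eps0.
pose kap := c / 16; have kap0 : 0 < kap by rewrite divr_gt0.
(* The tuple length for which the error [8 * |A| ^ 3 / k] of [almost_periods] is at most [kap * |A|]
   times the squared gap [(t / 2 * |A|) ^ 2] between levels. *)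
pose kk (t : R) : nat := (Num.bound (32 / (kap * t ^+ 2))).+1.
have hkk t : 0 < t -> (0 < kk t)%N /\ 32 <= kap * t ^+ 2 * (kk t)%:R.
  move=> t0; split=> //; have p : 0 < kap * t ^+ 2 by rewrite mulr_gt0 // exprn_gt0.
  rewrite mulrC -ler_pdivrMr //; apply: ltW; apply: lt_le_trans (archi_boundP _) _.
    by rewrite divr_ge0 // ltW.
  by rewrite ler_nat.
have p5 t : 0 < 8 * 5 ^+ kk t :> R by rewrite mulr_gt0 // exprn_gt0.
pose th t : R := c / 320 / (8 * 5 ^+ kk t).
have th0 t : 0 < th t by rewrite divr_gt0 ?divr_gt0.
(* The heavy cell has at least [th t * |A|] elements; the next level is so low that the bad pairs of
   [A] for it are few even relative to the square of that size. *)
pose F t := Num.min (t / 2) (g * th t ^+ 2 / 6).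
have hF t : 0 < t -> 0 < F t <= t / 2.
  move=> t0; rewrite lt_min divr_gt0 //= ge_min lexx andbT divr_gt0 // mulr_gt0 // exprn_gt0 //.
have hFg t : 6 * F t <= g * th t ^+ 2 by rewrite mulrC -ler_pdivlMr // ge_min lexx orbT.
have [J hJ] : exists J : nat, 7 <= kap * J%:R.
  exists (Num.bound (7 / kap)); rewrite mulrC -ler_pdivrMr //.
  by apply/ltW/archi_boundP; rewrite divr_ge0 // ltW.
pose gam j := iter j F 1.
have gam0 j : 0 < gam j by elim: j => [|j IH]; [exact: ltr01|rewrite /gam /=; case/andP: (hF _ IH)].
(* The level [j] is known only once [A] is, so [D] and [C] list the demands of each level and their
   minima over [j < J] are used. *)
pose D j := Num.min (c / 4 * gam j.+1) (Num.min (1 / (4 * (kk (gam j))%:R)) (c / 16 / (2 * (8 * 5 ^+ kk (gam j))))).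
have D0 j : 0 < D j.
  rewrite !lt_min; apply/and3P; split.
  - by rewrite mulr_gt0 ?gam0 // divr_gt0.
  - by rewrite divr_gt0 // mulr_gt0 // ltr0n.
  - by rewrite divr_gt0 ?divr_gt0 // mulr_gt0.
have [d' d'0 hd'] := exists_min_positive J D0.
pose C j := Num.min (1 / (8 * 5 ^+ kk (gam j))) (c * th (gam j) / 256).
have C0 j : 0 < C j.
  rewrite lt_min; apply/andP; split.
  - by rewrite divr_gt0.
  - by rewrite divr_gt0 // mulr_gt0.
have [co co0 hco] := exists_min_positive J C0.
exists (c / 4), d', co; split=> //; first by rewrite divr_gt0.
move=> N A S A0 AN hS hb.
have n0 : 0 < A%:c by rewrite ltr0n card_gt0.
have S5 : S%:c <= 5 * A%:c by apply: le_trans hS _; rewrite ler_pM2r //; lra.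
have hD j : (j < J)%N -> [/\ d' <= c / 4 * gam j.+1, d' <= 1 / (4 * (kk (gam j))%:R) &
    d' <= c / 16 / (2 * (8 * 5 ^+ kk (gam j)))].
  by move=> jJ; have := hd' j jJ; rewrite /D le_min => /andP[h1]; rewrite le_min => /andP[h2 h3].
have hdj j : (j < J)%N -> d' <= iter j.+1 F 1 /\ 4 * (kk (iter j F 1))%:R * d' <= 1.
  move=> jJ; have [h1 h2 _] := hD j jJ; split.
    apply: le_trans h1 _; rewrite -[leRHS]mul1r ler_pM2r ?gam0 //; lra.
  by rewrite mulrC -ler_pdivlMr // mulr_gt0 // ltr0n.
have [j [T [jJ TA cT hT [hV badV]]]] := almost_invariant_level kap0 hkk hF hJ A0 S5 hb hdj.
have [d1 d2 d3] := hD j jJ.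
have := hco j jJ; rewrite le_min => /andP[co1 co2].
rewrite -/(gam j) in cT hT hV badV *; set t := gam j in d1 d2 d3 co1 co2 cT hT hV badV *.
set V := thick (F t) A A in hT hV badV *.
have {}p5 := p5 t.
have t0 : 0 < t by apply: gam0.
have Ft0 : 0 < F t by case/andP: (hF t t0).
(* Then [|A|] is bounded by [8 * 5 ^+ kk t], and a single point of [A] is a long enough
   progression. *)
have [T1|T1] := leqP #|T| 1.
  left; case/set0Pn: (A0) => a aA; exists (val a), 1%N, 1%N, [set a]; split=> //.
  - apply: le_trans (_ : 1 / (8 * 5 ^+ kk t) * A%:c <= _); first by rewrite ler_pM2r.
    rewrite mulrAC ler_pdivrMr // !mul1r; apply: le_trans cT _.
    by rewrite ler_piMr ?(ltW p5) // lern1.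
  - by rewrite cards1 mulr1; move: eps0; pure_lra.
  - by rewrite sub1set.
  by move=> y /set1P ->; exists 0%N; rewrite ?mul0n ?addn0.
have VN : {in V, forall v, 2 * val v <= N}%N.
  move=> v /(subsetP (thick_sub A Ft0 A0)) /sumsetP[a [b [aA bA ->]]].
  have h1 := AN _ aA; have h2 := AN _ bA.
  by rewrite valD; move: h1 h2; move: (val a) (val b); pure_lia.
have dT : 2 * d' * A%:c <= c / 16 * T%:c.
  apply: le_trans (_ : 2 * d' * (8 * 5 ^+ kk t * T%:c) <= _); first by rewrite ler_wpM2l // mulr_ge0 // ltW.
  rewrite mulrA ler_pM2r; last by rewrite ltr0n; apply: leq_trans T1.
  have -> : 2 * d' * (8 * 5 ^+ kk t) = d' * (2 * (8 * 5 ^+ kk t)).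
    by move: (8 * 5 ^+ kk t) => P; ring.
  by rewrite -ler_pdivlMr // mulr_gt0.
have V4 : V%:c <= (4 + (c / 4 + d' / F t)) * A%:c.
  by apply: le_trans hV _; rewrite addrA mulrDl lerD2r.
have ek : c / 4 + d' / F t + 4 * kap <= c.
  have : d' / F t <= c / 4 by rewrite ler_pdivrMr.
  by rewrite /kap; move: c0; move: (d' / F t); pure_lra.
have [q' [i [hU hSA hbad]]] := heavy_cell c0 c1 A0 AN VN TA T1 S5 hb dT hT V4 ek.
have hth : th t * A%:c <= (residue q' @: cell q' A i)%:c.
  apply: le_trans hSA; rewrite /th mulrAC ler_pdivrMr // -[leRHS]mulrA ler_pM2l ?divr_gt0 //.
  by rewrite mulrC.
have hbad2 : (bad (residue q' @: cell q' A i) (residue q' @: cell q' A i) (residue q' @: cell2 q' V i))%:R <=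
    g * (residue q' @: cell q' A i)%:c ^+ 2.
  apply: le_trans (_ : (bad A A V)%:R <= _); first by rewrite ler_nat.
  apply: le_trans badV _; apply: le_trans (_ : g * th t ^+ 2 * A%:c ^+ 2 <= _).
    by rewrite ler_wpM2r ?exprn_ge0.
  by rewrite -mulrA ler_pM2l // -exprMn lerXn2r ?nnegrE // mulr_ge0 // ltW ?th0.
have weak (x : R) : c * th t / 256 * A%:c <= x -> co * A%:c <= x.
  by apply: le_trans; rewrite ler_pM2r.
have [[x0 [r [n [Y [h1 h2 h3 h4 h5]]]]]|[x0 [a1 [a2 [n1 [n2 [Y [h1 h2 h3 h4 h5]]]]]]]] :=
  hcell N A V q' i (th t) A0 (th0 t) hth hU hbad2.
  by left; exists x0, r, n, Y; split=> //; apply: weak.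
by right; exists x0, a1, a2, n1, n2, Y; split=> //; apply: weak.
Qed.

End Dichotomy.

(** * Transfer between ordinals and finite sets of integers *)

Section CardFset.
Variables (T : finType) (K : choiceType).
Implicit Types (X : {set T}) (F : {fset K}) (f : T -> K).

Lemma leq_card_fset X F f : {in X &, injective f} -> (forall x, x \in X -> f x \in F) -> (#|X| <= #|` F|)%N.
Proof.
move=> inj XF; rewrite cardE -(size_map f); apply: uniq_leq_size.
  by rewrite map_inj_in_uniq ?enum_uniq // => x y; rewrite !mem_enum; apply: inj.
by move=> _ /mapP[x + ->]; rewrite mem_enum; apply: XF.
Qed.

Lemma card_fset_leq X F f : (forall y, y \in F -> exists2 x, x \in X & y = f x) -> (#|` F| <= #|X|)%N.
Proof.
move=> FX; rewrite [leqRHS]cardE -(size_map f); apply: uniq_leq_size; first exact: fset_uniq.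
by move=> y /FX[x xX ->]; apply: map_f; rewrite mem_enum.
Qed.

Lemma card_fset_eq X F f : {in X &, injective f} -> (forall y, y \in F <-> exists2 x, x \in X & y = f x) ->
  #|` F| = #|X|.
Proof.
move=> inj FX; apply/eqP; rewrite eqn_leq (card_fset_leq (f := f)) ?(leq_card_fset inj) //.
  by move=> x xX; apply/FX; exists x.
by move=> y /FX.
Qed.

End CardFset.

Section Progressions.

Lemma progression1 (a0 r : int) (n : nat) : (0 < n)%N -> r != 0 ->
  exists P : {fset int}, [/\ is_progression 1 P, #|` P| = n &
    forall i : nat, (i < n)%N -> a0 + r * i%:Z \in P].
Proof.
move=> n0 r0; pose P : {fset int} := [fset (a0 + r * (val i)%:Z)%R | i in 'I_n]%fset.
have PP y : y \in P <-> exists2 i : 'I_n, i \in [set: 'I_n] & y = a0 + r * (val i)%:Z.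
  split=> [/imfsetP[i /= _ ->]|[i _ ->]]; first by exists i; rewrite ?inE.
  by apply/imfsetP; exists i; rewrite ?inE.
exists P; split.
(* Coefficients of a progression start at 1, so the base point is one step back. *)
- exists (a0 - r), (fun _ => r), (fun _ => n); split=> // y; rewrite PP; split.
    case=> i _ ->; exists (fun _ => (val i).+1%:Z); split; last by rewrite big_ord1 -addn1 PoszD; ring.
    by move=> _; have := ltn_ord i => /= h; rewrite lez_nat h.
  case=> lc [hl ->]; have /andP[h1 h2] := hl ord0; rewrite big_ord1.
  have lt : (absz (lc ord0 - 1) < n)%N by move: h1 h2; move: (lc ord0); pure_lia.
  exists (Ordinal lt); first by rewrite inE.
  by rewrite /= gez0_abs ?subr_ge0 //; ring.
- rewrite (card_fset_eq _ PP) ?cardsT ?card_ord // => i j _ _ /addrI /(mulfI r0) [] /val_inj //.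
by move=> i iN; apply/PP; exists (Ordinal iN); rewrite ?inE.
Qed.

Lemma progression2 (a0 a1 a2 : int) (n1 n2 : nat) : (0 < n1)%N -> (0 < n2)%N ->
  (forall i i' k k' : nat, (i < n1)%N -> (i' < n1)%N -> (k < n2)%N -> (k' < n2)%N ->
     a0 + a1 * i%:Z + a2 * k%:Z = a0 + a1 * i'%:Z + a2 * k'%:Z -> i = i' /\ k = k') ->
  exists P : {fset int}, [/\ is_proper_progression 2 P, #|` P| = (n1 * n2)%N &
    forall i k : nat, (i < n1)%N -> (k < n2)%N -> a0 + a1 * i%:Z + a2 * k%:Z \in P].
Proof.
move=> n10 n20 inj; pose f (ik : 'I_n1 * 'I_n2) := a0 + a1 * (val ik.1)%:Z + a2 * (val ik.2)%:Z.
pose P : {fset int} := [fset f ik | ik in [set: 'I_n1 * 'I_n2]]%fset.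
have PP y : y \in P <-> exists2 ik : 'I_n1 * 'I_n2, ik \in [set: 'I_n1 * 'I_n2] & y = f ik.
  split=> [/imfsetP[i /= _ ->]|[i _ ->]]; first by exists i; rewrite ?inE.
  by apply/imfsetP; exists i; rewrite ?inE.
have cP : #|` P| = (n1 * n2)%N.
  rewrite (card_fset_eq _ PP) ?cardsT ?card_prod ?card_ord // => -[i k] [i' k'] _ _ e.
  by have [/val_inj -> /val_inj ->] := inj _ _ _ _ (ltn_ord i) (ltn_ord i') (ltn_ord k) (ltn_ord k') e.
exists P; split=> //; last first.
  by move=> i k iN kN; apply/PP; exists (Ordinal iN, Ordinal kN); rewrite ?inE.
pose a (i : 'I_2) := if val i == 0%N then a1 else a2.
pose Ln (i : 'I_2) := if val i == 0%N then n1 else n2.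
exists (a0 - a1 - a2), a, Ln; split; last by rewrite cP !big_ord_recl big_ord0 /= muln1.
split=> [i|y]; first by rewrite /Ln; case: ifP.
rewrite PP; split.
  case=> [[i k] _ ->]; exists (fun j : 'I_2 => if val j == 0%N then (val i).+1%:Z else (val k).+1%:Z); split.
    move=> j; rewrite /Ln; case: ifP => _; rewrite lez_nat; exact: ltn_ord.
  by rewrite /f !big_ord_recl big_ord0 /= -[(i : nat).+1]addn1 -[(k : nat).+1]addn1 !PoszD; ring.
case=> lc [hl ->]; have := hl ord0; have := hl (lift ord0 ord0); rewrite /Ln /= => /andP[k1 k2] /andP[i1 i2].
have li : (absz (lc ord0 - 1) < n1)%N by move: i1 i2; move: (lc ord0); pure_lia.
have lk : (absz (lc (lift ord0 ord0) - 1) < n2)%N by move: k1 k2; move: (lc (lift _ _)); pure_lia.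
exists (Ordinal li, Ordinal lk); first by rewrite inE.
by rewrite /f !big_ord_recl big_ord0 /= !gez0_abs ?subr_ge0 //; ring.
Qed.

End Progressions.

Section Transfer.
Variable R : realType.
Variables (A : {fset int}) (B : nat).
Hypothesis AB : forall a, a \in A -> (absz a <= B)%N.
Local Notation N := (8 * B)%N.
Local Notation I := 'I_N.+1.

Let psi (x : I) : int := (val x)%:Z - B%:Z.

Let psi_inj : injective psi.
Proof. by move=> x y /addIr [] /val_inj. Qed.

(** Adding [B] places [A] in [[0, 2B]], the first quarter of [[0, 8B]], where sums and cells do not
    wrap around. *)
Definition ordinal_copy : {set I} := [set x | psi x \in A].

Let psi_onto a : a \in A -> exists2 x : I, x \in ordinal_copy & a = psi x.
Proof.
move=> aA; have aB := AB aA; exists (inord (absz (a + B%:Z))).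
  rewrite inE /psi /= inordK; last by move: aB; pure_lia.
  by rewrite gez0_abs ?addrK //; move: aB; pure_lia.
rewrite /psi /= inordK; last by move: aB; pure_lia.
by rewrite gez0_abs ?addrK //; move: aB; pure_lia.
Qed.

Lemma card_ordinal_copy : #|ordinal_copy| = #|` A|.
Proof.
symmetry; apply: (card_fset_eq (f := psi)); first by move=> x y _ _ /psi_inj.
move=> y; split; first exact: psi_onto.
by case=> x; rewrite inE => h ->.
Qed.

Lemma ordinal_copy_small : {in ordinal_copy, forall a, 4 * val a <= N}%N.
Proof.
move=> x; rewrite inE => /AB; rewrite /psi; move: (val x) => v; pure_lia.
Qed.

Definition sum_copy (G : {fset int * int}) : {set I} :=
  [set x | (val x)%:Z - (2 * B)%N%:Z \in restricted_sumset G].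

Lemma card_sum_copy G : (#|sum_copy G| <= #|` restricted_sumset G|)%N.
Proof.
apply: (leq_card_fset (f := fun x : I => (val x)%:Z - (2 * B)%N%:Z)).
  by move=> x y _ _ /addIr [] /val_inj.
by move=> x; rewrite inE.
Qed.

Lemma bad_ordinal_copy G : (G `<=` A `*` A)%fset ->
  (bad ordinal_copy ordinal_copy (sum_copy G) + #|` G| <= #|` A| * #|` A|)%N.
Proof.
move=> GA; pose Gs := [set p : I * I | (psi p.1, psi p.2) \in G].
have cG : (#|` G| <= #|Gs|)%N.
  apply: (card_fset_leq (f := fun p => (psi p.1, psi p.2))) => -[a b] abG.
  have : (a, b) \in (A `*` A)%fset by apply: (fsubsetP GA).
  rewrite in_fsetM /= => /andP[/psi_onto[x xA ea] /psi_onto[y yA eb]].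
  by exists (x, y); rewrite ?inE /= -ea -eb.
have GsE : #|Gs| = (\sum_(x in ordinal_copy) \sum_(y in ordinal_copy) ((x, y) \in Gs : nat))%N.
  rewrite pair_big /= -sum1_card big_mkcond [RHS]big_mkcond; apply: eq_bigr => -[x y] _ /=.
  have [xyG|_] := boolP ((x, y) \in Gs); last by case: ifP.
  move: xyG; rewrite inE => /(fsubsetP GA); rewrite in_fsetM /= => /andP[xA yA].
  by rewrite !inE xA yA.
apply: leq_trans (leq_add (leqnn _) cG) _; rewrite GsE /bad -big_split /= -card_ordinal_copy.
rewrite -sum_nat_const; apply: leq_sum => x xA; rewrite -big_split /= -sum1_card; apply: leq_sum => y yA /=.
have [xyG|_] := boolP ((x, y) \in Gs); last by rewrite addn0; case: (_ \notin _).
rewrite addn1 ltnS leqn0 eqb0 negbK inE.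
have h1 := ordinal_copy_small xA; have h2 := ordinal_copy_small yA.
rewrite valD; last by move: h1 h2; move: (val x) (val y); pure_lia.
apply/imfsetP; exists (psi x, psi y) => /=; first by move: xyG; rewrite inE.
by rewrite /psi PoszD PoszM; ring.
Qed.

Lemma half_dense_ap_transfer (c eps : R) : half_dense_ap ordinal_copy c eps ->
  exists P : {fset int}, [/\ is_progression 1 P, c * #|` A|%:R <= #|` P|%:R &
    1 / 2 - eps <= #|` (A `&` P)%fset|%:R / #|` P|%:R].
Proof.
case=> x0 [r [n [Y [/andP[n0 r0] cn hY /subsetP YA YP]]]].
have [|P [P1 Pn PY]] := @progression1 (x0%:Z - B%:Z) r%:Z n n0; first by rewrite eqz_nat -lt0n.
exists P; split=> //; first by rewrite Pn -card_ordinal_copy.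
rewrite Pn ler_pdivlMr ?ltr0n //; apply: le_trans hY _; rewrite ler_nat.
apply: (leq_card_fset (f := psi)); first by move=> x y _ _ /psi_inj.
move=> y yY; rewrite in_fsetI; apply/andP; split; first by have := YA _ yY; rewrite inE.
have [i iN ey] := YP _ yY.
have -> : psi y = x0%:Z - B%:Z + r%:Z * i%:Z by rewrite /psi ey PoszD PoszM; ring.
exact: PY.
Qed.

Lemma dense_gap_transfer (c eps : R) : dense_gap ordinal_copy c eps ->
  exists Q : {fset int}, [/\ is_proper_progression 2 Q, c * #|` A|%:R <= #|` Q|%:R &
    1 - eps <= #|` (A `&` Q)%fset|%:R / #|` Q|%:R].
Proof.
case=> x0 [a1 [a2 [n1 [n2 [Y [/andP[n10 n20] cn inj hY YA]]]]]].
have sh u v : x0 - B%:Z + u + v = x0 + u + v - B%:Z by ring.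
have {}inj i i' k k' : (i < n1)%N -> (i' < n1)%N -> (k < n2)%N -> (k' < n2)%N ->
    x0 - B%:Z + a1 * i%:Z + a2 * k%:Z = x0 - B%:Z + a1 * i'%:Z + a2 * k'%:Z -> i = i' /\ k = k'.
  by rewrite !sh => iI iI' kI kI' /addIr; apply: inj.
have [Q [Q2 Qn QY]] := @progression2 (x0 - B%:Z) a1 a2 n1 n2 n10 n20 inj.
exists Q; split=> //; first by rewrite Qn -card_ordinal_copy.
rewrite Qn ler_pdivlMr ?ltr0n ?muln_gt0 ?n10 //; apply: le_trans hY _; rewrite ler_nat.
pose f (ik : 'I_n1 * 'I_n2) := x0 - B%:Z + a1 * (val ik.1)%:Z + a2 * (val ik.2)%:Z.
apply: (leq_card_fset (f := f)).
  move=> [i k] [i' k'] _ _ e.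
  by have [/val_inj -> /val_inj ->] := inj _ _ _ _ (ltn_ord i) (ltn_ord i') (ltn_ord k) (ltn_ord k') e.
move=> [i k] ikY; rewrite in_fsetI; apply/andP; split; last exact: (QY _ _ (ltn_ord i) (ltn_ord k)).
have [s + es] := YA _ ikY; rewrite inE.
have -> // : psi s = f (i, k).
by rewrite /psi es /f /=; ring.
Qed.

End Transfer.

Lemma fset_dichotomy (R : realType) (eps : R) : 0 < eps -> exists delta delta' c : R,
  [/\ 0 < delta, 0 < delta', 0 < c & forall (A : {fset int}) (G : {fset int * int}), A != fset0%fset ->
    (G `<=` A `*` A)%fset -> (1 - delta') * #|` A|%:R ^+ 2 <= #|` G|%:R ->
    #|` restricted_sumset G|%:R <= (4 + delta) * #|` A|%:R ->
    (exists P : {fset int}, [/\ is_progression 1 P, c * #|` A|%:R <= #|` P|%:R &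
      1 / 2 - eps <= #|` (A `&` P)%fset|%:R / #|` P|%:R]) \/
    (exists Q : {fset int}, [/\ is_proper_progression 2 Q, c * #|` A|%:R <= #|` Q|%:R &
      1 - eps <= #|` (A `&` Q)%fset|%:R / #|` Q|%:R])].
Proof.
move=> eps0; have [delta [delta' [c [d0 d'0 c0 h]]]] := ordinal_dichotomy eps0.
exists delta, delta', c; split=> // A G A0 GA hG hS.
pose B := (\max_(a <- A) absz a)%N.
have AB a : a \in A -> (absz a <= B)%N by move=> aA; apply: leq_bigmax_seq.
have [||||ap|gap] := h _ (ordinal_copy A B) (sum_copy B G).
- by rewrite -card_gt0 card_ordinal_copy // cardfs_gt0.
- exact: ordinal_copy_small.
- by rewrite card_ordinal_copy //; apply: le_trans hS; rewrite ler_nat card_sum_copy.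
- rewrite card_ordinal_copy //; have := bad_ordinal_copy AB GA; rewrite -(ler_nat R) natrD natrM -expr2.
  by move: hG; rewrite mulrBl mul1r; pure_lra.
- by left; apply: half_dense_ap_transfer ap.
by right; apply: dense_gap_transfer gap.
Qed.

Theorem corollary1p3 (R : realType) :
  (* [tdelta] and [tdelta'] are the thresholds for delta in terms of eps' and
     for delta' in terms of delta; [c] is delta |-> c_delta. *)
  exists tdelta tdelta' c : R -> R,
    (forall x : R, 0 < x -> [/\ 0 < tdelta x, 0 < tdelta' x & 0 < c x]) /\
    forall eps' delta delta' : R,
      0 < delta' -> delta' < delta -> delta < eps' -> eps' < 1 ->
      delta <= tdelta eps' -> delta' <= tdelta' delta ->
    forall A : {fset int}, A != fset0%fset ->
      (exists G : {fset int * int},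
        [/\ (G `<=` A `*` A)%fset,
            #|` G|%:R >= (1 - delta') * #|` A|%:R ^+ 2
          & #|` restricted_sumset G|%:R <= (4 + delta) * #|` A|%:R]) ->
      (exists P : {fset int},
        [/\ is_progression 1 P,
            #|` P|%:R >= c delta * #|` A|%:R
          & #|` (A `&` P)%fset|%:R / #|` P|%:R >= 1 / 2 - eps'])
      \/
      (exists Q : {fset int},
        [/\ is_proper_progression 2 Q,
            #|` Q|%:R >= c delta * #|` A|%:R
          & #|` (A `&` Q)%fset|%:R / #|` Q|%:R >= 1 - eps']).
Proof.
(* The constant [c delta] has to serve every [eps' > delta]; restricting to reciprocals of integers
   leaves finitely many cases for each [delta]. *)
have e0 k : 0 < k.+1%:R^-1 :> R by rewrite invr_gt0 ltr0n.
have [dl hdl] := choice (fun k : nat => fset_dichotomy (e0 k)).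
have [dl' hdl'] := choice hdl.
have [cc hcc] := choice hdl'.
have d0 k : 0 < dl k by case: (hcc k).
have d'0 k : 0 < dl' k by case: (hcc k).
have c0 k : 0 < cc k by case: (hcc k).
have minima (f : nat -> R) (f0 : forall j, 0 < f j) J :
    exists m, 0 < m /\ forall j, (j < J)%N -> m <= f j.
  by have [m m0 hm] := exists_min_positive J f0; exists m.
have [md' hmd'] := choice (minima dl' d'0).
have [mc hmc] := choice (minima cc c0).
(* [eps'] is rounded down to [1/(j+1)]. The constants attached to [delta] are minima
   over all [j < 1/delta], which covers this [j] because [delta <= 1/(j+1)]. *)
pose k (x : R) := Num.bound x^-1.
exists (fun x => Num.min (dl (k x)) (k x).+1%:R^-1), (fun x => md' (k x)), (fun x => mc (k x)); split.
  move=> x x0; split; first by rewrite lt_min d0 e0.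
    by case: (hmd' (k x)).
  by case: (hmc (k x)).
move=> eps' delta delta' delta'0 dd' de e1; rewrite le_min => /andP[h1 h2] h3 A A0 [G [GA hG hS]].
have del0 : 0 < delta := lt_trans delta'0 dd'.
have eps0 : 0 < eps' := lt_trans del0 de.
pose j := k eps'.
have bnd (x : R) : 0 < x -> x^-1 < (k x)%:R.
  by move=> x0; apply: archi_boundP; rewrite invr_ge0 ltW.
have jk : (j < k delta)%N.
  rewrite -(ltr_nat R); apply: le_lt_trans (bnd _ del0).
  apply: le_trans (_ : j.+1%:R <= _); first by rewrite ler_nat.
  by rewrite -[leLHS]invrK lef_pV2 // posrE ?invr_gt0 ?ltr0n.
have je : j.+1%:R^-1 <= eps'.
  rewrite -[leRHS]invrK lef_pV2 ?posrE ?invr_gt0 ?ltr0n //.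
  by apply: ltW; apply: lt_le_trans (bnd _ eps0) _; rewrite ler_nat.
have [_ _ _ /(_ A G A0 GA)] := hcc j; case.
- apply: le_trans hG; rewrite ler_wpM2r ?exprn_ge0 // lerD2l lerN2.
  by apply: le_trans h3 _; apply: (hmd' (k delta)).2.
- by apply: le_trans hS _; rewrite ler_wpM2r // lerD2l.
- case=> P [P1 Pc Pd]; left; exists P; split=> //.
    by apply: le_trans Pc; rewrite ler_wpM2r //; apply: (hmc (k delta)).2.
  by apply: le_trans Pd; rewrite lerD2l lerN2.
case=> Q [Q1 Qc Qd]; right; exists Q; split=> //.
  by apply: le_trans Qc; rewrite ler_wpM2r //; apply: (hmc (k delta)).2.
by apply: le_trans Qd; rewrite lerD2l lerN2.
Qed.
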